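(* Let $f$ be a transcendental entire function and let $(a_n)_{n\in\mathbb{N}}$ be a sequence of positive real numbers with $a_n\to\infty$ as $n\to\infty$. Let $$I(f,(a_n))=\{z\in\mathbb{C}: |f^n(z)|\geq a_n\ \text{ for all } n\in\mathbb{N}\}.$$ Suppose that: (i) for every $n\in\mathbb{N}$, the disc $D(0,a_n)$ contains a periodic cycle of $f$; (ii) the complement $I(f,(a_n))^c=\mathbb{C}\setminus I(f,(a_n))$ has a bounded component; (iii) the sequence $(a_n)$ is increasing and $a_{n+1}\leq M(a_n)$ for all $n\in\mathbb{N}$, where $M(r)=\max_{|z|=r}|f(z)|$ for $r>0$. Then $I(f,(a_n))$ contains a spider's web.
   Context: $f^n$ denotes the $n$th iterate of $f$, $\mathbb{N}=\{1,2,\dots\}$, $D(0,r)=\{z:|z|<r\}$, and ''component'' means connected component. A set $E\subset\mathbb{C}$ is an (infinite) spider's web if $E$ is connected and there exists a sequence $(G_n)_{n\in\mathbb{N}}$ of bounded simply connected domains with $G_n\subset G_{n+1}$ and $\partial G_n\subset E$ for all $n\in\mathbb{N}$, and $\bigcup_{n\in\mathbb{N}}G_n=\mathbb{C}$. ''A set contains a spider's web'' means that it has a subset which is a spider's web. *)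

(* Defs.v *)
(* MathComp-Analysis; the complex plane is [R[i]] for [R : realType]. *)
From HB Require Import structures.
From mathcomp Require Import all_boot all_order all_algebra.
From mathcomp Require Import complex.
From mathcomp Require Import all_classical all_reals all_analysis.

Set Implicit Arguments.
Unset Strict Implicit.
Unset Printing Implicit Defensive.

Import Order.TTheory GRing.Theory Num.Theory.
Import numFieldNormedType.Exports.

Local Open Scope classical_set_scope.
Local Open Scope ring_scope.

(* The generic instances of [numFieldNormedType.Exports] do not fire on the
   concrete carrier [R[i]].  Here [R[i]] is normed over itself, so that
   [derivable f z 1] below is complex differentiability. *)
HB.instance Definition _ (R : realType) := GRing.ComAlgebra.copy R[i] R[i]^o.
HB.instance Definition _ (R : realType) := Vector.copy R[i] R[i]^o.
HB.instance Definition _ (R : realType) := NormedModule.copy R[i] R[i]^o.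

(* The modulus as an element of [R]; the norm [`|z|] lives in [R[i]], with
   [`|z| = (cmod z)%:C]. *)
Notation cmod := Normc.normc.

Section ComplexPlane.
Variable R : realType.
Local Notation C := R[i].

Definition entire (f : C -> C) : Prop :=
  forall z : C, derivable f z (1 : C).

Definition transcendental_entire (f : C -> C) : Prop :=
  entire f /\ ~ exists p : {poly C}, forall z : C, f z = p.[z].

(* For continuous [f] and [r >= 0] this supremum is taken over a nonempty
   compact set, hence is the maximum. *)
Definition max_modulus (f : C -> C) (r : R) : R :=
  sup [set cmod (f z) | z in [set z : C | cmod z = r]].

Definition disc0 (r : R) : set C := [set z : C | cmod z < r].

Definition periodic_cycle (f : C -> C) (O : set C) : Prop :=
  exists (z : C) (p : nat),
    [/\ (0 < p)%N, iter p f z = z & O = [set iter k f z | k in [set: nat]]].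

(* [a 0] is irrelevant: sequences are indexed by the positive integers. *)
Definition escaping_at_rate (f : C -> C) (a : nat -> R) : set C :=
  [set z : C | forall n : nat, (0 < n)%N -> a n <= cmod (iter n f z)].

Definition has_bounded_component (A : set C) : Prop :=
  exists2 z : C, A z & bounded_set (connected_component A z).

Definition boundary (A : set C) : set C := closure A `\` interior A.

Definition domain (G : set C) : Prop :=
  [/\ open G, connected G & G !=set0].

Definition closed_curve_in (G : set C) (g : R -> C) : Prop :=
  [/\ {within `[0, 1], continuous g}, g 0 = g 1 & g @` `[0, 1] `<=` G].

(* Free homotopy through closed curves in [G] from [g] to a constant curve. *)
Definition null_homotopic_in (G : set C) (g : R -> C) : Prop :=
  exists (H : R * R -> C) (c : C),
    [/\ {within `[0, 1] `*` `[0, 1], continuous H},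
        H @` (`[0, 1] `*` `[0, 1]) `<=` G,
        forall t, t \in `[0, 1] -> H (0, t) = g t,
        forall t, t \in `[0, 1] -> H (1, t) = c
      & forall s, s \in `[0, 1] -> H (s, 0) = H (s, 1)].

Definition simply_connected_domain (G : set C) : Prop :=
  domain G /\ forall g, closed_curve_in G g -> null_homotopic_in G g.

Definition spiders_web (E : set C) : Prop :=
  connected E /\
  exists G : nat -> set C,
    [/\ forall n, bounded_set (G n) /\ simply_connected_domain (G n),
        forall n, G n `<=` G n.+1,
        forall n, boundary (G n) `<=` E
      & \bigcup_n G n = [set: C]].

End ComplexPlane.

(* Main.v *)
Require Import Defs.
From HB Require Import structures.
From mathcomp Require Import all_boot all_order all_algebra.
From mathcomp Require Import complex.
From mathcomp Require Import all_classical all_reals all_analysis.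
From mathcomp Require Import ring lra zify.

Set Implicit Arguments.
Unset Strict Implicit.
Unset Printing Implicit Defensive.

Import Order.TTheory GRing.Theory Num.Theory.
Import numFieldNormedType.Exports.

Local Open Scope classical_set_scope.
Local Open Scope ring_scope.

(* Let U be a bounded component of the complement of I = I(f,(a_n)) and z0 in U,
   with |f^n(z0)| < a_n.  By the maximum principle for 1/(h - q), the boundary of
   h(V) lies in h(boundary of V) for every entire h and bounded open V.  Hence
   f^n(U) contains D(0,a_n), and the component T_n of 0 in its interior has its
   boundary in {z : |f^k(z)| >= a_(n+k) for all k}.  A point of a cycle inside
   D(0,a_n) lies in T_n, so f(T_n) meets D(0,a_(n+1)) and the construction can be
   repeated: it gives domains T_m containing D(0,a_m) with boundaries in I.
   Filling the holes makes T_m simply connected with a connected boundary.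

   The component E of I containing the boundary of T_n is unbounded: otherwise
   some bounded open set W containing T_n has its boundary outside I.  But
   f^k(W) contains D(0,a_(n+k)) for all k, and a point z of the boundary of W
   which, for each k, is a limit of points mapped by f^k outside f^k(closure W)
   then lies in I; such a z exists, again by the maximum principle.  As E is
   unbounded and connected, it meets, hence contains, the boundaries of all T_m
   with m large. *)

(** * Topology of the plane *)

(** The maximum principle applied to f^N gives, for each N, a boundary point of W that is good up to
    time N only, and these points vary with N. Hence the conditions for all k <= N are treated as
    decreasing closed subsets of the compact boundary. The periodic point also shows that no iterate
    is constant, which this use of the maximum principle needs.

    Simple connectivity is defined by free homotopy, whereas filling holes only yields a complement
    joined to infinity. The passage is discrete: a closed curve is deformed into a closed lattice
    walk, every square around which the walk winds lies in the domain, and the walk is contracted by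
    pushes across such squares. The connectedness of the boundary comes from that of the domain and
    of its complement, through a real lift of a function known modulo 1.

    Complex differentiability is a pointwise hypothesis, so Green's theorem is proved by Goursat's
    bisection; the mean value property and the maximum principles follow from it. *)

Section PlaneTopology.
Variable R : realType.
Local Notation C := R[i].
Implicit Types (z w : C) (A B : set C).

Definition cball z (r : R) : set C := [set w | cmod (w - z) < r].

Lemma normE z : `|z| = (cmod z)%:C%C.
Proof. by case: z. Qed.

Lemma cmod_ge0 z : 0 <= cmod z.
Proof. by case: z => a b; exact: sqrtr_ge0. Qed.

Lemma cmodD z w : cmod (z + w) <= cmod z + cmod w.
Proof. exact: le_normcD. Qed.

Lemma cmodN z : cmod (- z) = cmod z.
Proof. exact: normcN. Qed.

Lemma cmodM z w : cmod (z * w) = cmod z * cmod w.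
Proof. exact: Normc.normcM. Qed.

Lemma cmodV z : cmod z^-1 = (cmod z)^-1.
Proof. exact: Normc.normcV. Qed.

Lemma cmod0 : cmod (0 : C) = 0.
Proof. exact: Normc.normc0. Qed.

Lemma cmod1 : cmod (1 : C) = 1.
Proof. exact: Normc.normc1. Qed.

Lemma cmodX z n : cmod (z ^+ n) = cmod z ^+ n.
Proof. by elim: n => [|n IHn]; rewrite ?expr0 ?cmod1 // !exprS cmodM IHn. Qed.

Lemma cmod_eq0 z : (cmod z == 0) = (z == 0).
Proof.
by apply/eqP/eqP => [/Normc.eq0_normc//|->]; exact: cmod0.
Qed.

Lemma cmod_gt0 z : (0 < cmod z) = (z != 0).
Proof. by rewrite lt_def cmod_ge0 andbT cmod_eq0. Qed.

Lemma cmodB z w : cmod (z - w) = cmod (w - z).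
Proof. by rewrite -cmodN opprB. Qed.

Lemma cmodB_trans y z w : cmod (z - w) <= cmod (z - y) + cmod (y - w).
Proof. by have := cmodD (z - y) (y - w); rewrite addrA subrK. Qed.

Lemma cmodB_ge z w : cmod z - cmod w <= cmod (z - w).
Proof. by rewrite lerBlDr; have := cmodD (z - w) w; rewrite subrK. Qed.

Lemma cmod_real (r : R) : cmod (r%:C)%C = `|r|.
Proof. by rewrite /= expr0n addr0 sqrtr_sqr. Qed.

Lemma Re_le_cmod z : `|complex.Re z| <= cmod z.
Proof.
case: z => a b /=; rewrite -sqrtr_sqr ler_sqrt ?lerDl ?sqr_ge0 //.
by rewrite addr_ge0 ?sqr_ge0.
Qed.

Lemma Im_le_cmod z : `|complex.Im z| <= cmod z.
Proof.
case: z => a b /=; rewrite -sqrtr_sqr ler_sqrt ?lerDr ?sqr_ge0 //.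
by rewrite addr_ge0 ?sqr_ge0.
Qed.

Lemma cmod_le_ReIm z : cmod z <= `|complex.Re z| + `|complex.Im z|.
Proof.
case: z => a b /=; have h : 0 <= `|a| + `|b| by rewrite addr_ge0.
rewrite -(ger0_norm h) -sqrtr_sqr ler_sqrt ?sqr_ge0 //.
by rewrite sqrrD !real_normK ?num_real // addrAC lerDl mulrn_wge0 // mulr_ge0.
Qed.

(** The norm of [R[i]] takes values in [R[i]]; a positive element there is real, so balls of real
    radius form a basis of neighbourhoods. *)
Lemma nbhs_cballP z A : nbhs z A <-> exists2 r : R, 0 < r & cball z r `<=` A.
Proof.
split=> [/nbhs_ballP[e /= e0 eA]|[r r0 rA]].
  have er : e = (complex.Re e)%:C%C by rewrite RRe_real ?gtr0_real.
  exists (complex.Re e); first by rewrite -ltcR -er.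
  move=> w zw; apply: eA; rewrite -ball_normE /ball_ /= er normE ltcR.
  by rewrite cmodB.
apply/nbhs_ballP; exists (r%:C%C); first by rewrite /= ltcR.
move=> w; rewrite -ball_normE /ball_ /= normE ltcR => zw; apply: rA.
by rewrite /cball /= cmodB.
Qed.

Lemma openP A : open A <-> forall z, A z -> exists2 r : R, 0 < r & cball z r `<=` A.
Proof.
rewrite openE; split=> Ao z Az; first exact/nbhs_cballP/Ao.
by apply/nbhs_cballP/Ao.
Qed.

Lemma cball_center z r : 0 < r -> cball z r z.
Proof. by rewrite /cball /= subrr cmod0. Qed.

Lemma cball_open z r : open (cball z r).
Proof.
apply/openP => w zw; exists (r - cmod (w - z)); first by rewrite subr_gt0.
move=> y; rewrite /cball /= ltrBrDr => yw.
exact: le_lt_trans (cmodB_trans w y z) yw.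
Qed.

Lemma closureP A z :
  closure A z <-> forall r : R, 0 < r -> exists2 w, A w & cmod (w - z) < r.
Proof.
split=> [clA r r0|H B /nbhs_cballP[r r0 rB]].
  have [|w [Aw zw]] := clA (cball z r); last by exists w.
  by apply/nbhs_cballP; exists r.
by have [w Aw zw] := H r r0; exists w; split => //; exact: rB.
Qed.

Lemma interiorP A z : interior A z <-> exists2 r : R, 0 < r & cball z r `<=` A.
Proof. exact: nbhs_cballP. Qed.

Lemma continuousP (f : C -> C) z : {for z, continuous f} <->
  forall e : R, 0 < e -> exists2 d : R, 0 < d &
    forall w, cmod (w - z) < d -> cmod (f w - f z) < e.
Proof.
split=> [cf e e0|H B /nbhs_cballP[e e0 eB]].
  have /nbhs_cballP[d d0 dB] : nbhs z (f @^-1` cball (f z) e).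
    by apply: cf; apply/nbhs_cballP; exists e.
  by exists d => // w zw; exact: dB.
have [d d0 dB] := H e e0; apply/nbhs_cballP; exists d => // w zw.
by apply: eB; exact: dB.
Qed.

Lemma cmod_continuous : continuous (fun z : C => cmod z).
Proof.
move=> z B /nbhs_ballP[e /= e0 eB]; apply/nbhs_cballP; exists e => // w zw.
apply: eB; rewrite /ball /=; apply: le_lt_trans zw; rewrite ler_norml.
by rewrite lerNl opprB cmodB_ge cmodB cmodB_ge.
Qed.

Lemma boundedP A : bounded_set A <-> exists M : R, forall z, A z -> cmod z <= M.
Proof.
split=> [[M [Mr HM]]|[M HM]].
  have M1 : M < M + 1 by rewrite ltrDl.
  (* [bounded_set] gives a bound only for numbers strictly above [M]; hence [M + 1]. *)
  exists (complex.Re (M + 1)) => z Az.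
  have zM : (cmod z)%:C%C <= M + 1 := HM _ M1 z Az.
  by rewrite -lecR RRe_real // realD ?real1.
exists (M%:C)%C; split; first by apply/complex_realP; exists M.
move=> x Mx z Az; apply: (le_trans _ (ltW Mx)).
have zM : (cmod z)%:C%C <= (M%:C)%C by rewrite lecR HM.
exact: zM.
Qed.

Lemma complex_cvg (p : R * R) :
  {for p, continuous (fun p : R * R => (p.1 +i* p.2)%C : C)}.
Proof.
move=> B /nbhs_cballP[e e0 eB].
have e2 : 0 < e / 2 by rewrite divr_gt0.
apply/nbhs_ballP; exists (e / 2) => //= q [/= q1 q2]; apply: eB.
move: q1 q2; rewrite /ball /= => q1 q2.
apply: (le_lt_trans (cmod_le_ReIm _)) => /=.
by rewrite (splitr e) ltrD // distrC.
Qed.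

(** A closed disc is a closed subset of the image of a square, which is compact as a product of
    segments. *)
Lemma closed_disc_compact r : compact [set z : C | cmod z <= r].
Proof.
pose g := fun p : R * R => (p.1 +i* p.2)%C : C.
have cK : compact (g @` (`[- r, r] `*` `[- r, r])).
  apply: continuous_compact.
    by apply: continuous_subspaceT => p; exact: complex_cvg.
  by apply: compact_setX; exact: segment_compact.
apply: (subclosed_compact _ cK).
  rewrite (_ : [set z | _] = (fun z : C => cmod z) @^-1` [set x | x <= r]) //.
  by apply: closed_comp => [z _|]; [exact: cmod_continuous|exact: closed_le].
move=> [a b] zr; exists (a, b) => //=.
have := le_trans (Re_le_cmod _) zr; have := le_trans (Im_le_cmod _) zr.
by rewrite /= !ler_norml; split; rewrite /= in_itv.
Qed.

Lemma compactP A : closed A -> bounded_set A -> compact A.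
Proof.
move=> clA /boundedP[M HM].
by apply: (subclosed_compact clA (@closed_disc_compact M)) => z /HM.
Qed.

End PlaneTopology.

(** * Green's theorem for differentiable functions *)

Section SegmentIntegral.
Variable R : realType.
Implicit Types (f g : R -> R) (a b c : R).

Definition cont_on f a b := forall x, a <= x <= b -> forall e, 0 < e ->
  exists2 d, 0 < d & forall y, a <= y <= b -> `|y - x| < d -> `|f y - f x| < e.

Definition segint f a b : R := \int[lebesgue_measure]_(x in `[a, b]) f x.

Lemma cont_on_within f a b : cont_on f a b -> {within `[a, b], continuous f}.
Proof.
move=> cf; apply/subspace_continuousP => x /=; rewrite in_itv /= => xab.
move=> B /nbhs_ballP[e /= e0 eB]; have [d d0 dP] := cf x xab e e0.
apply/nbhs_ballP; exists d => //= y xy /=; rewrite in_itv /= => yab.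
by apply: eB; rewrite /ball /= distrC dP // distrC.
Qed.

Lemma cont_on_integrable f a b : cont_on f a b ->
  lebesgue_measure.-integrable `[a, b] (EFin \o f).
Proof.
move=> cf; apply: continuous_compact_integrable; first exact: segment_compact.
exact: cont_on_within.
Qed.

Lemma cont_onS f a b c d : a <= c -> d <= b -> cont_on f a b -> cont_on f c d.
Proof.
move=> ac db cf x /andP[cx xd] e e0.
have [|r r0 rP] := cf x _ e e0; first by rewrite (le_trans ac) ?(le_trans xd).
exists r => // y /andP[cy yd]; apply: rP.
by rewrite (le_trans ac) ?(le_trans yd).
Qed.

Lemma segintD f a b c : a <= b -> b <= c -> cont_on f a c ->
  segint f a c = segint f a b + segint f b c.
Proof.
move=> ab bc cf; have cbc := cont_onS ab (lexx _) cf.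
have := @Rintegral_itvB _ f (BLeft a) (BRight c) b (cont_on_integrable cf).
rewrite !bnd_simp => /(_ ab bc) /eqP; rewrite subr_eq => /eqP.
rewrite addrC /segint => ->; congr (_ + _).
rewrite Rintegral_itv_obnd_cbnd //.
apply: integrableS (cont_on_integrable cbc) => //.
by apply: subset_itvr; rewrite bnd_simp.
Qed.

Lemma segintB f g a b : cont_on f a b -> cont_on g a b ->
  segint (fun x => f x - g x) a b = segint f a b - segint g a b.
Proof. by move=> cf cg; apply: RintegralB => //; exact: cont_on_integrable. Qed.

Lemma eq_segint f g a b : (forall x, a <= x <= b -> f x = g x) ->
  segint f a b = segint g a b.
Proof.
by move=> fg; apply: eq_Rintegral => x; rewrite inE /= in_itv /=; exact: fg.
Qed.

Lemma segint_cst k a b : a <= b -> segint (fun=> k) a b = k * (b - a).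
Proof.
move=> ab; rewrite /segint Rintegral_cst //= lebesgue_measure_itv /= lte_fin.
case: ltP => [_|ba]; first by rewrite -EFinB.
have -> : a = b by apply/le_anti; rewrite ab.
by rewrite /= subrr.
Qed.

Lemma le_segint f g a b : cont_on f a b -> cont_on g a b ->
  (forall x, a <= x <= b -> f x <= g x) -> segint f a b <= segint g a b.
Proof.
move=> cf cg fg; apply: le_Rintegral => //; exact: cont_on_integrable.
Qed.

Lemma cont_on_cst k a b : cont_on (fun=> k) a b.
Proof. by move=> x _ e e0; exists 1 => // y _ _; rewrite subrr normr0. Qed.

Lemma cont_onB f g a b :
  cont_on f a b -> cont_on g a b -> cont_on (fun x => f x - g x) a b.
Proof.
move=> cf cg x xab e e0; have e2 : 0 < e / 2 by rewrite divr_gt0.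
have [d d0 dP] := cf x xab _ e2; have [d' d'0 dP'] := cg x xab _ e2.
exists (Num.min d d'); first by rewrite lt_min d0.
move=> y yab; rewrite lt_min => /andP[/(dP _ yab) h1 /(dP' _ yab) h2].
have -> : f y - g y - (f x - g x) = (f y - f x) - (g y - g x) by ring.
by rewrite (splitr e); apply: le_lt_trans (ler_normB _ _) _; rewrite ltrD.
Qed.

Lemma segint_near k M f a b : a <= b -> cont_on f a b ->
  (forall x, a <= x <= b -> `|f x - k| <= M) ->
  `|segint f a b - k * (b - a)| <= M * (b - a).
Proof.
move=> ab cf fM; rewrite ler_distl; apply/andP; split.
  rewrite -mulrBl -segint_cst //; apply: le_segint => //; first exact: cont_on_cst.
  by move=> x /fM; rewrite ler_distl => /andP[].
rewrite -mulrDl -segint_cst //; apply: le_segint => //; first exact: cont_on_cst.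
by move=> x /fM; rewrite ler_distl => /andP[].
Qed.

(** A positive value [f x] keeps [f] above [f x / 2] on a subinterval of positive length, and this
    already makes the integral positive. *)
Lemma segint_eq0 f a b : a < b -> cont_on f a b ->
  (forall x, a <= x <= b -> 0 <= f x) -> segint f a b = 0 ->
  forall x, a <= x <= b -> f x = 0.
Proof.
move=> ab cf f0 If x xab; apply/eqP; rewrite -[_ == _]negbK; apply/negP => fx0.
have fx : 0 < f x by rewrite lt_def fx0 f0.
have e0 : 0 < f x / 2 by rewrite divr_gt0.
have [d d0 dP] := cf x xab _ e0.
pose c := Num.max a (x - d / 2); pose c' := Num.min b (x + d / 2).
have d2 : 0 < d / 2 by rewrite divr_gt0.
have /andP[ax xb] := xab.
have ac : a <= c by rewrite le_max lexx.
have cb : c' <= b by rewrite ge_min lexx.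
have cc : c < c'.
  rewrite lt_min !gt_max; case: (ltgtP x b) xb => // [xb _|-> _].
    by rewrite ab /= (le_lt_trans _ xb) ?(ltrD2r, lerBlDr, lerDl, ltW) //=; lra.
  by rewrite ab /=; lra.
have near y : c <= y <= c' -> f x / 2 <= f y.
  rewrite ge_max le_min -andbA => /and4P[ay h1 yb h2].
  have : `|f y - f x| < f x / 2.
    apply: dP; first by rewrite ay yb.
    by rewrite ltr_distl; apply/andP; split; lra.
  by rewrite ltr_distl => /andP[h _]; lra.
have acc' : a <= c' by rewrite (le_trans ac) // ltW.
have If' := If; rewrite (segintD acc' cb) // in If'.
have cf1 : cont_on f a c' by exact: cont_onS cf.
have cf2 : cont_on f c' b by exact: cont_onS cf.
rewrite (segintD ac (ltW cc) cf1) in If'.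
have pos u v : a <= u -> v <= b -> 0 <= segint f u v.
  move=> au vb; apply: Rintegral_ge0 => y /=; rewrite in_itv /= => /andP[uy yv].
  by apply: f0; rewrite (le_trans au) ?(le_trans yv).
have := pos a c (lexx _) (le_trans (ltW cc) cb).
have := pos c' b acc' (lexx _).
have : f x / 2 * (c' - c) <= segint f c c'.
  rewrite -(segint_cst _ (ltW cc)); apply: le_segint => //; first exact: cont_on_cst.
  exact: cont_onS cf.
have : 0 < f x / 2 * (c' - c) by rewrite mulr_gt0 // subr_gt0.
move: If'; lra.
Qed.

End SegmentIntegral.

(** * Nested bisection of rectangles *)

Section Bisection.
Variable R : realType.

(** [q.1] holds the ends of the first side and [q.2] those of the second. *)
Definition rect : Type := R * R * (R * R).
Implicit Types q : rect.

Let wf q := q.1.1 <= q.1.2 /\ q.2.1 <= q.2.2.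

Let half (I J : R * R) :=
  J = (I.1, (I.1 + I.2) / 2) \/ J = ((I.1 + I.2) / 2, I.2).

(** Since every bad rectangle has a bad quarter, nested bad quarters shrink to a point, which thus
    lies in arbitrarily small bad rectangles. *)
Lemma bisect_point (bad : rect -> Prop) q0 : wf q0 -> bad q0 ->
  (forall q, wf q -> bad q -> exists q',
     [/\ bad q', half q.1 q'.1 & half q.2 q'.2]) ->
  exists s t, [/\ q0.1.1 <= s <= q0.1.2, q0.2.1 <= t <= q0.2.2 &
    forall d, 0 < d -> exists q, [/\ bad q, wf q,
      [/\ q0.1.1 <= q.1.1, q.1.2 <= q0.1.2, q0.2.1 <= q.2.1 & q.2.2 <= q0.2.2],
      [/\ q.1.1 <= s <= q.1.2 & q.2.1 <= t <= q.2.2] &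
      [/\ q.1.2 - q.1.1 < d & q.2.2 - q.2.1 < d]]].
Proof.
move=> wf0 bad0 Hb.
have [nxt nxtP] : {nxt : rect -> rect & forall q, wf q -> bad q ->
    [/\ bad (nxt q), half q.1 (nxt q).1 & half q.2 (nxt q).2]}.
  apply: (@choice _ _ (fun q q' => wf q -> bad q ->
    [/\ bad q', half q.1 q'.1 & half q.2 q'.2])) => q.
  have [[w b]|nwb] := pselect (wf q /\ bad q).
    by have [q' q'P] := Hb q w b; exists q'.
  by exists q => w b; case: nwb.
pose Q n := iter n nxt q0.
have QS n : Q n.+1 = nxt (Q n) by [].
have QP n : wf (Q n) /\ bad (Q n).
  elim: n => [//|n [w b]]; rewrite QS; have [b' h1 h2] := nxtP _ w b.
  by split=> //; case: w; split; [case: h1 => ->|case: h2 => ->] => /=; lra.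
have step n : [/\ (Q n).1.1 <= (Q n.+1).1.1, (Q n.+1).1.2 <= (Q n).1.2,
    (Q n).2.1 <= (Q n.+1).2.1 & (Q n.+1).2.2 <= (Q n).2.2] /\
    ((Q n.+1).1.2 - (Q n.+1).1.1 = ((Q n).1.2 - (Q n).1.1) / 2 /\
    (Q n.+1).2.2 - (Q n.+1).2.1 = ((Q n).2.2 - (Q n).2.1) / 2).
  have [[w1 w2] b] := QP n; rewrite QS; have [_ h1 h2] := nxtP _ (conj w1 w2) b.
  split; split.
  - by case: h1 => -> /=; lra.
  - by case: h1 => -> /=; lra.
  - by case: h2 => -> /=; lra.
  - by case: h2 => -> /=; lra.
  - by case: h1 => -> /=; lra.
  - by case: h2 => -> /=; lra.
have mono m n : (m <= n)%N ->
   [/\ (Q m).1.1 <= (Q n).1.1, (Q n).1.2 <= (Q m).1.2,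
    (Q m).2.1 <= (Q n).2.1 & (Q n).2.2 <= (Q m).2.2].
  move=> /subnK <-; elim: (n - m)%N => [//|k [h1 h2 h3 h4]]; rewrite addSn.
  by have [[g1 g2 g3 g4] _] := step (k + m)%N; split; lra.
have len n : (Q n).1.2 - (Q n).1.1 = (q0.1.2 - q0.1.1) / 2 ^+ n /\
    (Q n).2.2 - (Q n).2.1 = (q0.2.2 - q0.2.1) / 2 ^+ n.
  elim: n => [|n [h1 h2]]; first by rewrite expr0 !divr1.
  have [_ [-> ->]] := step n; rewrite h1 h2 exprSr invfM.
  by rewrite !mulrA.
have lu m n : (Q m).1.1 <= (Q n).1.2 /\ (Q m).2.1 <= (Q n).2.2.
  have [[w1 w2] _] := QP (maxn m n).
  have [h1 _ h3 _] := mono _ _ (leq_maxl m n).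
  by have [_ h2 _ h4] := mono _ _ (leq_maxr m n); split; lra.
have lim (u v : nat -> R) : (forall m n, u m <= v n) ->
    exists x, forall n, u n <= x <= v n.
  move=> uv; exists (sup (range u)) => n; apply/andP; split.
    by apply: ub_le_sup; [exists (v 0%N) => _ [m _ <-]|exists n].
  by apply: ge_sup; [exists (u 0%N); exists 0%N|move=> _ [m _ <-]].
have [s sP] := lim (fun n => (Q n).1.1) (fun n => (Q n).1.2)
  (fun m n => (lu m n).1).
have [t tP] := lim (fun n => (Q n).2.1) (fun n => (Q n).2.2)
  (fun m n => (lu m n).2).
exists s, t; split; [exact: (sP 0%N)|exact: (tP 0%N)|] => d d0.
pose L := (q0.1.2 - q0.1.1) + (q0.2.2 - q0.2.1) + 1.
have [w1 w2] := wf0.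
have [n nP] : exists n, L / 2 ^+ n < d.
  pose k := Num.truncn (L / d); exists k.+1.
  have Ld : L / d < k.+1%:R by apply: truncnS_gt.
  rewrite ltr_pdivrMr ?exprn_gt0 // mulrC -ltr_pdivrMr //.
  apply: lt_trans Ld _; rewrite -natrX ltr_nat; exact: ltn_expl.
have [l1 l2] := len n; have [wn bn] := QP n.
exists (Q n); split=> //; first exact: (mono 0%N n (leq0n n)).
have p0 : 0 < (2 ^+ n : R)^-1 by rewrite invr_gt0 exprn_gt0.
rewrite l1 l2; split; apply: le_lt_trans nP; rewrite ler_pM2r // /L; lra.
Qed.

End Bisection.

(** * Green's theorem by Goursat's method *)

Section Green.
Variables (R : realType) (P Q : R -> R -> R) (a b c d : R).

Let in_rect s t := a <= s <= b /\ c <= t <= d.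

(** Total differentiability at [(s, t)] relative to the rectangle, with partial derivatives [al] and
    [be] at this one point. *)
Definition diff_on (F : R -> R -> R) s t al be := forall e, 0 < e ->
  exists2 r, 0 < r & forall s' t', in_rect s' t' -> `|s' - s| < r -> `|t' - t| < r ->
    `|F s' t' - F s t - al * (s' - s) - be * (t' - t)| <=
      e * (`|s' - s| + `|t' - t|).

Lemma diff_on_cont F s t al be : diff_on F s t al be ->
  forall e, 0 < e -> exists2 r, 0 < r & forall s' t', in_rect s' t' ->
    `|s' - s| < r -> `|t' - t| < r -> `|F s' t' - F s t| < e.
Proof.
move=> dF e e0; have [r r0 rP] := dF _ (@ltr01 R).
pose M := `|al| + `|be| + 2.
have M0 : 0 < M by rewrite /M; have := normr_ge0 al; have := normr_ge0 be; lra.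
exists (Num.min r (e / M / 2)); first by rewrite lt_min r0 !divr_gt0.
move=> s' t' i; rewrite !lt_min => /andP[s1 s2] /andP[t1 t2].
have := rP s' t' i s1 t1; rewrite mul1r => h.
have -> : F s' t' - F s t = (F s' t' - F s t - al * (s' - s) - be * (t' - t)) +
  al * (s' - s) + be * (t' - t) by ring.
have := ler_normD (F s' t' - F s t - al * (s' - s) - be * (t' - t)
  + al * (s' - s)) (be * (t' - t)).
have := ler_normD (F s' t' - F s t - al * (s' - s) - be * (t' - t))
  (al * (s' - s)).
rewrite !normrM => h1 h2.
have e2 : e / M / 2 = e / 2 / M by rewrite mulrAC.
have k1 : (`|al| + 1) * `|s' - s| <= (`|al| + 1) * (e / M / 2).
  by rewrite ler_wpM2l ?addr_ge0 // ltW.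
have k2 : (`|be| + 1) * `|t' - t| <= (`|be| + 1) * (e / M / 2).
  by rewrite ler_wpM2l ?addr_ge0 // ltW.
have k3 : (`|al| + 1) * (e / M / 2) + (`|be| + 1) * (e / M / 2) = e / 2.
  rewrite -mulrDl (_ : `|al| + 1 + (`|be| + 1) = M); last by rewrite /M; ring.
  by rewrite e2 mulrC divfK // gt_eqF.
by lra.
Qed.

(** The first partial derivative of [P] and the second one of [Q] are both [al]: the field
    [(P, - Q)] has divergence zero. *)
Hypothesis PQ : forall s t, in_rect s t -> exists al be ga,
  diff_on P s t al be /\ diff_on Q s t ga al.

Let contP s : a <= s <= b -> cont_on (P s) c d.
Proof.
move=> sab t tcd e e0; have [al [be [ga [dP _]]]] := PQ (conj sab tcd).
have [r r0 rP] := diff_on_cont dP e0; exists r => // t' t'cd tt'.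
by apply: rP => //; rewrite subrr normr0.
Qed.

Let contQ t : c <= t <= d -> cont_on (Q^~ t) a b.
Proof.
move=> tcd s sab e e0; have [al [be [ga [_ dQ]]]] := PQ (conj sab tcd).
have [r r0 rP] := diff_on_cont dQ e0; exists r => // s' s'ab ss'.
by apply: rP => //; rewrite subrr normr0.
Qed.

(* The flux of (P, -Q) through the boundary of the rectangle. *)
Let J s0 s1 t0 t1 := segint (P s1) t0 t1 - segint (P s0) t0 t1
  - (segint (Q^~ t1) s0 s1 - segint (Q^~ t0) s0 s1).

Let Jsplit s0 s s1 t0 t t1 : a <= s0 -> s0 <= s -> s <= s1 -> s1 <= b ->
  c <= t0 -> t0 <= t -> t <= t1 -> t1 <= d ->
  J s0 s1 t0 t1 = J s0 s t0 t + J s s1 t0 t + (J s0 s t t1 + J s s1 t t1).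
Proof.
move=> h1 h2 h3 h4 g1 g2 g3 g4; rewrite /J.
have cP x : a <= x <= b -> cont_on (P x) t0 t1.
  by move=> /contP; apply: cont_onS.
have cQ x : c <= x <= d -> cont_on (Q^~ x) s0 s1.
  by move=> /contQ; apply: cont_onS.
rewrite (segintD g2 g3 (cP s0 _)); last by apply/andP; split; lra.
rewrite (segintD g2 g3 (cP s1 _)); last by apply/andP; split; lra.
rewrite (segintD h2 h3 (cQ t0 _)); last by apply/andP; split; lra.
rewrite (segintD h2 h3 (cQ t1 _)); last by apply/andP; split; lra.
ring.
Qed.

(** The linear parts of [P] and [Q] at [(s, t)] contribute [al * L * M] to both differences of
    opposite sides and cancel. Only the remainders are left, which are small compared with the
    square of the half perimeter. *)
Let Jlocal s t : in_rect s t -> forall e, 0 < e -> exists2 r, 0 < r &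
  forall s0 s1 t0 t1, a <= s0 -> s0 <= s <= s1 -> s1 <= b ->
    c <= t0 -> t0 <= t <= t1 -> t1 <= d -> s1 - s0 < r -> t1 - t0 < r ->
  `|J s0 s1 t0 t1| <= e * ((s1 - s0) + (t1 - t0)) ^+ 2.
Proof.
move=> ist e e0; have [al [be [ga [dP dQ]]]] := PQ ist.
have e2 : 0 < e / 2 by rewrite divr_gt0.
have [r r0 rP] := dP _ e2; have [r' r'0 rQ] := dQ _ e2.
exists (Num.min r r'); first by rewrite lt_min r0.
move=> s0 s1 t0 t1 h1 /andP[h2 h3] h4 g1 /andP[g2 g3] g4.
rewrite !lt_min => /andP[l1 l2] /andP[m1 m2].
set L := s1 - s0; set M := t1 - t0.
have s01 := le_trans h2 h3; have t01 := le_trans g2 g3.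
have cP x : a <= x <= b -> cont_on (P x) t0 t1.
  by move=> /contP; apply: cont_onS.
have cQ x : c <= x <= d -> cont_on (Q^~ x) s0 s1.
  by move=> /contQ; apply: cont_onS.
have s0ab : a <= s0 <= b by rewrite h1 (le_trans s01 h4).
have s1ab : a <= s1 <= b by rewrite h4 (le_trans h1 s01).
have t0cd : c <= t0 <= d by rewrite g1 (le_trans t01 g4).
have t1cd : c <= t1 <= d by rewrite g4 (le_trans g1 t01).
have absS x : s0 <= x <= s1 -> `|x - s| <= L.
  by move=> /andP[x0 x1]; rewrite ler_norml /L; apply/andP; split; lra.
have absT x : t0 <= x <= t1 -> `|x - t| <= M.
  by move=> /andP[x0 x1]; rewrite ler_norml /M; apply/andP; split; lra.
have estF F al' be' r1 : (forall s' t', in_rect s' t' -> `|s' - s| < r1 ->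
    `|t' - t| < r1 -> `|F s' t' - F s t - al' * (s' - s) - be' * (t' - t)| <=
      e / 2 * (`|s' - s| + `|t' - t|)) -> L < r1 -> M < r1 ->
   forall s' t', s0 <= s' <= s1 -> t0 <= t' <= t1 ->
    `|F s' t' - F s t - al' * (s' - s) - be' * (t' - t)| <= e / 2 * (L + M).
  move=> FP Lr Mr s' t' ss tt.
  have k1 := absS _ ss; have k2 := absT _ tt.
  apply: le_trans (FP s' t' _ (le_lt_trans k1 Lr) (le_lt_trans k2 Mr)) _.
    move: ss tt => /andP[ss0 ss1] /andP[tt0 tt1].
    by split; [rewrite (le_trans h1 ss0) (le_trans ss1 h4)|
      rewrite (le_trans g1 tt0) (le_trans tt1 g4)].
  by rewrite (ler_wpM2l (ltW e2)) // lerD.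
have eP := estF _ _ _ _ rP l1 m1; have eQ := estF _ _ _ _ rQ l2 m2.
have L0 : 0 <= L by rewrite subr_ge0.
have M0 : 0 <= M by rewrite subr_ge0.
have ls : s0 <= s0 <= s1 by rewrite lexx.
have us : s0 <= s1 <= s1 by rewrite lexx s01.
have lt : t0 <= t0 <= t1 by rewrite lexx.
have ut : t0 <= t1 <= t1 by rewrite lexx t01.
have IP : `|segint (fun x => P s1 x - P s0 x) t0 t1 - al * L * M|
    <= e * (L + M) * M.
  apply: segint_near; [by []|by apply: cont_onB; apply: cP|move=> x xt].
  have -> : P s1 x - P s0 x - al * L =
     (P s1 x - P s t - al * (s1 - s) - be * (x - t)) -
     (P s0 x - P s t - al * (s0 - s) - be * (x - t)) by rewrite /L; ring.
  apply: le_trans (ler_normB _ _) _.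
  by have := eP _ _ us xt; have := eP _ _ ls xt; lra.
have IQ : `|segint (fun x => Q x t1 - Q x t0) s0 s1 - al * M * L|
    <= e * (L + M) * L.
  apply: segint_near; [by []|by apply: cont_onB; apply: cQ|move=> x xs].
  have -> : Q x t1 - Q x t0 - al * M =
     (Q x t1 - Q s t - ga * (x - s) - al * (t1 - t)) -
     (Q x t0 - Q s t - ga * (x - s) - al * (t0 - t)) by rewrite /M; ring.
  apply: le_trans (ler_normB _ _) _.
  by have := eQ _ _ xs ut; have := eQ _ _ xs lt; lra.
move: IP IQ; rewrite !segintB; try by [exact: cP|exact: cQ].
rewrite -/(J s0 s1 t0 t1) => IP IQ.
have -> : J s0 s1 t0 t1 =
  (segint (P s1) t0 t1 - segint (P s0) t0 t1 - al * L * M) -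
  (segint (Q^~ t1) s0 s1 - segint (Q^~ t0) s0 s1 - al * M * L)
  by rewrite /J; ring.
apply: le_trans (ler_normB _ _) _; rewrite expr2; lra.
Qed.

(** The flux [J] is additive under subdivision. If it did not vanish, it would exceed [k] times the
    squared half perimeter on ever smaller quarters, and their limit point would contradict
    [Jlocal]. *)
Lemma green : a <= b -> c <= d ->
  segint (P b) c d - segint (P a) c d = segint (Q^~ d) a b - segint (Q^~ c) a b.
Proof.
move=> ab cd; apply/eqP; rewrite -subr_eq0 -/(J a b c d).
rewrite -[_ == _]negbK; apply/negP => J0.
(* This value makes the whole rectangle bad; the summand 1 keeps the denominator positive even for a
   degenerate rectangle. *)
pose k := `|J a b c d| / (2 * (b - a + (d - c) + 1) ^+ 2).
have J0' : 0 < `|J a b c d| by rewrite normr_gt0.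
have D0 : 0 < b - a + (d - c) + 1 by lra.
have k0 : 0 < k by rewrite divr_gt0 // mulr_gt0 // exprn_gt0.
pose bad (q : rect R) := [/\ a <= q.1.1, q.1.2 <= b, c <= q.2.1, q.2.2 <= d &
  k * ((q.1.2 - q.1.1) + (q.2.2 - q.2.1)) ^+ 2 < `|J q.1.1 q.1.2 q.2.1 q.2.2|].
have bad0 : bad ((a, b), (c, d)).
  split=> //=; rewrite /k mulrAC ltr_pdivrMr ?mulr_gt0 ?exprn_gt0 //.
  rewrite ltr_pM2l //.
  have : (b - a + (d - c)) ^+ 2 <= (b - a + (d - c) + 1) ^+ 2.
    by rewrite ler_sqr ?nnegrE; lra.
  have : 0 < (b - a + (d - c) + 1) ^+ 2 by rewrite exprn_gt0.
  lra.
have [||s [t [sab tcd Hst]]] := bisect_point _ bad0; first by [].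
  move=> [[s0 s1] [t0 t1]] [/= w1 w2] [/= h1 h2 h3 h4 h5].
  set s := (s0 + s1) / 2; set t := (t0 + t1) / 2.
  have [i1 i2] : s0 <= s /\ s <= s1 by rewrite /s; split; lra.
  have [j1 j2] : t0 <= t /\ t <= t1 by rewrite /t; split; lra.
  have [as_ sb] := (le_trans h1 i1, le_trans i2 h2).
  have [ct td] := (le_trans h3 j1, le_trans j2 h4).
  move: h5; rewrite (Jsplit h1 i1 i2 h2 h3 j1 j2 h4) => h5.
  (* A quarter has half the half perimeter, hence a fourth of its square: four good quarters would
     make the whole rectangle good. *)
  pose X := k * ((s1 - s0 + (t1 - t0)) / 2) ^+ 2.
  have X4 : k * (s1 - s0 + (t1 - t0)) ^+ 2 = X + X + (X + X).
    by rewrite /X; field.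
  have eqX x y : (s1 - s0) / 2 = x -> (t1 - t0) / 2 = y -> k * (x + y) ^+ 2 = X.
    by move=> <- <-; rewrite /X; congr (_ * _ ^+ 2); field.
  case: (ltP X `|J s0 s t0 t|) => [lt1|ge1].
    exists ((s0, s), (t0, t)); split; [split=> //=|by left|by left].
    by rewrite eqX //; rewrite ?/s ?/t; field.
  case: (ltP X `|J s s1 t0 t|) => [lt2|ge2].
    exists ((s, s1), (t0, t)); split; [split=> //=|by right|by left].
    by rewrite eqX //; rewrite ?/s ?/t; field.
  case: (ltP X `|J s0 s t t1|) => [lt3|ge3].
    exists ((s0, s), (t, t1)); split; [split=> //=|by left|by right].
    by rewrite eqX //; rewrite ?/s ?/t; field.
  case: (ltP X `|J s s1 t t1|) => [lt4|ge4].
    exists ((s, s1), (t, t1)); split; [split=> //=|by right|by right].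
    by rewrite eqX //; rewrite ?/s ?/t; field.
  have := ler_normD (J s0 s t0 t + J s s1 t0 t) (J s0 s t t1 + J s s1 t t1).
  have := ler_normD (J s0 s t0 t) (J s s1 t0 t).
  have := ler_normD (J s0 s t t1) (J s s1 t t1).
  by move: h5; rewrite X4; lra.
have [r r0 rP] := Jlocal (conj sab tcd) k0.
have [q [[h1 h2 h3 h4 h5] _ _ [qs qt] [q1 q2]]] := Hst r r0.
by have := rP _ _ _ _ h1 qs h2 h3 qt h4 q1 q2; rewrite leNgt h5.
Qed.

End Green.

(** * Complex derivatives and the maximum principle *)

Section ComplexDerivative.
Variable R : realType.
Local Notation C := R[i].
Implicit Types (f g : C -> C) (z w c : C).

(** The first-order expansion replaces the difference quotient, so that [w = z] needs no separate
    treatment. *)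
Definition has_cderiv f z c := forall e : R, 0 < e -> exists2 d : R, 0 < d &
  forall w, cmod (w - z) < d ->
    cmod (f w - f z - c * (w - z)) <= e * cmod (w - z).

Lemma entire_cderiv f z : entire f -> exists c, has_cderiv f z c.
Proof.
move=> /(_ z) /cvg_ex[c fc]; exists c => e e0.
have cn : nbhs (c : C) (cball c e) by apply/nbhs_cballP; exists e.
have /nbhs_cballP[d d0 dP] := fc _ cn.
exists d => // w wz; have [->|wz0] := eqVneq w z.
  by rewrite !subrr mulr0 subrr cmod0 mulr0.
have wz1 : w - z != 0 by rewrite subr_eq0.
have := dP (w - z); rewrite /cball /= subr0 => /(_ wz wz1).
rewrite /= scaler1 subrK => h; apply: ltW.
rewrite -ltr_pdivrMr ?cmod_gt0 // -cmodV -cmodM.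
rewrite mulrBl mulfK // mulrC; exact: h.
Qed.

Lemma has_cderiv_continuous f z c : has_cderiv f z c -> {for z, continuous f}.
Proof.
move=> df; apply/continuousP => e e0; have [d d0 dP] := df 1 ltr01.
have M0 : 0 < cmod c + 1 by rewrite ltr_wpDl ?cmod_ge0.
exists (Num.min d (e / (cmod c + 1))); first by rewrite lt_min d0 divr_gt0.
move=> w; rewrite lt_min ltr_pdivlMr // => /andP[/dP h1 h2].
have -> : f w - f z = (f w - f z - c * (w - z)) + c * (w - z) by rewrite subrK.
apply: le_lt_trans (cmodD _ _) _; rewrite cmodM.
by apply: le_lt_trans h2; move: h1; rewrite mul1r => h1; lra.
Qed.

Lemma has_cderiv_cst k z : has_cderiv (fun=> k) z 0.
Proof.
by move=> e e0; exists 1 => // w _; rewrite subrr mul0r subrr cmod0 mulr_ge0 ?cmod_ge0 // ltW.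
Qed.

Lemma has_cderiv_id z : has_cderiv id z 1.
Proof.
by move=> e e0; exists 1 => // w _; rewrite mul1r subrr cmod0 mulr_ge0 ?cmod_ge0 // ltW.
Qed.

Lemma has_cderivB f g z c c' : has_cderiv f z c -> has_cderiv g z c' ->
  has_cderiv (fun w => f w - g w) z (c - c').
Proof.
move=> df dg e e0; have e2 : 0 < e / 2 by rewrite divr_gt0.
have [d d0 dP] := df _ e2; have [d' d'0 dP'] := dg _ e2.
exists (Num.min d d'); first by rewrite lt_min d0.
move=> w; rewrite lt_min => /andP[/dP h1 /dP' h2].
have -> : f w - g w - (f z - g z) - (c - c') * (w - z) =
  (f w - f z - c * (w - z)) - (g w - g z - c' * (w - z)) by ring.
by apply: le_trans (cmodD _ _) _; rewrite cmodN; lra.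
Qed.

Lemma has_cderivM f g z c c' : has_cderiv f z c -> has_cderiv g z c' ->
  has_cderiv (fun w => f w * g w) z (c * g z + f z * c').
Proof.
move=> df dg e e0.
pose K := cmod (g z) + 1 + cmod (f z) + cmod c.
have K0 : 0 < K.
  by rewrite /K; have := cmod_ge0 (g z); have := cmod_ge0 (f z);
     have := cmod_ge0 c; lra.
have eK : 0 < e / K / 2 by rewrite !divr_gt0.
have [d d0 dP] := df _ eK; have [d' d'0 dP'] := dg _ eK.
have ek0 : 0 < Num.min 1 (e / K / 2) by rewrite lt_min ltr01.
have [r r0 rP] := (continuousP g z).1 (has_cderiv_continuous dg) _ ek0.
exists (Num.min d (Num.min d' r)); first by rewrite !lt_min d0 d'0.
move=> w; rewrite !lt_min => /and3P[/dP h1 /dP' h2 /rP].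
rewrite lt_min => /andP[h3 h4].
have -> : f w * g w - f z * g z - (c * g z + f z * c') * (w - z) =
  (f w - f z - c * (w - z)) * g w + (f z * (g w - g z - c' * (w - z)) +
  c * (w - z) * (g w - g z)) by ring.
have gw : cmod (g w) <= cmod (g z) + 1.
  by have := cmodB_ge (g w) (g z); lra.
set L : R := cmod (w - z) in h1 h2 *; have L0 : 0 <= L by exact: cmod_ge0.
have t1 : cmod ((f w - f z - c * (w - z)) * g w) <=
   (e / K / 2 * L) * (cmod (g z) + 1).
  by rewrite cmodM ler_pM ?cmod_ge0.
have t2 : cmod (f z * (g w - g z - c' * (w - z))) <= cmod (f z) * (e / K / 2 * L).
  by rewrite cmodM ler_wpM2l ?cmod_ge0.
have t3 : cmod (c * (w - z) * (g w - g z)) <= cmod c * (e / K / 2 * L).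
  rewrite [e / K / 2 * L]mulrC mulrA cmodM cmodM.
  by rewrite ler_wpM2l ?mulr_ge0 ?cmod_ge0 // ltW.
apply: le_trans (cmodD _ _) _.
have := cmodD (f z * (g w - g z - c' * (w - z))) (c * (w - z) * (g w - g z)).
have KE : e / K / 2 * L * K = e * L / 2 by field; rewrite gt_eqF.
have : e * L / 2 <= e * L by rewrite ler_pdivrMr // ler_peMr // ?mulr_ge0 // ?ltW // ltr1n.
move: KE t1 t2 t3; set E : R := e / K / 2 * L; rewrite /K => KE t1 t2 t3.
lra.
Qed.

Lemma has_cderivV f z c : has_cderiv f z c -> f z != 0 ->
  has_cderiv (fun w => (f w)^-1) z (- c / f z ^+ 2).
Proof.
move=> df fz0 e e0.
pose m := cmod (f z); have m0 : 0 < m by rewrite cmod_gt0.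
pose K := 1 + cmod c.
have K0 : 0 < K by rewrite /K; have := cmod_ge0 c; lra.
have e1 : 0 < e * m ^+ 2 / 4 by rewrite divr_gt0 // mulr_gt0 // exprn_gt0.
have e2 : 0 < Num.min (m / 2) (e * m ^+ 3 / 4 / K).
  by rewrite lt_min !divr_gt0 // mulr_gt0 // exprn_gt0.
have [d d0 dP] := df _ e1.
have [r r0 rP] := (continuousP f z).1 (has_cderiv_continuous df) _ e2.
exists (Num.min d r); first by rewrite lt_min d0.
move=> w; rewrite lt_min => /andP[/dP h1 /rP]; rewrite lt_min => /andP[h2 h3].
have mw : m / 2 <= cmod (f w).
  by have := cmodB_ge (f z) (f w); rewrite cmodB -/m; lra.
have fw0 : f w != 0 by rewrite -cmod_gt0; apply: lt_le_trans mw; rewrite divr_gt0.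
have -> : (f w)^-1 - (f z)^-1 - - c / f z ^+ 2 * (w - z) =
  (- (f w - f z - c * (w - z)) / (f z * f w)) +
  c * (w - z) * (f w - f z) / (f z ^+ 2 * f w) by field; rewrite fw0 fz0.
set L : R := cmod (w - z) in h1 *; have L0 : 0 <= L by exact: cmod_ge0.
have iw : (cmod (f w))^-1 <= 2 / m.
  by rewrite -[2 / m]invrK lef_pV2 ?posrE ?invf_div ?divr_gt0 // (lt_le_trans _ mw) ?divr_gt0.
apply: le_trans (cmodD _ _) _.
have t1 : cmod (- (f w - f z - c * (w - z)) / (f z * f w)) <= e * L / 2.
  rewrite cmodM cmodN cmodV cmodM invfM -/m.
  have -> : e * L / 2 = (e * m ^+ 2 / 4 * L) * (m^-1 * (2 / m)).
    by field; rewrite gt_eqF.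
  rewrite ler_pM ?cmod_ge0 ?mulr_ge0 ?invr_ge0 ?cmod_ge0 // ?(ltW m0) //.
  by rewrite ler_wpM2l // invr_ge0 ltW.
have t2 : cmod (c * (w - z) * (f w - f z) / (f z ^+ 2 * f w)) <= e * L / 2.
  rewrite cmodM [cmod (c * _ * _)]cmodM [cmod (c * _)]cmodM cmodV.
  rewrite [cmod (_ * f w)]cmodM cmodX invfM -/m -/L.
  have -> : e * L / 2 = (K * L * (e * m ^+ 3 / 4 / K)) * ((m ^+ 2)^-1 * (2 / m)).
    by field; rewrite !gt_eqF.
  rewrite ler_pM ?mulr_ge0 ?invr_ge0 ?cmod_ge0 ?exprn_ge0 // ?(ltW m0) //.
    rewrite ler_pM ?mulr_ge0 ?cmod_ge0 // ?(ltW h3) //.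
    by rewrite ler_wpM2r // /K lerDr.
  by rewrite ler_wpM2l // invr_ge0 exprn_ge0 // ltW.
by lra.
Qed.

Lemma has_cderiv_comp f g z c c' : has_cderiv f z c -> has_cderiv g (f z) c' ->
  has_cderiv (g \o f) z (c' * c).
Proof.
move=> df dg e e0.
pose K := cmod c + 1 + cmod c'.
have K0 : 0 < K by rewrite /K; have := cmod_ge0 c; have := cmod_ge0 c'; lra.
have eK : 0 < Num.min 1 (e / K) by rewrite lt_min ltr01 divr_gt0.
have eK' : 0 < e / K by rewrite divr_gt0.
have [d d0 dP] := df _ eK; have [d' d'0 dP'] := dg _ eK'.
have [r r0 rP] := (continuousP f z).1 (has_cderiv_continuous df) _ d'0.
exists (Num.min d r); first by rewrite lt_min d0.
move=> w; rewrite lt_min => /andP[/dP h1 /rP /dP' h2] /=.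
set L : R := cmod (w - z) in h1 *; have L0 : 0 <= L by exact: cmod_ge0.
have h1a : cmod (f w - f z - c * (w - z)) <= L.
  by apply: le_trans h1 _; rewrite -{2}[L]mul1r ler_wpM2r // ge_min lexx.
have h1b : cmod (f w - f z - c * (w - z)) <= e / K * L.
  by apply: le_trans h1 _; rewrite ler_wpM2r // ge_min lexx orbT.
have fL : cmod (f w - f z) <= (cmod c + 1) * L.
  have -> : f w - f z = (f w - f z - c * (w - z)) + c * (w - z) by rewrite subrK.
  by apply: le_trans (cmodD _ _) _; rewrite cmodM -/L; lra.
have -> : g (f w) - g (f z) - c' * c * (w - z) =
  (g (f w) - g (f z) - c' * (f w - f z)) + c' * (f w - f z - c * (w - z)) by ring.
apply: le_trans (cmodD _ _) _; rewrite cmodM.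
have t1 := le_trans h2 (ler_wpM2l (ltW eK') fL).
have t2 : cmod c' * cmod (f w - f z - c * (w - z)) <= cmod c' * (e / K * L).
  by rewrite ler_wpM2l ?cmod_ge0.
have KE : e / K * L * K = e * L by field; rewrite gt_eqF.
rewrite mulrCA [X in _ <= X]mulrC in t1; move: KE t1 t2.
set E : R := e / K * L; rewrite /K => KE t1 t2.
lra.
Qed.

End ComplexDerivative.

(** * Polar coordinates *)

Section MeanValue.
Variable R : realType.
Local Notation C := R[i].
Implicit Types (f : C -> C) (z w c : C) (r t : R).

Lemma is_derive_expand (h : R -> R) (x dh : R) : is_derive x (1 : R) h dh ->
  forall e : R, 0 < e -> exists2 d : R, 0 < d & forall y, `|y - x| < d ->
    `|h y - h x - dh * (y - x)| <= e * `|y - x|.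
Proof.
case=> /cvg_ex[c hc] Dh e e0.
have dhE : dh = c by rewrite -Dh; exact: (cvg_lim (@Rhausdorff R) hc).
have cn : nbhs c (ball c e) by exact: nbhsx_ballx.
have /nbhs_ballP[d /= d0 dP] := hc _ cn.
exists d => // y yx; have [->|yx0] := eqVneq y x.
  by rewrite !subrr mulr0 subr0 normr0 mulr0.
have yx1 : y - x != 0 by rewrite subr_eq0.
have := dP (y - x); rewrite /ball /= sub0r normrN => /(_ yx yx1).
rewrite scaler1 subrK => H; apply: ltW.
rewrite -ltr_pdivrMr ?normr_gt0 // -normfV -normrM.
rewrite mulrBl mulfK // mulrC dhE distrC; exact: H.
Qed.

Definition polar z r t : C := z + (r%:C)%C * (cos t +i* sin t)%C.

Lemma cmod_polar z r t : 0 <= r -> cmod (polar z r t - z) = r.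
Proof.
move=> r0; rewrite /polar addrAC subrr add0r cmodM cmod_real ger0_norm //.
by rewrite /= cos2Dsin2 sqrtr1 mulr1.
Qed.

(** The angle is [acos] of the normalised real part, with the sign of the imaginary part. *)
Lemma polar_onto z w : w != z ->
  exists2 t, - pi <= t <= pi & w = polar z (cmod (w - z)) t.
Proof.
rewrite -subr_eq0 -cmod_gt0; set r := cmod _ => r0.
have rE : r ^+ 2 = (complex.Re (w - z)) ^+ 2 + (complex.Im (w - z)) ^+ 2.
  rewrite /r; case: (w - z) => x y /=.
  by rewrite sqr_sqrtr // addr_ge0 ?sqr_ge0.
clearbody r; move: rE; have : w = z + (w - z) by rewrite addrC subrK.
move: (w - z) => -[x y] /= -> rE.
have x1 : -1 <= x / r <= 1.
  have : `|x| <= r.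
    rewrite -(ler_sqr (x := `|x|)) ?nnegrE ?(ltW r0) // real_normK ?num_real //.
    by rewrite rE lerDl sqr_ge0.
  by rewrite ler_norml => /andP[? ?]; rewrite ler_pdivlMr // ler_pdivrMr // mulN1r mul1r; apply/andP.
have xr : x / r \in `[-1, 1] by rewrite in_itv.
have sE : Num.sqrt (1 - (x / r) ^+ 2) = `|y| / r.
  have q0 : 0 <= `|y| / r by rewrite divr_ge0 // ltW.
  rewrite -(ger0_norm q0) -(sqrtr_sqr (`|y| / r)).
  congr (Num.sqrt _).
  rewrite !expr_div_n real_normK ?num_real //.
  have -> : y ^+ 2 = r ^+ 2 - x ^+ 2 by rewrite rE addrAC subrr add0r.
  by field; rewrite gt_eqF.
have a0 := acos_ge0 x1; have api := acos_lepi x1.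
case: (leP 0 y) => y0.
  exists (acos (x / r)); first by rewrite api andbT (le_trans _ a0) // oppr_le0 pi_ge0.
  rewrite /polar acosK // sin_acos // sE ger0_norm //.
  case: z => z1 z2; apply/eqP; rewrite eq_complex /=.
  by apply/andP; split; apply/eqP; field; rewrite gt_eqF.
exists (- acos (x / r)); first by rewrite lerN2 api (le_trans _ (pi_ge0 _)) // oppr_le0.
rewrite /polar cosN sinN acosK // sin_acos // sE ltr0_norm //.
case: z => z1 z2; apply/eqP; rewrite eq_complex /=.
by apply/andP; split; apply/eqP; field; rewrite gt_eqF.
Qed.

(** The linear part consists of a radial and a tangential term; after composition with the
    derivative of [f] they give the Cauchy-Riemann equations in polar form. *)
Lemma polar_expand z r t : forall e : R, 0 < e -> exists2 d : R, 0 < d &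
  forall r' t', `|r' - r| < d -> `|t' - t| < d ->
  cmod (polar z r' t' - polar z r t - (((r' - r)%:C)%C * (cos t +i* sin t)%C
    + ((r * (t' - t))%:C)%C * (- sin t +i* cos t)%C)) <=
  e * (`|r' - r| + `|t' - t|).
Proof.
move=> e e0; pose K := `|r| + 1.
have K0 : 0 < K by rewrite ltr_wpDl.
have e1 : 0 < e / 4 / K by rewrite !divr_gt0.
have [d d0 dP] := is_derive_expand (is_derive_cos t) e1.
have [d' d'0 dP'] := is_derive_expand (is_derive_sin t) e1.
exists (Num.min 1 (Num.min d (Num.min d' (e / 4)))).
  by rewrite !lt_min ltr01 d0 d'0 divr_gt0.
move=> r' t'; rewrite !lt_min => /and4P[r1 _ _ r4] /and4P[_ /dP t2 /dP' t3 _].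
set x := cos t' - cos t - - sin t * (t' - t) in t2.
set y := sin t' - sin t - cos t * (t' - t) in t3.
have -> : polar z r' t' - polar z r t - (((r' - r)%:C)%C * (cos t +i* sin t)%C
    + ((r * (t' - t))%:C)%C * (- sin t +i* cos t)%C) =
  ((r')%:C)%C * (x +i* y)%C +
  (((r' - r) * (t' - t))%:C)%C * (- sin t +i* cos t)%C.
  case: z => z1 z2; rewrite /polar /x /y; apply/eqP; rewrite eq_complex /=.
  by apply/andP; split; apply/eqP; ring.
apply: le_trans (cmodD _ _) _; rewrite !cmodM !cmod_real.
have -> : cmod (- sin t +i* cos t)%C = 1.
  by rewrite /= sqrrN addrC cos2Dsin2 sqrtr1.
have r'K : `|r'| <= K.
  by rewrite /K; have := lerB_normD r' (- r); rewrite normrN; lra.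
have h1 : cmod (x +i* y)%C <= e / 2 / K * `|t' - t|.
  apply: le_trans (cmod_le_ReIm _) _ => /=.
  have -> : e / 2 / K * `|t' - t| =
     e / 4 / K * `|t' - t| + e / 4 / K * `|t' - t|.
     by field; rewrite gt_eqF.
  exact: lerD.
have h2 : `|r'| * cmod (x +i* y)%C <= K * (e / 2 / K * `|t' - t|).
  by rewrite ler_pM ?cmod_ge0.
have h3 : K * (e / 2 / K * `|t' - t|) = e / 2 * `|t' - t|.
  by field; rewrite gt_eqF.
have h4 : `|(r' - r) * (t' - t)| <= e / 4 * `|t' - t|.
  by rewrite normrM ler_wpM2r // ltW.
have h5 : 0 <= e * `|r' - r| by rewrite mulr_ge0 // ltW.
have h6 : 0 <= e * `|t' - t| by rewrite mulr_ge0 // ltW.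
lra.
Qed.

Lemma polar_cderiv f z r t c : has_cderiv f (polar z r t) c ->
  forall e : R, 0 < e -> exists2 d : R, 0 < d &
  forall r' t', `|r' - r| < d -> `|t' - t| < d ->
  cmod (f (polar z r' t') - f (polar z r t)
    - c * (((r' - r)%:C)%C * (cos t +i* sin t)%C
    + ((r * (t' - t))%:C)%C * (- sin t +i* cos t)%C)) <=
  e * (`|r' - r| + `|t' - t|).
Proof.
move=> df e e0; pose K := `|r| + 2 + cmod c.
have K0 : 0 < K by rewrite ltr_wpDr ?cmod_ge0 // ltr_wpDl.
have eK : 0 < e / 2 / K by rewrite !divr_gt0.
have [d1 d10 d1P] := df _ eK.
have [d2 d20 d2P] := polar_expand z r t (@ltr01 R).
have [d3 d30 d3P] := polar_expand z r t eK.
exists (Num.min (Num.min d2 d3) (d1 / K / 2)).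
  by rewrite !lt_min d20 d30 !divr_gt0.
move=> r' t'; rewrite !lt_min => /andP[/andP[r2 r3] r1] /andP[/andP[t2 t3] t1].
set S := `|r' - r| + `|t' - t|.
have S0 : 0 <= S by rewrite addr_ge0.
set l := (X in c * X).
have e1 := d2P _ _ r2 t2; have e2 := d3P _ _ r3 t3; rewrite -/l -/S in e1 e2.
have lS : cmod l <= `|r' - r| + `|r| * `|t' - t|.
  apply: le_trans (cmodD _ _) _; rewrite !cmodM !cmod_real normrM.
  have -> : cmod (- sin t +i* cos t)%C = 1.
    by rewrite /= sqrrN addrC cos2Dsin2 sqrtr1.
  have -> : cmod (cos t +i* sin t)%C = 1 by rewrite /= cos2Dsin2 sqrtr1.
  by rewrite !mulr1.
have zS : cmod (polar z r' t' - polar z r t) <= K * S.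
  rewrite -[_ - _](subrK l); apply: le_trans (cmodD _ _) _.
  have : 0 <= `|r| * `|r' - r| by rewrite mulr_ge0.
  have : 0 <= cmod c * S by rewrite mulr_ge0 ?cmod_ge0.
  have := normr_ge0 (t' - t); have := normr_ge0 (r' - r).
  by move: e1 lS; rewrite /K /S; lra.
have zd : cmod (polar z r' t' - polar z r t) < d1.
  apply: le_lt_trans zS _; have : K * S < K * (d1 / K / 2 + d1 / K / 2).
    by rewrite ltr_pM2l // /S; lra.
  by have -> : K * (d1 / K / 2 + d1 / K / 2) = d1 by field; rewrite gt_eqF.
have e3 := le_trans (d1P _ zd) (ler_wpM2l (ltW eK) zS).
rewrite (_ : e / 2 / K * (K * S) = e / 2 * S) in e3; last first.
  by field; rewrite gt_eqF.
have -> : f (polar z r' t') - f (polar z r t) - c * l =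
  (f (polar z r' t') - f (polar z r t) - c * (polar z r' t' - polar z r t)) +
  c * (polar z r' t' - polar z r t - l) by ring.
apply: le_trans (cmodD _ _) _; rewrite cmodM.
have e4 : cmod c * cmod (polar z r' t' - polar z r t - l) <= K * (e / 2 / K * S).
  rewrite ler_pM ?cmod_ge0 // /K lerDr.
  by rewrite addr_ge0.
rewrite (_ : K * (e / 2 / K * S) = e / 2 * S) in e4; last first.
  by field; rewrite gt_eqF.
lra.
Qed.

(** Quotient rule for division by the first variable. It is meant for Im f / r, which is singular at
    radius 0; hence the lower bound [a] on the radius. *)
Lemma diff_on_div (F : R -> R -> R) (a b p q s t al be : R) : 0 < a -> a <= s ->
  diff_on a b p q F s t al be ->
  diff_on a b p q (fun s t => F s t / s) s t (al / s - F s t / s ^+ 2) (be / s).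
Proof.
move=> a0 as0 dF e e0; have s0 : 0 < s := lt_le_trans a0 as0.
pose G := `|F s t| / (s ^+ 2 * a).
have G0 : 0 <= G by rewrite divr_ge0 // mulr_ge0 ?exprn_ge0 // ltW.
have e1 : 0 < e * s / 3 by rewrite divr_gt0 // mulr_gt0.
have e2 : 0 < e * s * a / 3 by rewrite divr_gt0 // !mulr_gt0.
have [d1 d10 d1P] := dF _ e1.
have [d2 d20 d2P] := diff_on_cont dF e2.
have G1 : 0 < G + 1 by rewrite ltr_wpDl.
exists (Num.min (Num.min d1 d2) (e / 3 / (G + 1))).
  by rewrite !lt_min d10 d20 !divr_gt0.
move=> s' t' i; rewrite !lt_min => /andP[/andP[s1 s2] s3] /andP[/andP[t1 t2] _].
have E1 := d1P _ _ i s1 t1; have E2 := ltW (d2P _ _ i s2 t2).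
have as' : a <= s' by case: i => /andP[].
have s'0 : 0 < s' := lt_le_trans a0 as'.
have -> : F s' t' / s' - F s t / s - (al / s - F s t / s ^+ 2) * (s' - s)
    - be / s * (t' - t) =
  (F s' t' - F s t - al * (s' - s) - be * (t' - t)) / s
  - (F s' t' - F s t) * (s' - s) / (s * s')
  + F s t * ((s' - s) ^+ 2 / (s ^+ 2 * s')).
  by field; rewrite !gt_eqF.
set x := _ / s; set y := _ / (s * s'); set w := F s t * _.
have hx : `|x| <= e / 3 * (`|s' - s| + `|t' - t|).
  rewrite /x normrM normfV (gtr0_norm s0) ler_pdivrMr //.
  by lra.
have hy : `|y| <= e / 3 * `|s' - s|.
  rewrite /y !normrM normfV (gtr0_norm (mulr_gt0 s0 s'0)).
  rewrite ler_pdivrMr ?mulr_gt0 //.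
  have : `|F s' t' - F s t| * `|s' - s| <= e * s * a / 3 * `|s' - s|.
    by rewrite ler_wpM2r.
  move/le_trans; apply.
  rewrite (_ : e / 3 * _ * _ = e * s * s' / 3 * `|s' - s|); last by ring.
  rewrite ler_wpM2r // ler_pM2r // ler_wpM2l // mulr_ge0 // ltW //.
have hw : `|w| <= e / 3 * `|s' - s|.
  have -> : `|w| = `|F s t| / (s ^+ 2 * s') * `|s' - s| * `|s' - s|.
    rewrite /w normrM normrM normrX normfV.
    rewrite (gtr0_norm (mulr_gt0 (exprn_gt0 2 s0) s'0)).
    by rewrite expr2; ring.
  rewrite ler_wpM2r //.
  have GG : `|F s t| / (s ^+ 2 * s') <= G + 1.
    apply: (@le_trans _ _ G); last by rewrite lerDl.
    rewrite ler_wpM2l // lef_pV2 ?posrE ?mulr_gt0 ?exprn_gt0 //.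
    by rewrite ler_pM2l ?exprn_gt0.
  apply: (@le_trans _ _ ((G + 1) * (e / 3 / (G + 1)))).
    apply: ler_pM => //; last exact: ltW.
    by rewrite divr_ge0 // mulr_ge0 ?exprn_ge0 // ltW.
  by rewrite mulrC divfK // gt_eqF.
have := ler_normD (x - y) w; have := ler_normB x y.
have := mulr_ge0 (ltW e0) (normr_ge0 (t' - t)).
lra.
Qed.

End MeanValue.

(** * Mean value property and maximum principle *)

Section MaximumPrinciple.
Variable R : realType.
Local Notation C := R[i].
Implicit Types (f : C -> C) (z w c : C) (r t : R).

Lemma Re_continuous_of f (g : R -> C) a b :
  (forall x, a <= x <= b -> forall e : R, 0 < e -> exists2 d : R, 0 < d &
    forall y, `|y - x| < d -> cmod (g y - g x) < e) ->
  (forall x, a <= x <= b -> {for g x, continuous f}) ->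
  cont_on (fun x => complex.Re (f (g x))) a b.
Proof.
move=> cg cf x xab e e0.
have [d d0 dP] := (continuousP _ _).1 (cf x xab) e e0.
have [d' d'0 d'P] := cg x xab d d0; exists d' => // y _ /d'P /dP.
by apply: le_lt_trans; rewrite -raddfB; exact: Re_le_cmod.
Qed.

Lemma polar_continuous z r t : forall e : R, 0 < e -> exists2 d : R, 0 < d &
  forall t', `|t' - t| < d -> cmod (polar z r t' - polar z r t) < e.
Proof.
move=> e e0; have [d d0 dP] := polar_expand z r t (@ltr01 R).
have M0 : 0 < `|r| + 1 by rewrite ltr_wpDl.
exists (Num.min d (e / (`|r| + 1))); first by rewrite lt_min d0 divr_gt0.
move=> t'; rewrite lt_min ltr_pdivlMr // => /andP[t1 t2].
have := dP r t' _ t1; rewrite subrr normr0 => /(_ d0); rewrite add0r mul0r add0r.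
set l := (X in _ - X) => h; rewrite -[_ - _](subrK l).
apply: le_lt_trans (cmodD _ _) _; apply: le_lt_trans t2.
have -> : cmod l = `|r| * `|t' - t|.
  rewrite cmodM cmod_real normrM.
  have -> : cmod (- sin t +i* cos t)%C = 1.
    by rewrite /= sqrrN addrC cos2Dsin2 sqrtr1.
  by rewrite mulr1.
by lra.
Qed.

(** In polar coordinates, the radial derivative of Re f is the angular derivative of Im f / r. In
    Green's theorem for radii from [a] to [b] and angles from [- pi] to [pi], the sides at the two
    extreme angles contribute equally, so the circular means do not depend on the radius. Radii
    tending to 0 give the value at the centre. *)
Lemma mean_value f z b : 0 < b ->
  (forall w, cmod (w - z) <= b -> exists c, has_cderiv f w c) ->
  segint (fun t => complex.Re (f (polar z b t))) (- pi) pi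
    = complex.Re (f z) * (pi - (- pi)).
Proof.
move=> b0 df.
have pp : - pi <= pi :> R by have := pi_ge0 R; lra.
have pp0 : 0 < pi - - pi :> R by have := pi_gt0 R; lra.
have cf w : cmod (w - z) <= b -> {for w, continuous f}.
  by move=> /df[c /has_cderiv_continuous].
have cP a : 0 <= a <= b ->
    cont_on (fun t => complex.Re (f (polar z a t))) (- pi) pi.
  move=> /andP[a0 ab]; apply: Re_continuous_of => [t _|t _].
    exact: polar_continuous.
  by apply: cf; rewrite cmod_polar.
have eqa a : 0 < a -> a <= b ->
    segint (fun t => complex.Re (f (polar z b t))) (- pi) pi =
    segint (fun t => complex.Re (f (polar z a t))) (- pi) pi.
  move=> a0 ab; apply/eqP; rewrite -subr_eq0; apply/eqP.
  pose P r t := complex.Re (f (polar z r t)).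
  pose Q r t := complex.Im (f (polar z r t)) / r.
  have := @green R P Q a b (- pi) pi.
  rewrite -/(P a) -/(P b) => ->; try by [].
    rewrite (@eq_segint _ _ (Q^~ (- pi))) ?subrr // => x _.
    by rewrite /Q /polar cosN sinN sinpi oppr0.
  move=> s t [/andP[as0 sb] _]; have s0 := lt_le_trans a0 as0.
  have [c dc] : exists c, has_cderiv f (polar z s t) c.
    by apply: df; rewrite cmod_polar // ltW.
  have dP := polar_cderiv dc.
  exists (complex.Re c * cos t - complex.Im c * sin t).
  exists (- s * (complex.Re c * sin t + complex.Im c * cos t)).
  exists ((complex.Re c * sin t + complex.Im c * cos t) / s
     - complex.Im (f (polar z s t)) / s ^+ 2); split.
    move=> e /dP[d d0 {}dP]; exists d => // s' t' _ ss' tt'.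
    apply: le_trans (dP _ _ ss' tt'); apply: le_trans (Re_le_cmod _).
    rewrite le_eqVlt; apply/orP; left; apply/eqP; congr (`|_|).
    rewrite /P; case: (f (polar z s' t')) => x1 x2.
    by case: (f (polar z s t)) => y1 y2; case: (c) => c1 c2 /=; ring.
  (* Multiplied by [s], the common partial derivative is the angular derivative of Im f; dividing by
     [s] again brings it into the form of the quotient rule. *)
  rewrite -[complex.Re c * cos t - _](mulfK (lt0r_neq0 s0)).
  apply: (diff_on_div a0 as0).
  move=> e /dP[d d0 {}dP]; exists d => // s' t' _ ss' tt'.
  apply: le_trans (dP _ _ ss' tt'); apply: le_trans (Im_le_cmod _).
  rewrite le_eqVlt; apply/orP; left; apply/eqP; congr (`|_|).
  case: (f (polar z s' t')) => x1 x2.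
  by case: (f (polar z s t)) => y1 y2; case: (c) => c1 c2 /=; ring.
apply/eqP; rewrite -subr_eq0 -normr_le0; apply/ler_addgt0Pr => e e0.
rewrite add0r; have e1 : 0 < e / (pi - - pi) by rewrite divr_gt0.
have [|d d0 dP] := (continuousP _ _).1 (cf z _) _ e1.
  by rewrite subrr cmod0 ltW.
pose a := Num.min b (d / 2).
have a0 : 0 < a by rewrite lt_min b0 divr_gt0.
have ab : a <= b by rewrite ge_min lexx.
have ad : a < d.
  by apply: (@le_lt_trans _ _ (d / 2)); [rewrite ge_min lexx orbT|lra].
rewrite (eqa a a0 ab) -[e](divfK (lt0r_neq0 pp0)).
apply: segint_near => //; first by apply: cP; rewrite ab ltW.
move=> t _; apply: ltW; apply: le_lt_trans (dP (polar z a t) _).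
  by rewrite -raddfB; exact: Re_le_cmod.
by rewrite cmod_polar // ltW.
Qed.

(** Divided by [f z], the function has modulus at most 1 and value 1 at the centre. On the circle
    through [w], the nonnegative function 1 - Re g has mean zero, so Re g = 1 there, and the bound
    on the modulus forces g = 1. *)
Lemma strong_maximum f z b : 0 < b ->
  (forall w, cmod (w - z) <= b -> exists c, has_cderiv f w c) ->
  (forall w, cmod (w - z) <= b -> cmod (f w) <= cmod (f z)) ->
  forall w, cmod (w - z) <= b -> f w = f z.
Proof.
move=> b0 df fmax w wb.
have [fz0|fz0] := eqVneq (f z) 0.
  apply/eqP; rewrite fz0 -cmod_eq0 eq_le cmod_ge0 andbT.
  by have := fmax w wb; rewrite fz0 cmod0.
have [->//|wz] := eqVneq w z.
pose g w := f w * (f z)^-1.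
have gle v : cmod (v - z) <= b -> cmod (g v) <= 1.
  move=> /fmax vm; rewrite cmodM cmodV ler_pdivrMr ?cmod_gt0 //.
  by rewrite mul1r.
have dg v : cmod (v - z) <= b -> exists c, has_cderiv g v c.
  move=> /df[c dc]; exists (c * (f z)^-1 + f v * 0).
  by apply: has_cderivM => //; exact: has_cderiv_cst.
have gz : g z = 1 by rewrite /g divff.
pose r := cmod (w - z).
have r0 : 0 < r by rewrite cmod_gt0 subr_eq0.
have pp : - pi < pi :> R by have := pi_gt0 R; lra.
have dg' v : cmod (v - z) <= r -> exists c, has_cderiv g v c.
  by move=> vr; apply: dg; exact: le_trans wb.
have := mean_value r0 dg'; rewrite gz mul1r => Ig.
have cg : cont_on (fun t => complex.Re (g (polar z r t))) (- pi) pi.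
  apply: Re_continuous_of => [t _|t _]; first exact: polar_continuous.
  have [|c /has_cderiv_continuous//] := dg' (polar z r t).
  by rewrite cmod_polar // ltW.
have c1 := @cont_on_cst R 1 (- pi) pi.
have [t tp wt] := polar_onto wz.
have := @segint_eq0 R (fun t => 1 - complex.Re (g (polar z r t))) (- pi) pi pp.
move=> /(_ (cont_onB c1 cg)) H.
have /eqP : 1 - complex.Re (g w) = 0.
  rewrite {1}wt; apply: (H _ _ t tp).
    move=> s _; rewrite subr_ge0; apply: le_trans (gle (polar z r s) _).
      exact: le_trans (ler_norm _) (Re_le_cmod _).
    by rewrite cmod_polar // ltW.
  by rewrite segintB // Ig segint_cst ?(ltW pp) // mul1r subrr.
rewrite subr_eq0 => /eqP gw1.
suff gw : g w = 1 by rewrite -[f w](divfK fz0) -/(g w) gw mul1r.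
move: gw1 (gle w wb); case: (g w) => x y /= <- h.
have : Num.sqrt (1 ^+ 2 + y ^+ 2) ^+ 2 <= 1 ^+ 2 :> R.
  by rewrite ler_sqr ?nnegrE ?sqrtr_ge0.
rewrite sqr_sqrtr ?addr_ge0 ?sqr_ge0 // gerDl => y0.
by have /eqP : y ^+ 2 == 0; [rewrite eq_le y0 sqr_ge0|move=> /eqP; rewrite sqrf_eq0 => /eqP ->].
Qed.

Lemma path_connected (g : R -> C) a b :
  (forall x, a <= x <= b -> forall e : R, 0 < e -> exists2 d : R, 0 < d &
    forall y, `|y - x| < d -> cmod (g y - g x) < e) ->
  connected (g @` `[a, b]).
Proof.
move=> cg; apply: connected_continuous_connected; first exact: segment_connected.
apply/subspace_continuousP => x /=; rewrite in_itv /= => xab.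
move=> B /nbhs_cballP[e e0 eB]; have [d d0 dP] := cg x xab e e0.
apply/nbhs_ballP; exists d => //= y xy _; apply: eB.
by apply: dP; move: xy; rewrite /ball /= distrC.
Qed.

Definition cseg z w : set C := (fun t : R => z + (t%:C)%C * (w - z)) @` `[0, 1].

Lemma cseg_connected z w : connected (cseg z w).
Proof.
apply: path_connected => x _ e e0.
have M0 : 0 < cmod (w - z) + 1 by rewrite ltr_wpDl ?cmod_ge0.
exists (e / (cmod (w - z) + 1)); first by rewrite divr_gt0.
move=> y; rewrite ltr_pdivlMr // => h.
have -> : z + (y%:C)%C * (w - z) - (z + (x%:C)%C * (w - z)) =
  ((y - x)%:C)%C * (w - z) by rewrite rmorphB; ring.
rewrite cmodM cmod_real; apply: le_lt_trans h.
by rewrite ler_wpM2l // lerDl.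
Qed.

Lemma cseg_l z w : cseg z w z.
Proof. by exists 0; rewrite ?mul0r ?addr0 //= in_itv /= lexx ler01. Qed.

Lemma cseg_r z w : cseg z w w.
Proof. by exists 1; rewrite ?mul1r ?subrKC //= in_itv /= lexx ler01. Qed.

Lemma star_connected (A : set C) z : (forall w, A w -> cseg z w `<=` A) ->
  connected A.
Proof.
move=> st; have [A0|/set0P[w Aw]] := eqVneq A set0.
  by rewrite A0; exact: connected0.
have -> : A = \bigcup_(w in A) cseg z w.
  apply/seteqP; split=> [v Av|v [u Au /(st u Au)]//].
  by exists v => //; exact: cseg_r.
apply: bigcup_connected; last by move=> v _; exact: cseg_connected.
by exists z => v _; exact: cseg_l.
Qed.

Lemma plane_connected : connected [set: C].
Proof. by apply: (@star_connected _ 0). Qed.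

Lemma cseg_cmod z w v : cseg z w v -> cmod (v - z) <= cmod (w - z).
Proof.
move=> [t /=]; rewrite in_itv /= => /andP[t0 t1] <-.
rewrite addrAC subrr add0r cmodM cmod_real ger0_norm //.
by rewrite -[X in _ <= X]mul1r ler_wpM2r ?cmod_ge0.
Qed.

Lemma cball_connected z r : connected (cball z r).
Proof.
apply: (@star_connected _ z) => w wz v /cseg_cmod h; exact: (@le_lt_trans _ R _ _ _ h wz).
Qed.

(** Each circle in the set is joined to the common point [z + r] by a radial segment in the set.
    Since [S] may be bounded or not, this covers annuli and exteriors of discs. *)
Lemma ring_connected z r (S : set R) : 0 < r -> (forall s, S s -> r <= s) ->
  (forall s u, S s -> r <= u <= s -> S u) ->
  connected [set w : C | S (cmod (w - z))].
Proof.
move=> r0 rS Su.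
pose ray s := cseg (z + (r%:C)%C) (z + (s%:C)%C).
pose circle s := polar z s @` `[- pi, pi].
have -> : [set w : C | S (cmod (w - z))] =
    \bigcup_(s in S) (ray s `|` circle s).
  apply/seteqP; split=> [w /= Sw|w [s Ss]].
    exists (cmod (w - z)) => //; right.
    have wz : w != z by rewrite -subr_eq0 -cmod_gt0 (lt_le_trans r0) // rS.
    by have [t tp wt] := polar_onto wz; exists t.
  have rs := rS s Ss.
  case=> [[t /=]|[t _ <-]] /=; last by rewrite cmod_polar // (le_trans (ltW r0)).
  rewrite in_itv /= => /andP[t0 t1] <-.
  have -> : z + (r%:C)%C + (t%:C)%C * (z + (s%:C)%C - (z + (r%:C)%C)) - z =
    ((r + t * (s - r))%:C)%C by rewrite rmorphD rmorphM rmorphB /=; ring.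
  have h : 0 <= t * (s - r) by rewrite mulr_ge0 // subr_ge0.
  have h' : t * (s - r) <= s - r.
    by rewrite -[X in _ <= X]mul1r ler_wpM2r // subr_ge0.
  by rewrite cmod_real ger0_norm; [apply: (Su s) => //; apply/andP; split|]; lra.
apply: bigcup_connected.
  by exists (z + (r%:C)%C) => s _; left; exact: cseg_l.
move=> s Ss; apply: connectedU; last first.
- by apply: path_connected => x _; exact: polar_continuous.
- exact: cseg_connected.
exists (z + (s%:C)%C); split; first exact: cseg_r.
exists 0; first by rewrite /= in_itv /= oppr_le0 pi_ge0.
rewrite /polar cos0 sin0; case: (z) => z1 z2.
by apply/eqP; rewrite eq_complex /=; apply/andP; split; apply/eqP; ring.
Qed.

(** The clopen argument in metric form: [B] only has to be open and closed relative to [A]. *)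
Lemma connected_clopen (A B : set C) : connected A -> A !=set0 ->
  (forall z, A z -> B z -> exists2 r : R, 0 < r & forall w, A w -> cmod (w - z) < r -> B w) ->
  (forall z, A z -> ~ B z -> exists2 r : R, 0 < r & forall w, A w -> cmod (w - z) < r -> ~ B w) ->
  A `&` B !=set0 -> A `<=` B.
Proof.
move=> cA A0 oB oNB AB0.
pose U := \bigcup_(p in [set p : C * R | forall w, A w -> cball p.1 p.2 w -> B w])
   cball p.1 p.2.
pose V := \bigcup_(p in [set p : C * R | forall w, A w -> cball p.1 p.2 w -> ~ B w])
   cball p.1 p.2.
have oU : open U by apply: bigcup_open => p _; exact: cball_open.
have oV : open V by apply: bigcup_open => p _; exact: cball_open.
have ABU : A `&` B = A `&` U.
  apply/seteqP; split=> z [Az h]; split=> //.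
    have [r r0 rP] := oB z Az h; exists (z, r) => //=; exact: cball_center.
  by case: h => p /= H pz; exact: H.
have ABV : A `&` B = A `&` ~` V.
  apply/seteqP; split=> z [Az h]; split=> //.
    by case=> p /= H pz; exact: (H z Az pz h).
  apply: contrapT => Bz; apply: h; have [r r0 rP] := oNB z Az Bz.
  by exists (z, r) => //=; exact: cball_center.
have <- : A `&` B = A.
  apply: cA => //; first by exists U.
  by exists (~` V) => //; exact: open_closedC.
by move=> z [].
Qed.

Lemma closure_boundary (V : set C) z : open V -> closure V z ->
  V z \/ boundary V z.
Proof.
move=> oV cV; have [Vz|nVz] := pselect (V z); [by left|right; split=> //].
by move=> /interior_subset.
Qed.

Lemma open_boundary (V : set C) z : open V -> boundary V z -> ~ V z.
Proof. by rewrite openE => oV [_ nV] /oV. Qed.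

Lemma bounded_closure (V : set C) : bounded_set V -> bounded_set (closure V).
Proof.
move=> /boundedP[M HM]; apply/boundedP; exists (M + 1) => z /closureP cV.
have [w Vw wz] := cV 1 ltr01; have := cmodB_ge z w; rewrite cmodB.
by have := HM w Vw; lra.
Qed.

Lemma bounded_point (V : set C) : bounded_set V ->
  exists2 z : C, ~ V z & True.
Proof.
move=> /boundedP[M HM]; exists ((`|M| + 1)%:C)%C => // /HM.
rewrite cmod_real ger0_norm ?addr_ge0 //.
by have := ler_norm M; lra.
Qed.

Lemma compact_max (A : set C) (u : C -> R) : A !=set0 -> closed A ->
  bounded_set A ->
  (forall z, A z -> forall e : R, 0 < e -> exists2 d : R, 0 < d &
    forall w, A w -> cmod (w - z) < d -> `|u w - u z| < e) ->
  exists2 z, A z & forall w, A w -> u w <= u z.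
Proof.
move=> A0 cA bA cu; have kA := compactP cA bA.
have [|z] := @compact_EVT_max _ R u A A0 kA.
  apply/subspace_continuousP => z Az B /nbhs_ballP[e /= e0 eB].
  have [d d0 dP] := cu z Az e e0; apply/nbhs_cballP; exists d => // w zw Aw.
  by apply: eB; rewrite /ball /= distrC dP.
by rewrite inE => Az zP; exists z => // w Aw; apply: zP; rewrite inE.
Qed.

(** If the maximum of the modulus over the closure exceeded [M], it would be attained only inside
    [V]. The points where it is attained form an open set by the strong form and a closed one by
    continuity, hence the whole plane, although [V] is bounded. *)
Lemma maximum_principle (V : set C) f (M : R) : open V -> bounded_set V ->
  (forall w, closure V w -> exists c, has_cderiv f w c) ->
  (forall w, boundary V w -> cmod (f w) <= M) ->
  forall w, V w -> cmod (f w) <= M.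
Proof.
move=> oV bV df fM w Vw; rewrite leNgt; apply/negP => Mw.
have cV w' : V w' -> closure V w' by exact: subset_closure.
have cf z : closure V z -> forall e : R, 0 < e -> exists2 d : R, 0 < d &
    forall v, cmod (v - z) < d -> `|cmod (f v) - cmod (f z)| < e.
  move=> /df[c /has_cderiv_continuous /continuousP] + e e0 => /(_ e e0)[d d0 dP].
  exists d => // v /dP; apply: le_lt_trans; rewrite ler_norml cmodB_ge andbT.
  by rewrite lerNl opprB cmodB cmodB_ge.
have [||||z Vz zmax] := @compact_max (closure V) (fun v => cmod (f v)).
- by exists w; exact: cV.
- exact: closed_closure.
- exact: bounded_closure.
- move=> z /cf H e /H[d d0 dP]; exists d => // v _; exact: dP.
have Mz : M < cmod (f z) by apply: lt_le_trans Mw (zmax _ (cV _ Vw)).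
pose S := [set v | V v /\ cmod (f v) = cmod (f z)].
have VS v : closure V v -> cmod (f v) = cmod (f z) -> V v.
  move=> cv fv; case: (closure_boundary oV cv) => // /fM.
  by rewrite fv leNgt Mz.
have [v nVv _] := bounded_point bV; apply: nVv.
suff H : [set: C] `<=` S by have [] := H v I.
apply: connected_clopen.
- exact: plane_connected.
- by exists z.
- move=> p _ [Vp fp]; have [r r0 rV] := (openP V).1 oV p Vp.
  have r2 : 0 < r / 2 by rewrite divr_gt0.
  have rV' q : cmod (q - p) <= r / 2 -> V q.
    by move=> h; apply: rV; rewrite /cball /=; lra.
  exists (r / 2) => // q _ /ltW qp; split; first exact: rV'.
  rewrite (strong_maximum r2 _ _ qp) //.
    by move=> u /rV' /cV /df.
  by move=> u /rV' /cV /zmax; rewrite fp.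
- move=> p _ nSp; apply: contrapT => H.
  have H' r : 0 < r -> exists2 q, S q & cmod (q - p) < r.
    move=> r0; apply: contrapT => Hr; apply: H; exists r => // q _ qp Sq.
    by apply: Hr; exists q.
  have cp : closure V p.
    by apply/closureP => r /H'[q [Vq _] qp]; exists q.
  have fp : cmod (f p) = cmod (f z).
    apply/eqP; rewrite -subr_eq0 -normr_le0; apply/ler_addgt0Pr => e e0.
    have [d d0 dP] := cf p cp e e0; have [q [_ <-] qp] := H' d d0.
    by rewrite add0r distrC ltW // dP.
  by apply: nSp; split=> //; exact: VS.
- by exists z; split => //; split => //; exact: VS.
Qed.

End MaximumPrinciple.

(** * Images and boundary orbits under entire functions *)

Section Entire.
Variable R : realType.
Local Notation C := R[i].
Implicit Types (f g : C -> C) (z w c p q : C) (V W : set C).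

Definition cdiff f := forall z, exists c, has_cderiv f z c.

Lemma cdiff_continuous f z : cdiff f -> {for z, continuous f}.
Proof. by move=> /(_ z)[c /has_cderiv_continuous]. Qed.

Lemma cdiff_iter f n : cdiff f -> cdiff (iter n f).
Proof.
move=> df; elim: n => [|n IHn] z; first by exists 1; exact: has_cderiv_id.
have [c dn] := IHn z; have [c' d1] := df (iter n f z).
by exists (c' * c); exact: has_cderiv_comp dn d1.
Qed.

Lemma has_cderivX f z c n : has_cderiv f z c ->
  exists c', has_cderiv (fun w => f w ^+ n) z c'.
Proof.
move=> df; elim: n => [|n [c' IHn]]; first by exists 0; exact: has_cderiv_cst.
exists (c * f z ^+ n + f z * c').
rewrite (_ : (fun _ => _) = fun w => f w * f w ^+ n); first exact: has_cderivM.
by apply/funext => w; rewrite exprS.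
Qed.

Lemma has_cderivBV f z c q : has_cderiv f z c -> f z != q ->
  exists c', has_cderiv (fun w => (f w - q)^-1) z c'.
Proof.
move=> df fq; exists (- (c - 0) / (f z - q) ^+ 2); apply: has_cderivV.
  by apply: has_cderivB => //; exact: has_cderiv_cst.
by rewrite subr_eq0.
Qed.

Lemma closed_image f (A : set C) : (forall z, {for z, continuous f}) ->
  closed A -> bounded_set A -> closed (f @` A).
Proof.
move=> cf cA bA; apply: compact_closed; first exact: norm_hausdorff.
apply: continuous_compact; last exact: compactP.
exact/continuous_subspaceT.
Qed.

Lemma bounded_image f (A : set C) : (forall z, {for z, continuous f}) ->
  closed A -> bounded_set A -> bounded_set (f @` A).
Proof.
move=> cf cA bA; have [A0|A0] := eqVneq A set0.
  by rewrite A0 image_set0; apply/boundedP; exists 0 => z.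
have [||z Az zP] := @compact_max R A (fun z => cmod (f z)) _ cA bA.
- exact/set0P.
- move=> z _ e e0; have /continuousP/(_ e e0)[d d0 dP] := cf z.
  exists d => // v _ /dP; apply: le_lt_trans; rewrite ler_norml cmodB_ge andbT.
  by rewrite lerNl opprB cmodB cmodB_ge.
by apply/boundedP; exists (cmod (f z)) => _ [w /zP fw <-].
Qed.

Lemma closed_boundary V : closed (boundary V).
Proof.
have -> : boundary V = closure V `&` ~` interior V by [].
apply: closedI; first exact: closed_closure.
exact/open_closedC/open_interior.
Qed.

Lemma bounded_boundary V : bounded_set V -> bounded_set (boundary V).
Proof.
by move=> /bounded_closure /boundedP[M MP]; apply/boundedP; exists M => z [/MP].
Qed.

Lemma closed_gap (A : set C) p : closed A -> ~ A p ->
  exists2 d : R, 0 < d & forall w, A w -> d <= cmod (w - p).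
Proof.
move=> cA nAp; have /openP/(_ p nAp)[d d0 dP] := closed_openC cA.
by exists d => // w Aw; rewrite leNgt; apply/negP => /dP.
Qed.

(** Otherwise [p] is the value at some [z] in [V] and has distance at least [d] from the image of
    the boundary. For a value [q] omitted on [V] and within [d / 3] of [p], the function 1 / (f - q)
    is at most 3 / (2d) on the boundary but exceeds 3 / d at [z]. *)
Lemma boundary_image f V : cdiff f -> open V -> bounded_set V ->
  boundary (f @` V) `<=` f @` boundary V.
Proof.
move=> df oV bV p [cp ip].
have cf z : {for z, continuous f} by exact: cdiff_continuous.
have : (f @` closure V) p.
  rewrite (closure_id (f @` closure V)).1; last first.
    by apply: (closed_image cf); [exact: closed_closure|exact: bounded_closure].
  by apply: closureS cp; apply: image_subset; exact: subset_closure.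
move=> [z cz fz]; case: (closure_boundary oV cz) => [Vz|]; last by exists z.
apply: contrapT => np.
have [|d d0 dP] := @closed_gap (f @` boundary V) p _ np.
  by apply: (closed_image cf); [exact: closed_boundary|exact: bounded_boundary].
have [q nq qp] : exists2 q, ~ (f @` V) q & cmod (q - p) < d / 3.
  apply: contrapT => H; apply: ip; apply/interiorP; exists (d / 3).
    by rewrite divr_gt0.
  by move=> q qp; apply: contrapT => nq; apply: H; exists q.
have fq w : boundary V w -> 2 * d / 3 <= cmod (f w - q).
  move=> bw; have := dP _ (imageP f bw).
  by have := cmodB_trans q (f w) p; lra.
have fnq w : closure V w -> f w != q.
  move=> /(closure_boundary oV)[Vw|/fq bw]; apply/eqP => fwq.
    by apply: nq; exists w.
  by move: bw; rewrite fwq subrr cmod0; lra.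
have := @maximum_principle R V (fun w => (f w - q)^-1) (2 * d / 3)^-1 oV bV.
have e0 : 0 < 2 * d / 3 by lra.
move=> /(_ _ _ z Vz); rewrite fz cmodV => H.
have pq : 0 < cmod (p - q).
  by rewrite cmod_gt0 subr_eq0 -fz; apply: fnq; exact: subset_closure.
have : 2 * d / 3 <= cmod (p - q).
  rewrite -lef_pV2 ?posrE //; apply: H.
    move=> w cw; have [c dw] := df w.
    exact: has_cderivBV dw (fnq w cw).
  move=> w /fq bw; rewrite cmodV lef_pV2 ?posrE //.
  exact: lt_le_trans bw.
by rewrite cmodB; lra.
Qed.

(* Maximum principle for [(f - c) / (z - z0)^k] on an annulus, as k grows. *)
Lemma locally_constant_entire f z0 c (r : R) : cdiff f -> 0 < r ->
  (forall w, cmod (w - z0) <= r -> f w = c) -> forall z, f z = c.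
Proof.
move=> df r0 fc z; have [zr|zr] := leP (cmod (z - z0)) r; first exact: fc.
(* With outer radius twice the distance of [z], raising [k] by one halves the bound at [z]. *)
pose L := 2 * cmod (z - z0).
have z1 : 0 < cmod (z - z0) := lt_trans r0 zr.
pose V := [set w : C | r < cmod (w - z0) < L].
have oV : open V.
  apply/openP => w /andP[w1 w2].
  exists (Num.min (cmod (w - z0) - r) (L - cmod (w - z0))).
    by rewrite lt_min !subr_gt0 w1.
  move=> v; rewrite /cball /= lt_min => /andP[v1 v2]; apply/andP; split.
    have := cmodB_ge (w - z0) (w - v).
    have -> : w - z0 - (w - v) = v - z0 by ring.
    by rewrite (cmodB w v); lra.
  by have := cmodB_trans w v z0; lra.
have bV : bounded_set V.
  apply/boundedP; exists (L + cmod z0) => w /andP[_ w2].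
  by have := cmodB_ge w z0; lra.
have cV w : closure V w -> r <= cmod (w - z0) <= L.
  move=> /closureP H; apply/andP; split; apply/ler_addgt0Pr => e /H[v].
    by move=> /andP[v1 v2] vw; have := cmodB_trans w v z0; lra.
  move=> /andP[v1 v2]; rewrite cmodB => vw.
  by have := cmodB_trans v w z0; lra.
have bdV w : boundary V w -> cmod (w - z0) = r \/ cmod (w - z0) = L.
  move=> bw; have nVw := open_boundary oV bw; have [/cV /andP[w1 w2] _] := bw.
  have [w3|w3] := leP (cmod (w - z0)) r; [left|right]; apply/eqP.
    by rewrite eq_le w1 w3.
  rewrite eq_le w2 leNgt; apply/negP => w4; apply: nVw.
  by rewrite /V /= w3.
pose h w := f w - c.
have [M M0 hM] : exists2 M : R, 0 <= M & forall w, boundary V w -> cmod (h w) <= M.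
  have : bounded_set (h @` boundary V).
    apply: bounded_image; [|exact: closed_boundary|exact: bounded_boundary].
    move=> w; have [c' dw] := df w.
    exact: has_cderiv_continuous (has_cderivB dw (has_cderiv_cst c w)).
  move=> /boundedP[M HM]; exists `|M| => // w bw.
  by apply: le_trans (ler_norm M); apply: HM; exists w.
have key k : cmod (h z) <= M / 2 ^+ k.
  pose g w := h w * ((w - z0)^-1) ^+ k.
  have L0 : 0 < L by rewrite mulr_gt0.
  have gM : cmod (g z) <= M / L ^+ k.
    apply: (maximum_principle oV bV); last first.
    - by rewrite /V /= zr /L; lra.
    - move=> w bw; have [wr|wL] := bdV w bw.
        rewrite /g /h fc ?wr // subrr mul0r cmod0.
        by rewrite divr_ge0 // exprn_ge0 // ltW.
      rewrite cmodM cmodX cmodV wL exprVn ler_wpM2r ?hM //.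
      by rewrite invr_ge0 exprn_ge0 // ltW.
    - move=> w /cV /andP[w1 _]; have [c1 d1] := df w.
      have wz : w != z0 by rewrite -subr_eq0 -cmod_gt0 (lt_le_trans r0).
      have [c2 d2] := has_cderivBV (has_cderiv_id w) wz.
      have [c3 d3] := has_cderivX k d2.
      by eexists; apply: (has_cderivM (has_cderivB d1 (has_cderiv_cst c w)) d3).
  move: gM; rewrite cmodM cmodX cmodV exprVn ler_pdivrMr ?exprn_gt0 //.
  move=> gM; apply: le_trans gM _; rewrite /L exprMn invfM mulrA.
  by rewrite mulfVK // gt_eqF // exprn_gt0.
apply/eqP; rewrite -subr_eq0 -cmod_eq0 eq_le cmod_ge0 andbT.
rewrite leNgt; apply/negP => hz.
pose n := Num.truncn (M / cmod (h z)).
have := key n.+1; rewrite ler_pdivlMr ?exprn_gt0 // leNgt => /negP; apply.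
rewrite mulrC -ltr_pdivrMr //; apply: lt_trans (truncnS_gt _) _.
by rewrite -natrX ltr_nat; exact: ltn_expl.
Qed.

Lemma nested_closed (F : nat -> set C) : (forall n, closed (F n)) ->
  (forall n, F n !=set0) -> (forall n, F n.+1 `<=` F n) -> bounded_set (F 0%N) ->
  exists z, forall n, F n z.
Proof.
move=> cF nF sF bF.
have mF m n : (m <= n)%N -> F n `<=` F m.
  by move=> /subnK <-; elim: (n - m)%N => [//|k IH] z; rewrite addSn => /sF /IH.
have [u uP] := choice nF.
have kF := compactP (cF 0%N) bF.
have : (u @ \oo) (F 0%N) by exists 0%N => // n _; exact: mF (uP n).
move=> /(kF _ _)[z [Fz cz]]; exists z => n.
rewrite (closure_id (F n)).1 // => B Bz.
have [|w [Fw Bw]] := cz (F n) B _ Bz; last by exists w.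
exists n => // m /= nm; exact: (mF _ _ nm _ (uP m)).
Qed.

Definition nonconstant f := ~ exists c, forall z, f z = c.

(* If [f^N] maps a neighbourhood of [z] into [f^N(cl W)], where [f^N z] is a
   point of [f^N(cl W)] closest to an outside point [q], then [1 / (f^N - q)] has
   a local maximum at [z]. *)
Lemma exterior_adherent h W : cdiff h -> nonconstant h -> open W ->
  bounded_set W -> W !=set0 ->
  exists2 z, boundary W z & closure (h @^-1` ~` (h @` closure W)) z.
Proof.
move=> dh nh oW bW [w0 Ww0]; apply: contrapT => H.
have ch z : {for z, continuous h} by exact: cdiff_continuous.
have bcW := bounded_closure bW.
have [q nq _] := bounded_point (bounded_image ch (@closed_closure _ W) bcW).
have [||z cz zP] := @compact_max R (closure W) (fun z => - cmod (h z - q)) _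
  (@closed_closure _ W) bcW.
- by exists w0; exact: subset_closure.
- move=> z _ e e0; have /continuousP/(_ e e0)[d d0 dP] := ch z.
  exists d => // v _ /dP; apply: le_lt_trans.
  rewrite opprK addrC; have -> : h v - h z = (h v - q) - (h z - q) by ring.
  rewrite distrC ler_norml cmodB_ge andbT.
  by rewrite lerNl opprB (cmodB (h v - q)) cmodB_ge.
have [r r0 rP] : exists2 r : R, 0 < r &
    forall w, cmod (w - z) < r -> (h @` closure W) (h w).
  have : ~ closure (h @^-1` ~` (h @` closure W)) z.
    case: (closure_boundary oW cz) => [Wz|bz] cX; last by apply: H; exists z.
    have [w [/= hw Ww]] := cX W ((nbhs_cballP _ _).2 ((openP W).1 oW z Wz)).
    by apply: hw; exists w; [exact: subset_closure|].
  move=> nX; apply: contrapT => Hr; apply: nX; apply/closureP => r r0.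
  apply: contrapT => Hr'; apply: Hr; exists r; first by [].
  by move=> w wz; apply: contrapT => hw; apply: Hr'; exists w.
have hq w : closure W w -> h w != q.
  by move=> cw; apply/eqP => hwq; apply: nq; exists w.
have hm w : cmod (w - z) < r -> cmod (h z - q) <= cmod (h w - q) /\ h w != q.
  move=> /rP[v cv <-]; split; last exact: hq.
  by have := zP v cv; rewrite lerN2.
have r2 : 0 < r / 2 by rewrite divr_gt0.
have small w : cmod (w - z) <= r / 2 -> cmod (w - z) < r by lra.
apply: nh; exists (h z) => w.
apply: (locally_constant_entire dh r2 _ w) => v vz.
have := @strong_maximum R (fun w => (h w - q)^-1) z _ r2 _ _ v vz.
move=> /= E; apply: (addIr (- q)); apply: invr_inj; apply: E.
  move=> u /small /hm[_ hu]; have [c du] := dh u.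
  exact: has_cderivBV du hu.
move=> u /small /hm[hu hu']; rewrite !cmodV lef_pV2 ?posrE ?cmod_gt0 ?subr_eq0 //.
exact: hq.
Qed.

(** The point that [exterior_adherent] gives for f^N satisfies the bounds for all k <= N. Otherwise
    some nearby x with f^N(x) outside f^N(cl W) has f^k(x) in D(0,b_k), hence in f^k(W), and then
    f^N(x) lies in f^N(W). Compactness of the boundary gives one point for all [N]. *)
Lemma boundary_orbit f W (b : nat -> R) : cdiff f -> open W -> bounded_set W ->
  W !=set0 -> (forall k, nonconstant (iter k f)) ->
  (forall k, disc0 (b k) `<=` iter k f @` W) ->
  exists2 z, boundary W z & forall k, b k <= cmod (iter k f z).
Proof.
move=> df oW bW W0 ncf bP.
have ck k z : {for z, continuous (iter k f)}.
  by apply: cdiff_continuous; exact: cdiff_iter.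
pose F N := boundary W `&` [set z | forall k, (k <= N)%N -> b k <= cmod (iter k f z)].
have [||||z zP] := @nested_closed F.
- move=> N z /closureP cz; split.
    rewrite (closure_id (boundary W)).1; last exact: closed_boundary.
    by apply/closureP => r /cz[w [bw _] wz]; exists w.
  move=> k kN; apply/ler_addgt0Pr => e e0.
  have /continuousP/(_ e e0)[d d0 dP] := ck k z.
  have [w [_ /(_ k kN) bw] /dP wz] := cz d d0.
  by have := cmodB_ge (iter k f w) (iter k f z); lra.
- move=> N; have dN := cdiff_iter N df.
  have [z bz cz] := exterior_adherent dN (ncf N) oW bW W0.
  exists z; split=> // k kN; rewrite leNgt; apply/negP => zb.
  have e0 : 0 < b k - cmod (iter k f z) by rewrite subr_gt0.
  have /continuousP/(_ _ e0)[d d0 dP] := ck k z.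
  have /closureP/(_ d d0)[x xX xz] := cz.
  have bx : disc0 (b k) (iter k f x).
    by rewrite /disc0 /=; have := dP x xz; have := cmodB_ge (iter k f x) (iter k f z); lra.
  have [w Ww fw] := bP k _ bx; apply: xX; exists w; first exact: subset_closure.
  by rewrite -(subnK kN) !iterD fw.
- by move=> N z [bz zP]; split=> // k kN; apply: zP; exact: leqW.
- have /boundedP[M MP] := bounded_boundary bW.
  by apply/boundedP; exists M => z [/MP].
exists z; first by case: (zP 0%N).
by move=> k; have [_ /(_ k (leqnn k))] := zP k.
Qed.

End Entire.

(** * Components of plane sets *)

Section PlaneSets.
Variable R : realType.
Local Notation C := R[i].
Implicit Types (z w c p q : C) (A B V W X T : set C).

(** For empty [A] the infimum is a default value; whence the nonemptiness assumptions in what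
    follows. *)
Definition cdist A z : R := inf [set cmod (w - z) | w in A].

Lemma cdist_le A z w : A w -> cdist A z <= cmod (w - z).
Proof.
move=> Aw; apply: ge_inf; last by exists w.
by exists 0 => _ [v _ <-]; exact: cmod_ge0.
Qed.

Lemma le_cdist A z (d : R) : A !=set0 -> (forall w, A w -> d <= cmod (w - z)) ->
  d <= cdist A z.
Proof.
move=> [w Aw] H; apply: lb_le_inf; first by exists (cmod (w - z)); exists w.
by move=> _ [v /H + <-].
Qed.

Lemma cdist_ge0 A z : A !=set0 -> 0 <= cdist A z.
Proof. by move=> A0; apply: le_cdist => // w _; exact: cmod_ge0. Qed.

Lemma cdist_mem A z : A z -> cdist A z = 0.
Proof.
move=> Az; apply/eqP; rewrite eq_le cdist_ge0; last by exists z.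
by have := cdist_le z Az; rewrite subrr cmod0 => ->.
Qed.

Lemma cdistD A z w : A !=set0 -> cdist A z <= cdist A w + cmod (z - w).
Proof.
move=> A0; rewrite -lerBlDr; apply: le_cdist => // v Av.
have := cdist_le z Av; have := cmodB_trans w v z; rewrite (cmodB w z); lra.
Qed.

Lemma cdist_lip A z w : A !=set0 -> `|cdist A z - cdist A w| <= cmod (z - w).
Proof.
move=> A0; have := cdistD z w A0; have := cdistD w z A0.
by rewrite (cmodB w z) ler_norml => h1 h2; apply/andP; split; lra.
Qed.

Lemma cdist_gt0 A z : A !=set0 -> closed A -> ~ A z -> 0 < cdist A z.
Proof.
move=> A0 cA /(closed_gap cA)[d d0 dP]; apply: lt_le_trans d0 _.
exact: le_cdist.
Qed.

Lemma cdist_lt A z (d : R) : A !=set0 -> cdist A z < d ->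
  exists2 w, A w & cmod (w - z) < d.
Proof.
move=> A0 zd; apply: contrapT => H; suff : d <= cdist A z by rewrite leNgt zd.
by apply: le_cdist => // w Aw; rewrite leNgt; apply/negP => wz; apply: H; exists w.
Qed.

Lemma compact_gap A B : A !=set0 -> B !=set0 -> closed A -> bounded_set A ->
  closed B -> A `&` B = set0 -> exists2 d : R, 0 < d &
  forall z w, A z -> B w -> d <= cmod (w - z).
Proof.
move=> A0 B0 cA bA cB AB.
have [|z Az zP] := @compact_max R A (fun z => - cdist B z) A0 cA bA.
  move=> z _ e e0; exists e => // w _; apply: le_lt_trans; rewrite (cmodB w).
  have -> : - cdist B w - - cdist B z = cdist B z - cdist B w by ring.
  exact: cdist_lip.
exists (cdist B z).
  apply: cdist_gt0 => // Bz; suff : (A `&` B) z by rewrite AB.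
  by split.
move=> u w Au Bw; apply: le_trans (cdist_le u Bw).
by have := zP u Au; rewrite lerN2.
Qed.

(** The two pieces of a separation of a compact set are closed in the plane, so they are disjoint
    compact sets and have positive distance. *)
Lemma disconnected_gap A : closed A -> bounded_set A -> ~ connected A ->
  exists A0 A1 : set C, [/\ A0 !=set0, A1 !=set0, closed A0, closed A1 &
   A = A0 `|` A1 /\ exists2 d : R, 0 < d &
     forall z w, A0 z -> A1 w -> d <= cmod (w - z)].
Proof.
move=> cA bA /connectedPn[E [E0 EU [E1 E2]]].
have cE b : closed (E b).
  have sub : closure (E b) `<=` A.
    rewrite [X in _ `<=` X](closure_id A).1 //; apply: closureS.
    by rewrite EU; case: b => z; [right|left].
  rewrite closure_id eqEsubset; split; first exact: subset_closure.
  move=> z cz; have := sub z cz; rewrite EU => -[] Ez; case: b cz {sub} => // cz.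
    suff : set0 z by []. by rewrite -E2; split.
  suff : set0 z by []. by rewrite -E1; split.
exists (E false), (E true); split => //; split=> //.
apply: compact_gap => //.
  have /boundedP[M MP] := bA; apply/boundedP; exists M => z Ez; apply: MP.
  by rewrite EU; left.
by rewrite -(closure_id _).1 in E1.
Qed.

Lemma connected_boundary A V : connected A -> A `&` V !=set0 ->
  A `&` ~` V !=set0 -> A `&` boundary V !=set0.
Proof.
move=> cA AV [w [Aw nVw]]; apply: contrapT => H; apply: nVw.
have nb z : A z -> ~ boundary V z by move=> Az bz; apply: H; exists z.
apply: (connected_clopen cA) Aw => //; first by case: AV => z [Az _]; exists z.
  move=> z Az Vz; have /interiorP[r r0 rP] : interior V z.
    apply: contrapT => nV; apply: (nb z Az); split=> //; exact: subset_closure.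
  by exists r => // v _; exact: rP.
move=> z Az nVz; apply: contrapT => Hr; apply: (nb z Az); split; last first.
  by move=> /interior_subset.
apply/closureP => r r0; apply: contrapT => Hr'; apply: Hr; exists r => // v _ vz Vv.
by apply: Hr'; exists v.
Qed.

Lemma bounded_open_boundary V : bounded_set V -> V !=set0 -> boundary V !=set0.
Proof.
move=> bV [v Vv]; have [w nVw _] := bounded_point bV.
have [||z [_ bz]] := connected_boundary (V := V) (@plane_connected R).
- by exists v.
- by exists w.
by exists z.
Qed.

Lemma component_open A z : open A -> open (connected_component A z).
Proof.
move=> oA; apply/openP => w zw; have Aw := connected_component_sub zw.
have [r r0 rA] := (openP A).1 oA w Aw; exists r => // v wv.
apply: connected_component_trans zw _.
exists (cball w r); last exact: wv.
by split; [exact: cball_center|exact: rA|exact: cball_connected].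
Qed.

(** A boundary point in [A] would be the centre of a disc in [A] that meets the component, hence is
    contained in it. *)
Lemma component_boundary A z : open A ->
  boundary (connected_component A z) `<=` ~` A.
Proof.
move=> oA w bw Aw; have oz : open (connected_component A z) by exact: component_open.
apply: (open_boundary oz bw); case: bw => cw _.
have [r r0 rA] := (openP A).1 oA w Aw.
have [v [zv wv]] := cw (cball w r) (open_nbhs_nbhs (conj (@cball_open R w r) (@cball_center R w r r0))).
apply: connected_component_trans zv _; exists (cball w r); last exact: cball_center.
by split; [exact: wv|exact: rA|exact: cball_connected].
Qed.

(** The points joined to infinity off [B]; for bounded [B] this is the unbounded component of the
    complement. *)
Definition outer B : set C :=
  [set z | exists X, [/\ connected X, X `<=` ~` B, X z & ~ bounded_set X]].

(** * Filling the holes of a bounded open set *)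

Section Outer.
Variables (B : set C) (r : R).
Hypotheses (r0 : 0 < r) (Br : forall z, B z -> cmod z < r).

Let far : set C := [set z : C | r <= cmod (z - 0)].

Let far_conn : connected far.
Proof.
apply: (@ring_connected R 0 r [set s | r <= s]) => // s u /= _ /andP[//].
Qed.

Let far_unbounded : ~ bounded_set far.
Proof.
move=> /boundedP[M MP]; have M0 := normr_ge0 M; have M1 := ler_norm M.
have p0 : 0 <= `|M| + r + 1 by rewrite addr_ge0 // addr_ge0 // ltW.
have : far ((`|M| + r + 1)%:C)%C.
  by rewrite /far /mkset subr0 cmod_real ger0_norm //; lra.
move=> /MP; rewrite cmod_real ger0_norm // leNgt => /negP; apply.
have h := r0; lra.
Qed.

Lemma outer_far z : r <= cmod z -> outer B z.
Proof.
move=> rz; exists far; split; [exact: far_conn| |by rewrite /far /= subr0|exact: far_unbounded].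
move=> w; rewrite /far /= subr0 => rw /Br; rewrite ltNge.
by move=> /negP; apply.
Qed.

Lemma outerC z : outer B z -> ~ B z.
Proof. by case=> X [_ XB Xz _]; exact: XB. Qed.

(** Every unbounded set off [B] meets [far], which is itself connected. *)
Lemma outer_connected : connected (outer B).
Proof.
have -> : outer B = \bigcup_(X in [set X | connected X /\ X `<=` ~` B /\
    ~ bounded_set X]) (X `|` far).
  apply/seteqP; split=> [z [X [cX XB Xz bX]]|z [X [cX [XB bX]] [Xz|]]].
  - by exists X => //; left.
  - by exists X.
  - by rewrite /far /= subr0; exact: outer_far.
apply: bigcup_connected.
  by exists ((r%:C)%C) => X _; right; rewrite /far /mkset subr0 cmod_real ger0_norm // ltW.
move=> X [cX [XB bX]]; apply: connectedU => //.
apply: contrapT => H; apply: bX; apply/boundedP; exists r => z Xz.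
rewrite leNgt; apply/negP => /ltW rz; apply: H; exists z; split=> //.
by rewrite /far /= subr0.
Qed.

Lemma outer_unbounded : ~ bounded_set (outer B).
Proof.
move=> /boundedP[M MP]; apply: far_unbounded; apply/boundedP; exists M => z.
by rewrite /far /= subr0 => /outer_far /MP.
Qed.

Lemma outer_max X : connected X -> X `<=` ~` B -> X `&` outer B !=set0 ->
  X `<=` outer B.
Proof.
move=> cX XB X0 z Xz; exists (X `|` outer B); split.
- by apply: connectedU => //; exact: outer_connected.
- by move=> w [/XB//|/outerC].
- by left.
- move=> /boundedP[M MP]; apply: outer_unbounded; apply/boundedP; exists M => w ow.
  by apply: MP; right.
Qed.

Hypothesis oB : open B.

Lemma outer_closed : closed (outer B).
Proof.
rewrite closure_id eqEsubset; split; first exact: subset_closure.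
apply: outer_max; first by apply: connected_closure; exact: outer_connected.
  rewrite [X in _ `<=` X](closure_id _).1; last exact: open_closedC.
  by apply: closureS => z; exact: outerC.
have rr : outer B ((r%:C)%C).
  by apply: outer_far; rewrite cmod_real ger0_norm // ltW.
by exists ((r%:C)%C); split=> //; exact: subset_closure.
Qed.

Definition fill : set C := ~` outer B.

Lemma fill_open : open fill.
Proof. exact/closed_openC/outer_closed. Qed.

Lemma fill_lt z : fill z -> cmod z < r.
Proof. by move=> nz; rewrite ltNge; apply/negP => /outer_far. Qed.

Lemma sub_fill : B `<=` fill.
Proof. by move=> z Bz /outerC. Qed.

(** A boundary point of the filling lies in [outer B]. If it were not in the closure of [B], a disc
    around it would avoid [B], hence be contained in [outer B], yet it meets the filling. *)
Lemma fill_boundary : boundary fill `<=` boundary B.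
Proof.
move=> z bz; have nz : outer B z.
  by apply: contrapT; exact: (open_boundary fill_open bz).
split; last by move=> /interior_subset; exact: (outerC nz).
apply: contrapT => cz; case: bz => cz' _.
have /openP/(_ z cz)[e e0 eP] : open (~` closure B).
  exact/closed_openC/closed_closure.
have /closureP/(_ e e0)[w nw wz] := cz'; apply: nw.
apply: (@outer_max (cball z e)) => //; first exact: cball_connected.
  by move=> v /eP nv Bv; apply: nv; exact: subset_closure.
by exists z; split=> //; exact: cball_center.
Qed.

(** Every component of the filling meets [B]: otherwise its closure would be a connected set off [B]
    that meets [outer B] at a boundary point, hence would be contained in [outer B]. *)
Lemma fill_connected : connected B -> B !=set0 -> connected fill.
Proof.
move=> cB [b Bb].
have meet z : fill z -> connected_component fill z `&` B !=set0.
  move=> fz; set O := connected_component fill z; apply: contrapT => OB.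
  have oO : open O by apply: component_open; exact: fill_open.
  have Oz : O z by exact: connected_component_refl.
  have bO : bounded_set O.
    by apply/boundedP; exists r => w /connected_component_sub /fill_lt /ltW.
  have [w bw] : boundary O !=set0 by apply: bounded_open_boundary => //; exists z.
  have ow : outer B w.
    by apply: contrapT; exact: (component_boundary fill_open bw).
  apply: fz; apply: (@outer_max (closure O)).
  - exact/connected_closure/component_connected.
  - move=> v cv Bv; have [|u [Ou Bu]] := cv B; first exact: open_nbhs_nbhs.
    by apply: OB; exists u.
  - by exists w; split=> //; case: bw.
  - exact: subset_closure.
have -> : fill = \bigcup_(z in fill) (B `|` connected_component fill z).
  apply/seteqP; split=> [z fz|z [w fw [/sub_fill//|/connected_component_sub//]]].
  by exists z => //; right; exact: connected_component_refl.
apply: bigcup_connected; first by exists b => z _; left.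
move=> z fz; apply: connectedU => //; last exact: component_connected.
by rewrite setIC; exact: meet.
Qed.

End Outer.

(** * Chains and components of compact sets *)

Section Chains.
Variables (Z : set C) (x : C).

(** The points reached from [x] by finite chains in [Z] with steps shorter than [d], encoded as the
    least set that contains [x] and is closed under such steps. *)
Definition chain_class (d : R) : set C := [set y | forall S : set C, S x ->
  (forall u v, S u -> Z v -> cmod (v - u) < d -> S v) -> S y].

Lemma chain_class_refl d : chain_class d x. Proof. by move=> S. Qed.

Lemma chain_class_step d u v : chain_class d u -> Z v -> cmod (v - u) < d ->
  chain_class d v.
Proof. by move=> Su Zv uv S Sx Sstep; apply: (Sstep u) => //; exact: Su. Qed.

Lemma chain_class_sub d : Z x -> chain_class d `<=` Z.
Proof. by move=> Zx y; apply. Qed.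

Lemma chain_class_le d d' : d <= d' -> chain_class d `<=` chain_class d'.
Proof.
move=> dd y Sy S Sx Sstep; apply: Sy => // u v Su Zv uv.
by apply: (Sstep u) => //; exact: lt_le_trans dd.
Qed.

Lemma chain_class_closed d : Z x -> closed Z -> 0 < d -> closed (chain_class d).
Proof.
move=> Zx cZ d0; rewrite closure_id eqEsubset; split; first exact: subset_closure.
move=> y cy; have /closureP/(_ d d0)[u Su uy] := cy.
apply: (chain_class_step Su); last by rewrite cmodB.
rewrite (closure_id Z).1 //; apply: closureS cy; exact: chain_class_sub.
Qed.

(** If the points reached by arbitrarily fine chains split into two parts at distance [d],
    compactness would confine some chain class to the neighbourhoods of width [d / 3] of the parts,
    and steps shorter than [d / 3] cannot pass from one to the other. *)
Lemma chain_class_component : Z x -> closed Z -> bounded_set Z ->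
  \bigcap_n chain_class (n.+1%:R^-1) `<=` connected_component Z x.
Proof.
move=> Zx cZ bZ; set K := \bigcap_n _.
have cC n : closed (chain_class n.+1%:R^-1) by exact: chain_class_closed.
have KZ : K `<=` Z by move=> y /(_ 0%N I); exact: chain_class_sub.
have Kx : K x by move=> n _; exact: chain_class_refl.
have cK : closed K by apply: closed_bigI.
have bK : bounded_set K.
  by have /boundedP[M MP] := bZ; apply/boundedP; exists M => y /KZ /MP.
suff : connected K by move=> kK; exact: connected_component_max.
apply: contrapT => /(disconnected_gap cK bK).
(* The two parts are interchangeable, so [x] may be taken in the first one. *)
suff H A0 A1 : A0 x -> A1 !=set0 -> closed A0 -> closed A1 -> K = A0 `|` A1 ->
    (exists2 d : R, 0 < d & forall z w, A0 z -> A1 w -> d <= cmod (w - z)) -> False.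
  move=> [A0 [A1 [A00 A10 cA0 cA1 [KA [d d0 dP]]]]].
  have : K x by []. rewrite KA => -[Ax|Ax].
    by apply: (H A0 A1) => //; exists d.
  apply: (H A1 A0) => //; first by rewrite KA setUC.
  by exists d => // z w Az Aw; rewrite cmodB; exact: dP.
move=> A0x [a1 A1a] cA0 cA1 KA [d d0 dP].
pose e : R := d / 3; have e0 : 0 < e by rewrite divr_gt0.
have de : d = e + e + e by rewrite /e; field.
have A00 : A0 !=set0 by exists x.
have A10 : A1 !=set0 by exists a1.
pose U A := [set z | cdist A z < e].
pose F n := chain_class n.+1%:R^-1 `&` ~` (U A0 `|` U A1).
have oU A : A !=set0 -> open (U A).
  move=> AN; apply/openP => z zA; exists (e - cdist A z); first by rewrite subr_gt0.
  by move=> w; rewrite /cball /U /= => wz; have := cdistD w z AN; lra.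
have step n : chain_class n.+2%:R^-1 `<=` chain_class n.+1%:R^-1.
  by apply: chain_class_le; rewrite lef_pV2 ?posrE // ler_nat.
have [n nF] : exists n, ~ (F n !=set0).
  apply: contrapT => HF.
  have [||||z zP] := @nested_closed R F.
  - move=> n; apply: closedI => //; apply: open_closedC.
    by apply: openU; exact: oU.
  - by move=> n; apply: contrapT => Fn; apply: HF; exists n.
  - by move=> n z [/step].
  - have /boundedP[M MP] := bZ; apply/boundedP; exists M => z [zC _].
    by apply: MP; exact: (chain_class_sub Zx zC).
  have : K z by move=> n _; case: (zP n).
  have [_ nz] := zP 0%N; rewrite KA => -[Az|Az]; apply: nz; [left|right].
    by rewrite /U /= cdist_mem.
  by rewrite /U /= cdist_mem.
pose m := maxn n (Num.truncn e^-1).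
have me : m.+1%:R^-1 <= e.
  rewrite -[e]invrK lef_pV2 ?posrE ?invr_gt0 //.
  apply: (le_trans (ltW (truncnS_gt _))); rewrite ler_nat ltnS.
  exact: leq_maxr.
have mn : chain_class m.+1%:R^-1 `<=` chain_class n.+1%:R^-1.
  by apply: chain_class_le; rewrite lef_pV2 ?posrE // ler_nat ltnS leq_maxl.
have : K a1 by rewrite KA; right.
move=> /(_ m I) Ka.
(* This set is closed under chain steps, so it contains [a1], which is too far from [A0]. *)
pose S := chain_class m.+1%:R^-1 `&` U A0.
have [|u v [Su u0] Zv uv|_] := Ka S.
- by split; [exact: chain_class_refl|rewrite /U /= cdist_mem].
- have Sv := chain_class_step Su Zv uv; split=> //.
  have [//|v1] : (U A0 `|` U A1) v.
    by apply: contrapT => nv; apply: nF; exists v; split=> //; exact: mn.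
  have [y Ay uy] := cdist_lt A00 u0; have [w Aw vw] := cdist_lt A10 v1.
  have := dP y w Ay Aw; have := cmodB_trans v w y; have := cmodB_trans u v y.
  have uv' := lt_le_trans uv me; move: uy uv' vw; rewrite (cmodB y u) de; lra.
rewrite /U /= => /(cdist_lt A00)[y Ay]; have := dP y a1 Ay A1a.
by rewrite (cmodB y) de; lra.
Qed.

End Chains.

(** Cutting [I] by a disc slightly larger than the component leaves a compact set [Z], in which the
    chain class [D] of [x] stays off the cutting circle once the steps are small. A thin
    neighbourhood of [D] has no point of [I] on its boundary: such a point would be one step away
    from [D], hence in [D]. *)
Lemma bounded_component_nbhs (I : set C) x : closed I -> I x ->
  bounded_set (connected_component I x) ->
  exists N : set C, [/\ open N, bounded_set N,
    connected_component I x `<=` N & boundary N `&` I = set0].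
Proof.
move=> cI Ix bE; have /boundedP[M MP] := bE.
pose r : R := `|M| + 1.
have Er y : connected_component I x y -> cmod y < r.
  by move=> /MP; rewrite /r; have := ler_norm M; lra.
pose Z := I `&` [set z | cmod z <= r].
have cZ : closed Z.
  apply: closedI => //; rewrite (_ : [set z : C | _] = (fun z : C => cmod z) @^-1` [set t | t <= r]) //.
  by apply: closed_comp => [z _|]; [exact: cmod_continuous|exact: closed_le].
have bZ : bounded_set Z by apply/boundedP; exists r => z [].
have Zx : Z x by split => //; apply/ltW/Er/connected_component_refl.
have cC n : closed (chain_class Z x n.+1%:R^-1).
  by apply: chain_class_closed Zx cZ _; rewrite invr_gt0.
have ZI : connected_component Z x `<=` connected_component I x.
  apply: connected_component_max; last exact: component_connected.
    exact: connected_component_refl.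
  by move=> y /connected_component_sub [].
pose F n := chain_class Z x n.+1%:R^-1 `&` [set z | r <= cmod z].
have [n nF] : exists n, ~ (F n !=set0).
  apply: contrapT => HF.
  have [||||z zP] := @nested_closed R F.
  - move=> n; apply: closedI; first exact: cC.
    rewrite (_ : [set z : C | _] = (fun z : C => cmod z) @^-1` [set t | r <= t]) //.
    by apply: closed_comp => [z _|]; [exact: cmod_continuous|exact: closed_ge].
  - by move=> n; apply: contrapT => Fn; apply: HF; exists n.
  - move=> n z [zn zr]; split=> //; apply: chain_class_le zn.
    by rewrite lef_pV2 ?posrE // ler_nat.
  - by apply/boundedP; exists r => z [/(chain_class_sub Zx) []].
  have [_ zr] := zP 0%N.
  have : (\bigcap_n chain_class Z x n.+1%:R^-1) z by move=> n _; case: (zP n).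
  by move=> /(chain_class_component Zx cZ bZ) /ZI /Er; rewrite ltNge zr.
set D := chain_class Z x n.+1%:R^-1.
have DZ : D `<=` Z by exact: chain_class_sub.
have bD : bounded_set D by apply/boundedP; exists r => z /DZ[].
have Dx : D x by exact: chain_class_refl.
have D0 : D !=set0 by exists x.
have [|p Dp pP] := @compact_max R D (fun z => cmod z) D0 (cC n) bD.
  move=> z _ e e0; exists e => // w _; apply: le_lt_trans.
  by rewrite ler_norml cmodB_ge andbT lerNl opprB cmodB cmodB_ge.
have pr : cmod p < r by rewrite ltNge; apply/negP => rp; apply: nF; exists p.
have dn0 : 0 < n.+1%:R^-1 :> R by rewrite invr_gt0.
(* A point of [I] on the boundary of the neighbourhood is within [e + e] of [D]. This is at most the
   chain step, so that the point is reached, and at most the room left up to the circle, so that it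
   belongs to [Z]. *)
pose e : R := Num.min n.+1%:R^-1 (r - cmod p) / 2.
have e0 : 0 < e by rewrite divr_gt0 // lt_min dn0 subr_gt0.
have [en er] : e + e <= n.+1%:R^-1 /\ e + e <= r - cmod p.
  by rewrite /e -splitr; split; rewrite ge_min lexx // orbT.
pose N := [set z | cdist D z < e].
have oN : open N.
  apply/openP => z zN; exists (e - cdist D z); first by rewrite subr_gt0.
  by move=> w; rewrite /cball /N /= => wz; have := cdistD w z D0; lra.
exists N; split=> //.
- apply/boundedP; exists (r + e) => z /(cdist_lt D0)[w /pP wp wz].
  by have := cmodB_ge z w; rewrite cmodB; lra.
- move=> y Ey; rewrite /N /=.
  have Zy : Z y by split; [exact: connected_component_sub Ey|exact/ltW/Er].
  suff Dy : D y by rewrite cdist_mem.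
  have EZ : connected_component I x `<=` Z.
    by move=> u Eu; split; [exact: connected_component_sub Eu|exact/ltW/Er].
  apply: (connected_clopen (component_connected (A:=I) (x:=x))) Ey.
  + by exists x; exact: connected_component_refl.
  + move=> u Eu Du; exists n.+1%:R^-1 => // v Ev; exact: chain_class_step Du (EZ v Ev).
  + move=> u Eu nDu; exists n.+1%:R^-1 => // v Ev uv Dv; apply: nDu.
    by apply: chain_class_step Dv (EZ u Eu) _; rewrite cmodB.
  + by exists x; split; [exact: connected_component_refl|].
- rewrite -subset0 => y [by_ Iy]; have [cy _] := by_; apply: (open_boundary oN by_).
  have /closureP/(_ e e0)[u uN uy] := cy.
  have [w Dw wu] := cdist_lt D0 uN.
  have yw : cmod (y - w) < n.+1%:R^-1.
    apply: lt_le_trans en; have := cmodB_trans u y w.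
    by move: uy wu; rewrite (cmodB u y) (cmodB w u); lra.
  have Dy : D y.
    apply: (chain_class_step Dw _ yw); split=> //=.
    have := cmodB_ge y w; have := pP w Dw; have := cmodB_trans u y w.
    by move: uy wu; rewrite (cmodB u y) (cmodB w u); lra.
  by rewrite /N /= cdist_mem.
Qed.

End PlaneSets.

(** * Connectedness of boundaries *)

Section Lifting.
Variable R : realType.
Local Notation C := R[i].
Implicit Types (z w : C).

Lemma int_small (n : int) : `|n%:~R| < 1 :> R -> n = 0.
Proof. by rewrite -intr_norm ltrz1; case: n => [[|n]|n]. Qed.

(* A function on a disc which is uniformly slowly varying modulo 1 has a slowly
   varying real lift: sum up the small representatives of its increments along
   the radius [0, z]. *)
Lemma lift_mod1 (v : C -> R) (L d : R) : 0 < L -> 0 < d ->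
  (forall z w, cmod z <= L -> cmod w <= L -> cmod (z - w) < d ->
    exists n : int, `|v z - v w - n%:~R| < 8^-1) ->
  exists k : C -> int, forall z w, cmod z <= L -> cmod w <= L ->
    cmod (z - w) < d -> `|(v z + (k z)%:~R) - (v w + (k w)%:~R)| < 8^-1.
Proof.
move=> L0 d0 vH.
have [n nP] : {n : C * C -> int & forall p, cmod p.1 <= L -> cmod p.2 <= L ->
    cmod (p.1 - p.2) < d -> `|v p.1 - v p.2 - (n p)%:~R| < 8^-1}.
  apply: (@choice _ _ (fun p m => cmod p.1 <= L -> cmod p.2 <= L ->
    cmod (p.1 - p.2) < d -> `|v p.1 - v p.2 - m%:~R| < 8^-1)) => -[z w] /=.
  have [[h1 [h2 h3]]|h] := pselect (cmod z <= L /\ cmod w <= L /\ cmod (z - w) < d).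
    by have [m mP] := vH z w h1 h2 h3; exists m.
  by exists 0 => h1 h2 h3; case: h.
pose N := (Num.truncn (L / d)).+1.
have N0 : 0 < N%:R :> R by rewrite ltr0n.
have LN : L / N%:R < d.
  by rewrite ltr_pdivrMr // mulrC -ltr_pdivrMr // truncnS_gt.
pose pt (j : nat) z : C := ((j%:R / N%:R)%:C)%C * z.
have ptL j z : (j <= N)%N -> cmod z <= L -> cmod (pt j z) <= L.
  move=> jN zL; rewrite cmodM cmod_real ger0_norm ?divr_ge0 ?ler0n //.
  apply: le_trans zL; rewrite -[X in _ <= X]mul1r ler_wpM2r ?cmod_ge0 //.
  by rewrite ler_pdivrMr // mul1r ler_nat.
have ptS j z : cmod z <= L -> cmod (pt j.+1 z - pt j z) < d.
  move=> zL; rewrite /pt -mulrBl -rmorphB -mulrBl -natrB // subSnn.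
  rewrite cmodM cmod_real ger0_norm ?divr_ge0 // mul1r mulrC.
  by apply: le_lt_trans LN; rewrite ler_wpM2r // invr_ge0 ltW.
have ptD j z w : (j <= N)%N -> cmod (z - w) < d -> cmod (pt j z - pt j w) < d.
  move=> jN zw; rewrite /pt -mulrBr cmodM cmod_real ger0_norm ?divr_ge0 ?ler0n //.
  apply: le_lt_trans zw; rewrite -[X in _ <= X]mul1r ler_wpM2r ?cmod_ge0 //.
  by rewrite ler_pdivrMr // mul1r ler_nat.
pose k z : nat -> int := fun j => - \sum_(i < j) n (pt i.+1 z, pt i z).
exists (fun z => k z N) => z w zL wL zw.
have pN u : pt N u = u by rewrite /pt divff ?gt_eqF // mul1r.
have p0 u : pt 0%N u = 0.
  by case: u => x y; rewrite /pt mul0r; apply/eqP; rewrite eq_complex /= !mul0r subr0 addr0 eqxx.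
suff H j : (j <= N)%N ->
    `|(v (pt j z) + (k z j)%:~R) - (v (pt j w) + (k w j)%:~R)| < 8^-1.
  by have := H N (leqnn N); rewrite !pN.
elim: j => [_|j IHj jN].
  rewrite !p0 /k !big_ord0 subrr normr0.
  by rewrite invr_gt0.
have jN' := ltnW jN; have {}IHj := IHj jN'.
have kS u : k u j.+1 = k u j - n (pt j.+1 u, pt j u).
  by rewrite /k big_ord_recr /= opprD.
have h1 := nP (pt j.+1 z, pt j z) (ptL _ _ jN zL) (ptL _ _ jN' zL) (ptS j _ zL).
have h2 := nP (pt j.+1 w, pt j w) (ptL _ _ jN wL) (ptL _ _ jN' wL) (ptS j _ wL).
have [m hm] := vH _ _ (ptL _ _ jN zL) (ptL _ _ jN wL) (ptD _ _ _ jN zw).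
move: IHj h1 h2 hm; rewrite !kS /= !rmorphB /=.
set a := v (pt j z); set b := v (pt j w); set a' := v (pt j.+1 z).
set b' := v (pt j.+1 w); set p := n (_, pt j z); set q := n (_, pt j w).
set kz := k z j; set kw := k w j => h0 h1 h2 h3.
(* This integer is a sum of four terms of modulus below 1/8, hence 0. *)
have E : kz - p - (kw - q) + m = 0.
  apply: int_small; rewrite rmorphD !rmorphB /=.
  by move: h0 h1 h2 h3; rewrite !ltr_norml => /andP[? ?] /andP[? ?] /andP[? ?] /andP[? ?]; apply/andP; split; lra.
have E' : kz%:~R - p%:~R - (kw%:~R - q%:~R) + m%:~R = 0 :> R.
  by rewrite -!rmorphB -rmorphD /= E.
rewrite (_ : _ - _ = a' - b' - m%:~R) //; lra.
Qed.

Lemma chain_constant (A : set C) (k : C -> int) (d : R) : connected A -> 0 < d ->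
  (forall z w, A z -> A w -> cmod (z - w) < d -> k z = k w) ->
  forall z w, A z -> A w -> k z = k w.
Proof.
move=> cA d0 kd z w Az; move: w.
suff : A `<=` [set w | k z = k w] by [].
apply: (connected_clopen cA); first by exists z.
- by move=> w Aw /= ->; exists d => // u Au uw; rewrite (kd w u) // cmodB.
- move=> w Aw /= zw; exists d => // u Au uw zu; apply: zw.
  by rewrite zu; exact: kd.
- by exists z.
Qed.

(* Suppose the boundary is the union of two far apart closed sets [F0] and [F1],
   and [phi] is a Lipschitz function equal to 0 on [F0] and to 1 on [F1].  The
   function equal to [phi / 2] on [T] and to [- phi / 2] off [T] is slowly varying
   modulo 1, and its real lift differs by an integer constant from [phi / 2] on [T]
   and from [- phi / 2] off [T]; these are incompatible. *)
Lemma boundary_connected (T : set C) : open T -> bounded_set T -> connected T ->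
  connected (~` T) -> connected (boundary T).
Proof.
move=> oT bT cT cQ; apply: contrapT.
move=> /(disconnected_gap (@closed_boundary _ T) (bounded_boundary bT)).
move=> [F0 [F1 [F00 F10 cF0 cF1 [bF [d0 d00 dP]]]]].
pose phi z : R := Num.min 1 (cdist F0 z / d0).
have phi_lip z w : `|phi z - phi w| <= cmod (z - w) / d0.
  have h : `|cdist F0 z / d0 - cdist F0 w / d0| <= cmod (z - w) / d0.
    rewrite -mulrBl normrM normfV (gtr0_norm d00) ler_pM2r ?invr_gt0 //.
    exact: cdist_lip.
  move: h; rewrite /phi !ler_norml => /andP[h1 h2].
  by case: (leP 1 (cdist F0 z / d0)) => ?; case: (leP 1 (cdist F0 w / d0)) => ?; apply/andP; split; lra.
have phi_ge0 z : 0 <= phi z by rewrite le_min ler01 divr_ge0 ?cdist_ge0 // ltW.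
have phi_le1 z : phi z <= 1 by rewrite ge_min lexx.
have phi0 z : F0 z -> phi z = 0.
  by move=> Fz; rewrite /phi cdist_mem // mul0r; case: leP => //; rewrite ler10.
have phi1 z : F1 z -> phi z = 1.
  move=> Fz; rewrite /phi; case: leP => //; rewrite ltr_pdivrMr // mul1r.
  move=> /(cdist_lt F00)[w Fw]; have := dP w z Fw Fz.
  by rewrite cmodB leNgt => /negP.
have phi_bd z : boundary T z -> phi z = 0 \/ phi z = 1.
  by rewrite bF => -[/phi0|/phi1]; [left|right].
pose v z : R := if `[< T z >] then phi z / 2 else - (phi z / 2).
have vT z : T z -> v z = phi z / 2 by move=> Tz; rewrite /v asboolT.
have vQ z : ~ T z -> v z = - (phi z / 2) by move=> Tz; rewrite /v asboolF.
pose d : R := d0 / 16; have d_gt0 : 0 < d by rewrite divr_gt0.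
have phid z w : cmod (z - w) < d -> `|phi z - phi w| < 16^-1.
  move=> zw; apply: le_lt_trans (phi_lip z w) _.
  by rewrite ltr_pdivrMr // mulrC.
have /boundedP[M MP] := bT.
pose r : R := `|M| + 1; pose L : R := r + 1.
have r0 : 0 < r by rewrite ltr_wpDl.
have rL : r < L by rewrite ltrDl.
have L0 : 0 < L := lt_trans r0 rL.
have Tr z : T z -> cmod z < r.
  by move=> /MP; have := ler_norm M; rewrite /r; lra.
(* The segment from [z] to [w] meets the boundary at a point where [phi] is 0 or 1, so the jump of
   [v] is close to an integer. This is where the decomposition of the boundary into [F0] and [F1]
   enters. *)
have cross z w : T z -> ~ T w -> cmod (z - w) < d ->
    exists n : int, `|phi z / 2 + phi w / 2 - n%:~R| < 8^-1.
  move=> Tz nTw zw.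
  have [||y [yzw by_]] := @connected_boundary R (cseg z w) T (@cseg_connected R z w).
  - by exists z; split=> //; exact: cseg_l.
  - by exists w; split=> //; exact: cseg_r.
  have yz : cmod (y - z) < d.
    by apply: le_lt_trans (cseg_cmod yzw) _; rewrite cmodB.
  have yw : cmod (y - w) < d.
    move: yzw => [t /=]; rewrite in_itv /= => /andP[t0 t1] <-.
    have -> : z + (t%:C)%C * (w - z) - w = ((1 - t)%:C)%C * (z - w).
      by rewrite rmorphB rmorph1; ring.
    rewrite cmodM cmod_real ger0_norm ?subr_ge0 //; apply: le_lt_trans zw.
    by rewrite -[X in _ <= X]mul1r ler_wpM2r ?cmod_ge0 // lerBlDr lerDl.
  have := phid _ _ yz; have := phid _ _ yw; rewrite !ltr_norml.
  move=> /andP[h1 h2] /andP[h3 h4].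
  by case: (phi_bd y by_) => yE; rewrite yE in h1 h2 h3 h4; [exists 0|exists 1];
    rewrite ltr_norml; apply/andP; split; lra.
have [|k kP] := @lift_mod1 v L d L0 d_gt0.
  move=> z w _ _ zw; have := phid _ _ zw; rewrite ltr_norml => /andP[h1 h2].
  have [Tz|Tz] := pselect (T z); have [Tw|Tw] := pselect (T w).
  - by exists 0; rewrite (vT z) // (vT w) // ltr_norml; apply/andP; split; lra.
  - by have [n nP] := cross z w Tz Tw zw; exists n; rewrite vT // vQ // opprK.
  - have [n nP] := cross w z Tw Tz (eq_ind _ (fun x => x < d) zw _ (cmodB z w)).
    exists (- n); rewrite vQ // vT // -normrN rmorphN /=.
    have -> : - (- (phi z / 2) - phi w / 2 - - n%:~R) =
      phi w / 2 + phi z / 2 - n%:~R by ring.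
    exact: nP.
  - by exists 0; rewrite (vQ z) // (vQ w) // ltr_norml; apply/andP; split; lra.
have kT z w : T z -> T w -> k z = k w.
  apply: (chain_constant cT d_gt0) => {}z {}w Tz Tw zw.
  have := kP z w (ltW (lt_trans (Tr z Tz) rL)) (ltW (lt_trans (Tr w Tw) rL)) zw.
  have := phid _ _ zw; rewrite vT // vT // !ltr_norml => /andP[? ?] /andP[? ?].
  apply/eqP; rewrite -subr_eq0; apply/eqP/int_small.
  by rewrite rmorphB /= ltr_norml; apply/andP; split; lra.
have kQ' z w : ~ T z -> ~ T w -> cmod z <= L -> cmod w <= L -> cmod (z - w) < d ->
    k z = k w.
  move=> Tz Tw zL wL zw; have := kP z w zL wL zw.
  have := phid _ _ zw; rewrite vQ // vQ // !ltr_norml => /andP[? ?] /andP[? ?].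
  apply/eqP; rewrite -subr_eq0; apply/eqP/int_small.
  by rewrite rmorphB /= ltr_norml; apply/andP; split; lra.
(* The lift is controlled only in the disc of radius [L], which may cut the complement of [T] into
   pieces; this annulus off [T] links them. *)
pose ring := [set z : C | r <= cmod (z - 0) <= L].
have cring : connected ring.
  apply: (@ring_connected R 0 r [set s | r <= s <= L]) => // s.
    by move=> /andP[].
  by move=> u /= /andP[_ sL] /andP[ru us]; rewrite ru (le_trans us).
have ringQ z : r <= cmod z -> ~ T z.
  by move=> rz /Tr; rewrite ltNge rz.
have kring : forall z w, ring z -> ring w -> k z = k w.
  apply: (chain_constant cring d_gt0) => z w; rewrite /ring /= !subr0.
  by move=> /andP[z1 z2] /andP[w1 w2] zw; apply: kQ' => //; exact: ringQ.
pose z0 : C := (r%:C)%C.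
have z0r : cmod z0 = r by rewrite cmod_real gtr0_norm.
have rz0 : ring z0 by rewrite /ring /mkset subr0 z0r lexx ltW.
(* All points of modulus at least [r] are counted as good, so that the connectedness of the whole
   complement can be used although [k] is controlled only in a disc. *)
have kQ z : ~ T z -> cmod z < r -> k z = k z0.
  move=> Tz zr; suff H : ~` T `<=` [set z | r <= cmod z \/ k z = k z0].
    by case: (H z Tz) => //; rewrite leNgt zr.
  apply: (connected_clopen cQ).
  - by exists z.
  - move=> w Tw Bw; have [Lw|wL] := leP L (cmod w).
      exists (L - r); first by rewrite subr_gt0.
      move=> u _ uw; left; have := cmodB_ge w u; rewrite (cmodB w u); lra.
    have kw : k w = k z0.
      case: Bw => // rw; apply: kring => //.
      by rewrite /ring /mkset subr0 rw ltW.
    exists (Num.min d (L - cmod w)); first by rewrite lt_min d_gt0 subr_gt0.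
    move=> u Tu; rewrite lt_min => /andP[uw uL]; right; rewrite -kw.
    apply: kQ' => //; last exact: ltW.
    by have := cmodB_ge u w; lra.
  - move=> w Tw /not_orP[/negP wr kw]; rewrite -ltNge in wr.
    exists (Num.min d (r - cmod w)); first by rewrite lt_min d_gt0 subr_gt0.
    move=> u Tu; rewrite lt_min => /andP[uw uL].
    have ur : cmod u < r by have := cmodB_ge u w; lra.
    move=> [|ku]; first by rewrite leNgt ur.
    by apply: kw; rewrite -ku; apply: kQ' => //; rewrite ?(cmodB w u) // ltW //; lra.
  - by exists z0; split; [apply: ringQ; rewrite z0r|left; rewrite z0r].
have near x : boundary T x -> exists2 z, T z & cmod (z - x) < d.
  by move=> [/closureP/(_ d d_gt0)[z Tz zx] _]; exists z.
have bdk x : boundary T x -> cmod x < r \/ ring x.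
  move=> [cx _]; have [//|rx] := ltP (cmod x) r; [by left|right].
  rewrite /ring /mkset subr0 rx /=; have /closureP/(_ 1 ltr01)[z /Tr zr zx] := cx.
  by have := cmodB_ge x z; rewrite (cmodB x z) /L; lra.
have kbd x : boundary T x -> k x = k z0.
  move=> bx; case: (bdk x bx) => [xr|rx]; last exact: kring.
  by apply: kQ => //; exact: (open_boundary oT bx).
have cmp x z : boundary T x -> T z -> cmod (z - x) < d ->
    `|phi z / 2 + (k z)%:~R - (- (phi x / 2) + (k z0)%:~R)| < 8^-1.
  move=> bx Tz zx; rewrite -(kbd x bx) -vT // -vQ; last exact: (open_boundary oT bx).
  apply: kP => //; first by rewrite ltW // (lt_trans (Tr z Tz)).
  case: (bdk x bx) => [xr|]; first by rewrite ltW // (lt_trans xr).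
  by rewrite /ring /mkset subr0 => /andP[].
(* Near a point of [F0] the constants on the two sides must agree; near a point of [F1] they must
   differ by 1. *)
have [x0 Fx0] := F00; have [x1 Fx1] := F10.
have bx0 : boundary T x0 by rewrite bF; left.
have bx1 : boundary T x1 by rewrite bF; right.
have [y0 Ty0 yx0] := near x0 bx0; have [y1 Ty1 yx1] := near x1 bx1.
have := cmp _ _ bx0 Ty0 yx0; have := cmp _ _ bx1 Ty1 yx1.
have := phid _ _ yx0; have := phid _ _ yx1; rewrite (phi0 _ Fx0) (phi1 _ Fx1) (kT y1 y0 Ty1 Ty0).
set a : R := (k y0)%:~R; set b : R := (k z0)%:~R; rewrite !ltr_norml.
move=> /andP[? ?] /andP[? ?] /andP[? ?] /andP[? ?].
have k01 : k y0 - k z0 = 0.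
  by apply: int_small; rewrite rmorphB /= -/a -/b ltr_norml; apply/andP; split; lra.
have ab : a = b by rewrite /a /b; congr (_%:~R); apply/eqP; rewrite -subr_eq0 k01.
by move: ab; lra.
Qed.

End Lifting.

(** * Contraction of closed lattice walks *)

Section Walks.

Definition vtx : Type := int * int.
Implicit Types (u v a b p q c : vtx) (s : nat -> vtx) (i j k m n : nat).
Local Open Scope int_scope.
Local Open Scope ring_scope.

(** Equal vertices are adjacent: walks may pause, so that they keep their length [M] while they are
    contracted. *)
Definition adj u v := `|u.1 - v.1| + `|u.2 - v.2| <= 1.

Definition corner c u :=
  ((u.1 == c.1) || (u.1 == c.1 + 1)) && ((u.2 == c.2) || (u.2 == c.2 + 1)).

Definition setr s k1 k3 a : nat -> vtx :=
  fun k => if (k1 <= k < k3)%N then a else s k.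

(** The walk pauses at [s i] on the closed index range from [i] to [j], whereas [setr] uses a
    half-open range. *)
Definition flat i j s := setr s i j.+1 (s i).

Definition nsteps s i j := (\sum_(i <= k < j) (s k != s k.+1 :> vtx))%N.

(* Signed crossing of the upward vertical ray from the square with lower left
   corner [c] by the step from [u] to [v]. *)
Definition cross u v c : int :=
  if (u.2 == v.2) && (c.2 < u.2) then
    if (u.1 == c.1) && (v.1 == c.1 + 1) then 1
    else if (u.1 == c.1 + 1) && (v.1 == c.1) then -1 else 0
  else 0.

(** For a closed walk, this is up to sign the winding number around the centre of the square. *)
Definition wind s i j c := \sum_(i <= k < j) cross (s k) (s k.+1) c.

Lemma eq_vtx u v : u.1 = v.1 -> u.2 = v.2 -> u = v.
Proof. by case: u v => [x y] [x' y'] /= -> ->. Qed.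

Lemma nsteps_cat s i j k : (i <= j)%N -> (j <= k)%N ->
  nsteps s i k = (nsteps s i j + nsteps s j k)%N.
Proof. by move=> ij jk; rewrite /nsteps (@big_cat_nat _ _ _ j i k). Qed.

Lemma nsteps_eq0 s i j : nsteps s i j = 0%N ->
  forall k, (i <= k <= j)%N -> s k = s i.
Proof.
move=> n0 k /andP[ik kj]; move: kj; rewrite -(subnKC ik).
elim: (k - i)%N => [|m IH] mj; first by rewrite addn0.
rewrite -IH; last by lia.
apply/esym/eqP; have: (nsteps s i j == 0)%N by rewrite n0.
rewrite /nsteps sum_nat_seq_eq0 => /allP/(_ (i + m)%N).
rewrite mem_index_iota addnS => H.
have im : (i <= i + m < j)%N by lia.
by have := H im; rewrite /= eqb0 negbK.
Qed.

Lemma nsteps_const s i j a : (forall k, (i <= k <= j)%N -> s k = a) ->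
  nsteps s i j = 0%N.
Proof.
move=> sa; apply/eqP; rewrite /nsteps sum_nat_seq_eq0; apply/allP => k.
rewrite mem_index_iota => /andP[ik kj] /=.
by rewrite !sa ?eqxx //; lia.
Qed.

Lemma eq_nsteps s s' i j : (forall k, (i <= k <= j)%N -> s k = s' k) ->
  nsteps s i j = nsteps s' i j.
Proof.
move=> ss; rewrite /nsteps !big_nat; apply: eq_bigr => k /andP[ik kj].
by rewrite !ss //; lia.
Qed.

Lemma cross_right x y c :
  cross (x, y) (x + 1, y) c = ((x == c.1) && (c.2 < y) : nat).
Proof. by rewrite /cross /=; do !case: ifP => //; lia. Qed.

Lemma cross_left x y c :
  cross (x + 1, y) (x, y) c = - ((x == c.1) && (c.2 < y) : nat)%:Z.
Proof. by rewrite /cross /=; do !case: ifP => //; lia. Qed.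

Lemma cross_vert x y y' c : cross (x, y) (x, y') c = 0.
Proof. by rewrite /cross /=; do !case: ifP => //; lia. Qed.

Lemma adj_cases u v : adj u v ->
  [\/ v = (u.1 + 1, u.2), u = (v.1 + 1, v.2), v = (u.1, u.2 + 1) |
    u = (v.1, v.2 + 1)] \/ u = v.
Proof.
case: u v => [x y] [x' y']; rewrite /adj /= => h.
have [ex|ex] := eqVneq x x'; last first.
  have ey : y = y' by lia.
  have [e|e] : x' = x + 1 \/ x = x' + 1 by lia.
    by left; constructor 1; rewrite e ey.
  by left; constructor 2; rewrite e ey.
rewrite ex in h *; have [e|[e|e]] : y' = y + 1 \/ y = y' + 1 \/ y = y' by lia.
- by left; constructor 3; rewrite e.
- by left; constructor 4; rewrite e.
- by right; rewrite e.
Qed.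

(** Counts for two squares that differ by a coboundary have the same sum along a closed walk. *)
Lemma cross_telescope s i j c c' (phi : vtx -> int) : (i <= j)%N -> s i = s j ->
  (forall k, (i <= k < j)%N ->
    cross (s k) (s k.+1) c - cross (s k) (s k.+1) c' = phi (s k.+1) - phi (s k)) ->
  wind s i j c = wind s i j c'.
Proof.
move=> ij sij H; apply/eqP; rewrite -subr_eq0 /wind -sumrB.
by rewrite big_nat (eq_bigr _ H) -big_nat telescope_sumr // sij subrr.
Qed.

(** The ray from the upper square misses only the common edge, which the walk does not use. *)
Lemma wind_above s i j c :
  (forall k, (i <= k < j)%N ->
    ~ (s k = (c.1, c.2 + 1) /\ s k.+1 = (c.1 + 1, c.2 + 1)) /\
    ~ (s k.+1 = (c.1, c.2 + 1) /\ s k = (c.1 + 1, c.2 + 1))) ->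
  wind s i j c = wind s i j (c.1, c.2 + 1).
Proof.
move=> H; rewrite /wind !big_nat; apply: eq_bigr => k kij.
have [h1 h2] := H k kij.
have g1 : ~ ((s k).1 = c.1 /\ (s k).2 = c.2 + 1 /\ (s k.+1).1 = c.1 + 1 /\ (s k.+1).2 = c.2 + 1).
  by move=> [? [? [? ?]]]; apply: h1; split; exact: eq_vtx.
have g2 : ~ ((s k.+1).1 = c.1 /\ (s k.+1).2 = c.2 + 1 /\ (s k).1 = c.1 + 1 /\ (s k).2 = c.2 + 1).
  by move=> [? [? [? ?]]]; apply: h2; split; exact: eq_vtx.
by move: g1 g2; clear; rewrite /cross /=; do !case: ifP => //; lia.
Qed.

(** [phi] marks the vertices between the two rays. Apart from steps along the common edge of the
    squares, entering or leaving this half-line means crossing one of the rays. *)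
Lemma wind_right s i j c : (i <= j)%N -> s i = s j ->
  (forall k, (i <= k < j)%N -> adj (s k) (s k.+1)) ->
  (forall k, (i <= k < j)%N ->
    ~ (s k = (c.1 + 1, c.2) /\ s k.+1 = (c.1 + 1, c.2 + 1)) /\
    ~ (s k.+1 = (c.1 + 1, c.2) /\ s k = (c.1 + 1, c.2 + 1))) ->
  wind s i j c = wind s i j (c.1 + 1, c.2).
Proof.
move=> ij sij sadj H; pose phi u : int := ((u.1 == c.1 + 1) && (c.2 < u.2) : nat).
apply: (cross_telescope (phi := phi)) => // k kij.
have [h1 h2] := H k kij; have := adj_cases (sadj k kij).
move: h1 h2; case: (s k) (s k.+1) => [x y] [x' y']; rewrite /phi /= => h1 h2 cases.
move: cases h1 h2 => [[]|] [-> ->] h1 h2.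
- by rewrite !cross_right /=; lia.
- by rewrite !cross_left /=; lia.
- rewrite !cross_vert /=.
  have g : ~ (x = c.1 + 1 /\ y = c.2) by move=> [ex ey]; apply: h1; rewrite ex ey.
  by move: g; clear; lia.
- rewrite !cross_vert /=.
  have g : ~ (x' = c.1 + 1 /\ y' = c.2) by move=> [ex ey]; apply: h2; rewrite ex ey.
  by move: g; clear; lia.
- by rewrite !cross_vert !subrr.
Qed.

(** When the walk stays above the square, every passage between the two columns counts and the
    crossings telescope; in the other three positions no step meets the ray. *)
Lemma wind_far s i j c : (i <= j)%N -> s i = s j ->
  (forall k, (i <= k < j)%N -> adj (s k) (s k.+1)) ->
  [\/ forall k, (i <= k <= j)%N -> (s k).2 <= c.2,
      forall k, (i <= k <= j)%N -> c.2 < (s k).2,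
      forall k, (i <= k <= j)%N -> (s k).1 <= c.1 |
      forall k, (i <= k <= j)%N -> c.1 < (s k).1] -> wind s i j c = 0.
Proof.
move=> ij sij sadj.
have z : (forall k, (i <= k < j)%N -> cross (s k) (s k.+1) c = 0) ->
    wind s i j c = 0 by move=> H; rewrite /wind big_nat big1.
case=> H.
- apply: z => // k kij; have := H k; have := H k.+1; rewrite /cross => h1 h2.
  by case: ifP => // g; lia.
- pose psi k : int := ((c.1 < (s k).1)%R : nat).
  apply/eqP; rewrite /wind big_nat (eq_bigr (fun k => psi k.+1 - psi k)).
    by rewrite -big_nat (telescope_sumr psi) // /psi sij subrr.
  move=> k kij; have h1 : c.2 < (s k).2 by apply: H; lia.
  have h2 : c.2 < (s k.+1).2 by apply: H; lia.
  rewrite /psi; have := adj_cases (sadj k kij); move: h1 h2; case: (s k) (s k.+1) => [x y] [x' y'] /= h1 h2 cases.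
  move: cases h1 h2 => [[]|] [-> ->] h1 h2.
  + by rewrite cross_right; move: h1; clear; lia.
  + by rewrite cross_left; move: h2; clear; lia.
  + by rewrite cross_vert; clear; lia.
  + by rewrite cross_vert; clear; lia.
  + by rewrite cross_vert; clear; lia.
- apply: z => // k kij; have h1 : (s k).1 <= c.1 by apply: H; lia.
  have h2 : (s k.+1).1 <= c.1 by apply: H; lia.
  by rewrite /cross; do !case: ifP => //; lia.
- apply: z => // k kij; have h1 : c.1 < (s k).1 by apply: H; lia.
  have h2 : c.1 < (s k.+1).1 by apply: H; lia.
  by rewrite /cross; do !case: ifP => //; lia.
Qed.

Lemma setr_out s k1 k3 a k : (k < k1)%N || (k3 <= k)%N -> setr s k1 k3 a k = s k.
Proof. by rewrite /setr; case: ifP => //; lia. Qed.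

Lemma setr_prev s k1 k3 : (0 < k1)%N -> (k1 <= k3)%N ->
  setr s k1 k3 (s k1.-1) k3.-1 = s k1.-1.
Proof.
by rewrite /setr; case: ifP => // kk k10 k13; have -> : k3.-1 = k1.-1 by lia.
Qed.

Lemma setr_run s k1 k3 a q k : (k1 <= k3)%N ->
  setr (setr s k1 k3 a) k3 k3.+1 q k =
  if k == k3 then q else if (k1 <= k < k3)%N then a else s k.
Proof. by rewrite /setr => k13; do !case: ifP => //; lia. Qed.

Lemma setr_id s k a : setr s k k a = s.
Proof. by apply/funext => l; rewrite setr_out //; lia. Qed.

Lemma nsteps_gt0 s i j k k' : (i <= k <= j)%N -> (i <= k' <= j)%N -> s k != s k' ->
  (0 < nsteps s i j)%N.
Proof.
move=> ki k'i kk; rewrite lt0n; apply/negP => /eqP n0; move/eqP: kk; apply.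
by rewrite (nsteps_eq0 n0 ki) (nsteps_eq0 n0 k'i).
Qed.

(** The two moving steps through the corner vertex are replaced by at most two through [q]. *)
Lemma nsteps_push s i j k1 k3 q : (i < k1)%N -> (k1 <= k3)%N -> (k3 < j)%N ->
  s k1.-1 != s k3 -> s k3.+1 != s k3 ->
  (nsteps (setr (setr s k1 k3 (s k1.-1)) k3 k3.+1 q) i j <= nsteps s i j)%N.
Proof.
move=> ik1 k13 k3j av bv; set s2 := setr _ _ _ _.
have s2E k : s2 k = if k == k3 then q else if (k1 <= k < k3)%N then s k1.-1 else s k.
  exact: setr_run.
have q1 : (0 < nsteps s k1.-1 k3)%N.
  by apply: (@nsteps_gt0 s _ _ k1.-1 k3); [lia|lia|].
have q3 : (0 < nsteps s k3 k3.+1)%N.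
  by apply: (@nsteps_gt0 s _ _ k3.+1 k3); [lia|lia|].
have c1 : (i <= k1.-1)%N by lia.
have c2 : (k1.-1 <= k3)%N by lia.
have split3 s' : nsteps s' i j = (nsteps s' i k1.-1 + nsteps s' k1.-1 k3
    + nsteps s' k3 k3.+1 + nsteps s' k3.+1 j)%N.
  rewrite -(nsteps_cat s' c1 c2) -(nsteps_cat s' (leq_trans c1 c2) (leqnSn _)).
  by rewrite -nsteps_cat //; lia.
rewrite !split3.
rewrite (@eq_nsteps s2 s i k1.-1); last first.
  by move=> k kk; rewrite s2E; do !case: ifP => //; lia.
rewrite (@eq_nsteps s2 s k3.+1 j); last first.
  by move=> k kk; rewrite s2E; do !case: ifP => //; lia.
rewrite (@nsteps_cat s2 k1.-1 k3.-1 k3); [|lia|lia].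
rewrite (@nsteps_const s2 k1.-1 k3.-1 (s k1.-1)); last first.
  move=> k kk; rewrite s2E; case: eqP => [e|_]; first by lia.
  by case: ifP => // kk'; have -> : k = k1.-1 by lia.
have one s' k : (nsteps s' k k.+1 <= 1)%N.
  by rewrite /nsteps big_nat1; case: (_ != _).
have := one s2 k3; have := one s2 k3.-1; rewrite prednK; last by lia.
lia.
Qed.

(** Termination measure for pushes: [B] is a row below the walk, and each push lowers a vertex. *)
Definition height (B : int) s i j := (\sum_(i <= k < j) `|((s k).2 - B)%R|)%N.

Lemma leq_dist (B x y : int) : B <= x -> x <= y -> (`|(x - B)%R| <= `|(y - B)%R|)%N.
Proof. lia. Qed.

Lemma ltn_dist (B x y : int) : B <= x -> x < y -> (`|(x - B)%R| < `|(y - B)%R|)%N.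
Proof. lia. Qed.

Lemma height_lt B s s' i j l : (i <= l < j)%N ->
  (forall k, (i <= k < j)%N -> (`|((s' k).2 - B)%R| <= `|((s k).2 - B)%R|)%N) ->
  (`|((s' l).2 - B)%R| < `|((s l).2 - B)%R|)%N ->
  (height B s' i j < height B s i j)%N.
Proof.
move=> /andP[il lj] le lt; rewrite /height.
rewrite (@big_cat_nat _ _ _ l i j) /=; [|lia|lia].
rewrite [X in (_ < X)%N](@big_cat_nat _ _ _ l i j) /=; [|lia|lia].
rewrite (big_ltn lj) [X in (_ < _ + X)%N](big_ltn lj).
have l1 : (\sum_(i <= k < l) `|((s' k).2 - B)%R| <=
    \sum_(i <= k < l) `|((s k).2 - B)%R|)%N.
  by rewrite !big_nat; apply: leq_sum => k kk; apply: le; lia.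
have l2 : (\sum_(l.+1 <= k < j) `|((s' k).2 - B)%R| <=
    \sum_(l.+1 <= k < j) `|((s k).2 - B)%R|)%N.
  by rewrite !big_nat; apply: leq_sum => k kk; apply: le; lia.
lia.
Qed.

(** [E] and [Q] stand for the edges and squares contained in a domain. The topology of the domain
    enters through [Q_wind], which makes every square with nonzero winding number available for a
    push. *)
Variables (M : nat) (E : vtx -> vtx -> Prop) (Q : vtx -> Prop).
Hypothesis E_adj : forall u v, E u v -> adj u v.
Hypothesis E_sym : forall u v, E u v -> E v u.
Hypothesis E_refl : forall u v, E u v -> E u u.
Hypothesis Q_E : forall c u v, Q c -> corner c u -> corner c v -> adj u v -> E u v.

Definition walk s := forall k, (k < M)%N -> E (s k) (s k.+1).

Hypothesis Q_wind : forall s i j c, walk s -> (i <= j)%N -> (j <= M)%N ->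
  s i = s j -> wind s i j c <> 0 -> Q c.

(** An edge or a square is a convex piece of the domain, so a straight-line homotopy can perform the
    move of these four vertices. *)
Definition in_cell u1 u2 u3 u4 :=
  (exists p q, E p q /\ [/\ u1 = p \/ u1 = q, u2 = p \/ u2 = q,
     u3 = p \/ u3 = q & u4 = p \/ u4 = q]) \/
  (exists2 c, Q c & [&& corner c u1, corner c u2, corner c u3 & corner c u4]).

Variable N : (nat -> vtx) -> Prop.
(** The implication runs from the walk after the move back to the walk before it, as null-homotopy
    is to be pulled back from the contracted walk. *)
Hypothesis N_move : forall s k v, walk s -> (0 < k < M)%N ->
  E (s k.-1) v -> E v (s k.+1) -> in_cell (s k.-1) (s k) v (s k.+1) ->
  N (setr s k k.+1 v) -> N s.

Lemma walk_setr s k1 k3 a : walk s -> (k1 < k3)%N -> E a a ->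
  ((0 < k1)%N -> E (s k1.-1) a) -> ((k3 <= M)%N -> E a (s k3)) ->
  walk (setr s k1 k3 a).
Proof.
move=> ws k13 aa ha hb k kM; rewrite /setr.
case: ifP => h1; case: ifP => h2 //.
- have e : k.+1 = k3 by lia.
  rewrite e; apply: hb; lia.
- have e : k = k1.-1 by lia.
  rewrite e; apply: ha; lia.
- exact: ws.
Qed.

Lemma walk_run s k1 k3 : walk s -> (0 < k1)%N -> (k1 <= k3)%N ->
  E (s k1.-1) (s k1.-1) -> ((k3 <= M)%N -> E (s k1.-1) (s k3)) ->
  walk (setr s k1 k3 (s k1.-1)).
Proof.
move=> ws k10; rewrite leq_eqVlt => /orP[/eqP -> _ _|k13 aa ab].
  by rewrite setr_id.
exact: walk_setr.
Qed.

(** The pause at [v] is transferred to the preceding vertex one index at a time; each of these moves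
    stays within the edge joining the two vertices. *)
Lemma run_move s k1 k3 v : walk s -> (0 < k1)%N -> (k1 <= k3 <= M)%N ->
  (forall k, (k1 <= k < k3)%N -> s k = v) -> E (s k1.-1) v ->
  s k3 = v \/ s k3 = s k1.-1 ->
  N (setr s k1 k3 (s k1.-1)) -> N s.
Proof.
set a := s k1.-1 => ws k10 /andP[k13 k3M] sv Eav sk3.
suff H m : (m <= k3)%N -> N (setr s k1 m a) -> N s by exact: H.
elim: m => [|m IHm] mk.
  suff -> : setr s k1 0 a = s by [].
  by apply/funext => k; rewrite /setr; case: ifP => // h; lia.
have [mk1|mk1] := leqP k1 m; last first.
  suff -> : setr s k1 m.+1 a = s by [].
  by apply/funext => k; rewrite /setr; case: ifP => // h; lia.
move=> Nm; apply: IHm; first by lia.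
have Evv : E v v := E_refl (E_sym Eav).
have Eaa : E a a := E_refl Eav.
have sm : s m = v by apply: sv; lia.
have ws' : walk (setr s k1 m a).
  have [km1|km1] := ltnP k1 m; first by apply: walk_setr; rewrite // sm.
  suff -> : setr s k1 m a = s by [].
  by apply/funext => k; rewrite /setr; case: ifP => // h; lia.
have prev : setr s k1 m a m.-1 = a.
  rewrite /setr; case: ifP => // h; have -> : m = k1 by lia.
  by [].
have next : setr s k1 m a m.+1 = v \/ setr s k1 m a m.+1 = a.
  rewrite /setr; case: ifP => // h; first by right.
  have [mk3|mk3] := ltnP m.+1 k3; first by left; apply: sv; lia.
  by have -> : m.+1 = k3 by lia.
have cur : setr s k1 m a m = v by rewrite /setr; case: ifP => // h; lia.
apply: (@N_move _ m a) => //; first by lia.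
- by rewrite prev.
- by case: next => ->.
- left; exists a, v; split=> //; rewrite prev cur; split; [by left|by right|by left|].
  by case: next => ->; [right|left].
suff -> : setr (setr s k1 m a) m m.+1 a = setr s k1 m.+1 a by [].
by apply/funext => k; rewrite /setr; do !case: ifP => //; lia.
Qed.

Lemma corner_square v (sg : int) : (sg == 1) || (sg == -1) ->
  let c := (if sg == 1 then v.1 else v.1 - 1, v.2 - 1) in
  [/\ corner c (v.1 + sg, v.2), corner c v, corner c (v.1 + sg, v.2 - 1) &
   corner c (v.1, v.2 - 1)].
Proof. by case/orP => /eqP -> /=; rewrite /corner /=; split; lia. Qed.

Lemma adj_square v (sg : int) : (sg == 1) || (sg == -1) ->
  let q := (v.1 + sg, v.2 - 1) in
  [/\ adj (v.1 + sg, v.2) q, adj q (v.1 + sg, v.2), adj (v.1, v.2 - 1) q &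
   adj q (v.1, v.2 - 1)].
Proof. by case/orP => /eqP -> /=; rewrite /adj /=; split; lia. Qed.

(** The only edge of the walk above the square inside the corner can be the one from the extreme
    vertex [s k1] to its neighbour [r]. It is used exactly once, since the walk visits [s k1] in a
    single run and turns there. *)
Lemma wind_corner (sg : int) s i j k1 k2 : (sg == 1) || (sg == -1) ->
  (i < k1)%N -> (k1 <= k2)%N -> (k2 < j)%N -> (j <= M)%N -> walk s ->
  (forall k, (i <= k <= j)%N -> (s k == s k1) = (k1 <= k <= k2)%N) ->
  (forall k, (i <= k <= j)%N -> (s k).2 <= (s k1).2 /\
     ((s k).2 = (s k1).2 -> sg * (s k1).1 <= sg * (s k).1)) ->
  s k1.-1 != s k2.+1 ->
  let r := ((s k1).1 + sg, (s k1).2) in let d := ((s k1).1, (s k1).2 - 1) in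
  let c := (if sg == 1 then (s k1).1 else (s k1).1 - 1, (s k1).2 - 1) in
  [/\ (s k1.-1 = r /\ s k2.+1 = d) \/ (s k1.-1 = d /\ s k2.+1 = r) &
   wind s i j c <> 0].
Proof.
move=> sgE ik1 k12 k2j jM ws sv ext ab r d c.
have nbr w : E w (s k1) -> w != s k1 -> w.2 <= (s k1).2 ->
    (w.2 = (s k1).2 -> sg * (s k1).1 <= sg * w.1) -> w = r \/ w = d.
  move=> /E_adj; rewrite /adj => h wv h2 h3.
  have wv' : ~ (w.1 = (s k1).1 /\ w.2 = (s k1).2).
    by move=> [e1 e2]; move/eqP: wv; apply; exact: eq_vtx.
  have [e|e] := eqVneq w.2 (s k1).2.
    left; apply: eq_vtx; rewrite /r //=.
    by have := h3 e; case/orP: sgE => /eqP ->; lia.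
  by right; apply: eq_vtx; rewrite /d /=; lia.
have sk2 : s k2 = s k1 by apply/eqP; rewrite sv; lia.
have Ea : E (s k1.-1) (s k1).
  by have := ws k1.-1; rewrite prednK; [apply; lia|lia].
have Eb : E (s k2.+1) (s k1) by rewrite -sk2; apply: E_sym; apply: ws; lia.
have na : s k1.-1 != s k1 by rewrite sv; lia.
have nb : s k2.+1 != s k1 by rewrite sv; lia.
have [a1 a2] : (s k1.-1).2 <= (s k1).2 /\
    ((s k1.-1).2 = (s k1).2 -> sg * (s k1).1 <= sg * (s k1.-1).1).
  by apply: ext; lia.
have [b1 b2] : (s k2.+1).2 <= (s k1).2 /\
    ((s k2.+1).2 = (s k1).2 -> sg * (s k1).1 <= sg * (s k2.+1).1).
  by apply: ext; lia.
have ha := nbr _ Ea na a1 a2; have hb := nbr _ Eb nb b1 b2.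
have rd : (s k1.-1 = r /\ s k2.+1 = d) \/ (s k1.-1 = d /\ s k2.+1 = r).
  case: ha => ha; case: hb => hb; [|by left|by right|];
  by move: ab; rewrite ha hb eqxx.
split=> //.
have c0 k : (i <= k < j)%N -> k != k1.-1 -> k != k2 ->
    cross (s k) (s k.+1) c = 0.
  move=> kij kk1 kk2.
  have [h1 h2] : (s k).2 <= (s k1).2 /\
    ((s k).2 = (s k1).2 -> sg * (s k1).1 <= sg * (s k).1) by apply: ext; lia.
  have [g1 g2] : (s k.+1).2 <= (s k1).2 /\
    ((s k.+1).2 = (s k1).2 -> sg * (s k1).1 <= sg * (s k.+1).1) by apply: ext; lia.
  have [kv|kv] := boolP (k1 <= k <= k2)%N.
    have e1 : s k = s k1 by apply/eqP; rewrite sv; lia.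
    have e2 : s k.+1 = s k1 by apply/eqP; rewrite sv; lia.
    rewrite e1 e2 /cross; case: ifP => // _.
    by case: ifP => [/andP[/eqP h /eqP h']|_]; [lia|case: ifP => [/andP[/eqP h /eqP h']|//]; lia].
  have n1 : s k != s k1 by rewrite sv; lia.
  have n2 : s k.+1 != s k1 by rewrite sv; lia.
  have n1' : ~ ((s k).1 = (s k1).1 /\ (s k).2 = (s k1).2).
    by move=> [e1 e2]; move/eqP: n1; apply; exact: eq_vtx.
  have n2' : ~ ((s k.+1).1 = (s k1).1 /\ (s k.+1).2 = (s k1).2).
    by move=> [e1 e2]; move/eqP: n2; apply; exact: eq_vtx.
  rewrite /cross /c /=; case: ifP => // /andP[/eqP f1 f2].
  case/orP: sgE => /eqP sgE; rewrite sgE /= in h2 g2 *;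
  by case: ifP => [/andP[/eqP ? /eqP ?]|_]; [lia|case: ifP => [/andP[/eqP ? /eqP ?]|//]; lia].
have k1j : (k1.-1 < j)%N by lia.
rewrite /wind (@big_cat_nat _ _ _ k1 i j) /=; [|lia|lia].
have sum0 m m' : (i <= m)%N -> (m' <= j)%N ->
    (forall k, (m <= k < m')%N -> k != k1.-1 /\ k != k2) ->
    \sum_(m <= k < m') cross (s k) (s k.+1) c = 0.
  move=> im mj H; rewrite big_nat big1 // => k km; have [? ?] := H k km.
  by apply: c0 => //; lia.
have -> : \sum_(i <= k < k1) cross (s k) (s k.+1) c = cross (s k1.-1) (s k1) c.
  have e : k1 = k1.-1.+1 by lia.
  rewrite [X in \sum_(_ <= _ < X) _]e big_nat_recr /=; last by lia.
  by rewrite sum0 ?add0r ?prednK //; lia.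
rewrite (@big_cat_nat _ _ _ k2.+1 k1 j) /=; [|lia|lia].
rewrite big_nat_recr //= sum0 //; [|lia|lia|move=> k; lia].
rewrite sum0 //; [|lia|move=> k; lia].
rewrite add0r addr0 sk2.
case: rd => -[-> ->]; rewrite /cross /r /d /c /=;
  by case/orP: sgE => /eqP -> /=; do ?case: ifP; lia.
Qed.

Lemma first_index (P : pred nat) i j : (exists2 k, (i <= k <= j)%N & P k) ->
  exists k1, [/\ (i <= k1 <= j)%N, P k1 & forall k, (i <= k < k1)%N -> ~~ P k].
Proof.
move=> [k0 k0ij Pk0].
have ex : exists k, (i <= k <= j)%N && P k by exists k0; rewrite k0ij.
exists (ex_minn ex); case: ex_minnP => k1 /andP[k1ij Pk1] k1min; split=> // k kk1.
apply/negP => Pk; have kk : (k1 <= k)%N by apply: k1min; rewrite Pk andbT; lia.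
lia.
Qed.

Lemma last_index (P : pred nat) i j : (exists2 k, (i <= k <= j)%N & P k) ->
  exists k1, [/\ (i <= k1 <= j)%N, P k1 & forall k, (k1 < k <= j)%N -> ~~ P k].
Proof.
move=> [k0 k0ij Pk0].
have ex : exists k, (i <= k <= j)%N && P k by exists k0; rewrite k0ij.
have ub k : (i <= k <= j)%N && P k -> (k <= j)%N by lia.
exists (ex_maxn ex ub); case: ex_maxnP => k1 /andP[k1ij Pk1] k1max; split=> // k kk1.
apply/negP => Pk; have kk : (k <= k1)%N by apply: k1max; rewrite Pk andbT; lia.
lia.
Qed.

(** Highest row, and in it the leftmost place for [sg = 1], the rightmost for [sg = -1]. *)
Definition extreme (sg : int) s i j k0 := forall k, (i <= k <= j)%N ->
  (s k).2 <= (s k0).2 /\ ((s k).2 = (s k0).2 -> sg * (s k0).1 <= sg * (s k).1).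

Lemma extreme_exists (sg : int) s i j : (i <= j)%N ->
  exists2 k0, (i <= k0 <= j)%N & extreme sg s i j k0.
Proof.
move=> /subnKC <-; elim: (j - i)%N => [|m [k0 k0i k0P]].
  by exists i; [lia|move=> k ki; have -> : k = i by lia].
rewrite addnS; pose l := (i + m).+1.
have [b|b] := boolP (((s k0).2 < (s l).2) ||
    (((s k0).2 == (s l).2) && (sg * (s l).1 <= sg * (s k0).1))).
  exists l; first by lia.
  move=> k ki; have [->|kl] := eqVneq k l; first by split=> //; lia.
  by have [|h1 h2] := k0P k; [lia|move: b h1 h2; lia].
exists k0; first by lia.
move=> k ki; have [->|kl] := eqVneq k l; first by move: b; lia.
by apply: k0P; lia.
Qed.

Lemma flat_setr s i j k1 k3 a : (i < k1)%N -> (k3 <= j.+1)%N ->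
  flat i j (setr s k1 k3 a) = flat i j s.
Proof.
move=> ik1 k3j; apply/funext => k; rewrite /flat /setr.
by do !case: ifP => //; lia.
Qed.

Lemma flat_const s i j : (forall k, (i <= k <= j)%N -> s k = s i) -> flat i j s = s.
Proof.
move=> si; apply/funext => k; rewrite /flat /setr; case: ifP => // h.
by rewrite si //; lia.
Qed.

Lemma walk_E_refl s i j : walk s -> (i <= j <= M)%N -> (i < j)%N -> E (s i) (s i).
Proof. by move=> ws ij lij; apply: E_refl (ws i _); lia. Qed.

(* Outer induction on the number of moving steps, inner one on the total height.
   Take the top row of the closed walk and in it the leftmost vertex, or the
   rightmost one if the leftmost is the base point.  If it is visited more than
   once, the part between two visits is contracted first; if the walk goes back
   along the edge it came from, that step is removed; otherwise the walk turns
   there, the square inside the corner has winding number 1 or -1, and the vertex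
   is pushed down across it. *)
Lemma contract_walk n : forall s i j, walk s -> (i <= j <= M)%N -> s i = s j ->
  (nsteps s i j <= n)%N -> N (flat i j s) -> N s.
Proof.
elim: n => [|n IHn] s i j ws ijM sij nsn.
  move: nsn; rewrite leqn0 => /eqP /nsteps_eq0 /flat_const ->; exact.
have [B BP] : exists B : int, forall k, (i <= k <= j)%N -> B <= (s k).2.
  have /andP[ij _] := ijM; move: ij => /subnKC <-.
  elim: (j - i)%N => [|m [B BP]].
    by exists (s i).2 => k ki; have -> : k = i by lia.
  exists (Num.min B (s (i + m).+1).2) => k ki.
  have [->|kl] := eqVneq k (i + m).+1; first by rewrite ge_min lexx orbT.
  by rewrite ge_min BP //; lia.
have [h hP] : exists h, (height B s i j < h)%N by exists (height B s i j).+1.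
elim: h s ws sij nsn BP hP => [|h IHh] s ws sij nsn BP hP Nf; first by [].
have /andP[ij jM] := ijM.
have [ns0|ns0] := eqVneq (nsteps s i j) 0%N.
  by move: Nf; rewrite flat_const //; exact: nsteps_eq0.
have ij' : (i < j)%N.
  rewrite ltn_neqAle ij andbT; apply/eqP => e; move/eqP: ns0; apply.
  by rewrite /nsteps e big_geq.
have Epp : E (s i) (s i) by apply: (walk_E_refl (j := j)).
have process sg k0 : (sg == 1) || (sg == -1) -> (i <= k0 <= j)%N ->
    extreme sg s i j k0 -> s k0 != s i -> N s.
  move=> sgE k0ij ext vp; set v := s k0 in vp.
  have [|k1 [k1ij /eqP k1v k1min]] := @first_index (fun k => s k == v) i j.
    by exists k0.
  have [|k3 [k3ij /eqP k3v k3max]] := @last_index (fun k => s k == v) i j.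
    by exists k0.
  have ik1 : (i < k1)%N.
    rewrite ltn_neqAle; apply/andP; split; last by lia.
    by apply/eqP => e; move: vp; rewrite -k1v e eqxx.
  have k3j : (k3 < j)%N.
    rewrite ltn_neqAle; apply/andP; split; last by lia.
    by apply/eqP => e; move: vp; rewrite -k3v e sij eqxx.
  have k13 : (k1 <= k3)%N.
    by rewrite leqNgt; apply/negP => lt; have := k1min k3; rewrite k3v eqxx => H; have : false by apply: H; lia.
  have sum3 := nsteps_cat s (ltnW ik1) (ltnW (leq_ltn_trans k13 k3j)).
  have sum2 := nsteps_cat s k13 (ltnW k3j).
  have p1 : (0 < nsteps s i k1)%N.
    by apply: (@nsteps_gt0 s i k1 i k1); [lia|lia|rewrite k1v eq_sym].
  have p3 : (0 < nsteps s k3 j)%N.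
    by apply: (@nsteps_gt0 s k3 j j k3); [lia|lia|rewrite -sij k3v eq_sym].
  (* If the walk leaves [v] between its first and last visit, the closed part in between has fewer
     moving steps than the whole, and so has the walk that remains after its contraction. *)
  have [n13|n13] := eqVneq (nsteps s k1 k3) 0%N; last first.
    have lk13 : (k1 < k3)%N.
      rewrite ltn_neqAle k13 andbT; apply/eqP => e; move/eqP: n13; apply.
      by rewrite /nsteps e big_geq.
    apply: (IHn s k1 k3) => //; [lia|by rewrite k1v|lia|].
    have ws' : walk (flat k1 k3 s).
      apply: walk_setr => //.
      - by apply: (walk_E_refl (j := k3)) => //; lia.
      - by move=> k10; have := ws k1.-1; rewrite prednK //; apply; lia.
      - by move=> k3M; rewrite k1v -k3v; apply: ws; lia.
    have si : flat k1 k3 s i = s i by rewrite /flat /setr; case: ifP => //; lia.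
    have sj : flat k1 k3 s j = s j by rewrite /flat /setr; case: ifP => //; lia.
    apply: (IHn _ i j) => //; [by rewrite si sj| |by rewrite flat_setr //; lia].
    rewrite (nsteps_cat _ (ltnW ik1) (ltnW (leq_ltn_trans k13 k3j))).
    rewrite (nsteps_cat _ k13 (ltnW k3j)).
    rewrite (@nsteps_const _ k1 k3 (s k1)); last first.
      by move=> k kk; rewrite /flat /setr; case: ifP => //; lia.
    rewrite (@eq_nsteps _ s i k1); last first.
      move=> k kk; rewrite /flat /setr; case: ifP => // kk'.
      by have -> : k = k1 by lia.
    rewrite (@eq_nsteps _ s k3 j); last first.
      move=> k kk; rewrite /flat /setr; case: ifP => // kk'.
      by have -> : k = k3 by [lia]; rewrite k1v k3v.
    lia.
  have run k : (k1 <= k <= k3)%N -> s k = v.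
    by move=> kk; rewrite (nsteps_eq0 n13 kk) k1v.
  set a := s k1.-1; set b := s k3.+1.
  have Eav : E a v by have := ws k1.-1; rewrite prednK ?k1v; [apply; lia|lia].
  have Evb : E v b by have := ws k3; rewrite k3v; apply; lia.
  have Eaa : E a a := E_refl Eav.
  have av : a != v.
    by apply: k1min; lia.
  have bv : b != v by apply: k3max; lia.
  have q1 : (0 < nsteps s k1.-1 k3)%N.
    by apply: (@nsteps_gt0 s _ _ k1.-1 k3); [lia|lia|rewrite k3v].
  have q3 : (0 < nsteps s k3 k3.+1)%N.
    by apply: (@nsteps_gt0 s _ _ k3.+1 k3); [lia|lia|rewrite k3v].
  have k1_gt0 : (0 < k1)%N by lia.
  have k13M : (k1 <= k3 <= M)%N by lia.
  have Ba : B <= (s k1.-1).2 by apply: BP; lia.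
  have Bb : B <= (s k3.+1).2 by apply: BP; lia.
  have ik3 : (i < k3)%N := leq_trans ik1 k13.
  have ik3' := ltnW ik3.
  have k3j1 : (k3 <= j.+1)%N by lia.
  have k3M : (0 < k3 < M)%N by lia.
  have c1 : (i <= k1.-1)%N by lia.
  have c2 : (k1.-1 <= k3)%N by lia.
  have c3 : (k3 <= k3.+1)%N by lia.
  have split3 s' : nsteps s' i j = (nsteps s' i k1.-1 + nsteps s' k1.-1 k3
      + nsteps s' k3 k3.+1 + nsteps s' k3.+1 j)%N.
    rewrite -(nsteps_cat s' c1 c2) -(nsteps_cat s' (leq_trans c1 c2) c3).
    by rewrite -nsteps_cat //; lia.
  (* A step out to [v] and straight back is removed. Otherwise the walk turns at [v], and
     extremality leaves only the neighbour beside [v] and the one below it. *)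
  have [ab|ab] := eqVneq a b.
    apply: (@run_move s k1 k3.+1 v ws _ _ _ Eav); [lia|lia| | |].
    - by move=> k kk; apply: run; lia.
    - by right; exact/esym.
    set s' := setr _ _ _ _.
    have ws' : walk s'.
      by apply: walk_setr => // _; rewrite -/b -ab.
    have si : s' i = s i by rewrite /s' /setr; case: ifP => //; lia.
    have sj : s' j = s j by rewrite /s' /setr; case: ifP => //; lia.
    apply: (IHn s' i j) => //; [by rewrite si sj| |by rewrite flat_setr //; lia].
    move: nsn; rewrite !split3.
    rewrite (@eq_nsteps s' s i k1.-1); last first.
      by move=> k kk; rewrite /s' /setr; case: ifP => // kk'; lia.
    rewrite (@eq_nsteps s' s k3.+1 j); last first.
      by move=> k kk; rewrite /s' /setr; case: ifP => // kk'; lia.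
    have cs k : (k1.-1 <= k <= k3.+1)%N -> s' k = a.
      move=> kk; rewrite /s' /setr; case: ifP => // kk'.
      have [->|kn] := eqVneq k k1.-1; first by [].
      by have -> : k = k3.+1 by [lia]; rewrite ab.
    rewrite (@nsteps_const s' k1.-1 k3 a); last by move=> k kk; apply: cs; lia.
    rewrite (@nsteps_const s' k3 k3.+1 a); last by move=> k kk; apply: cs; lia.
    lia.
  have sv k : (i <= k <= j)%N -> (s k == s k1) = (k1 <= k <= k3)%N.
    move=> kk; rewrite k1v; apply/idP/idP => [kv|kk']; last by rewrite run.
    apply/andP; split; rewrite leqNgt; apply/negP => lt.
      by have /negP[] : ~~ (s k == v) by apply: k1min; lia.
    by have /negP[] : ~~ (s k == v) by apply: k3max; lia.
  have [] := @wind_corner sg s i j k1 k3 sgE ik1 k13 k3j jM ws sv _ ab.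
    by move=> k kk; rewrite k1v; exact: ext.
  rewrite k1v; rewrite -/a -/b; set c := (X in wind _ _ _ X); move=> rd wc.
  have Qc : Q c by apply: (Q_wind ws ij jM sij wc).
  pose q : vtx := (v.1 + sg, v.2 - 1).
  have [ca cv cq cb] : [/\ corner c a, corner c v, corner c q & corner c b].
    by have [? ? ? ?] := corner_square v sgE; case: rd => -[-> ->].
  have [aq bq] : adj a q /\ adj q b.
    by have [? ? ? ?] := adj_square v sgE; case: rd => -[-> ->].
  have a2 : a.2 <= v.2 by case: rd => -[-> _] //=; rewrite lerBlDr lerDl.
  have q2 : q.2 = a.2 \/ q.2 = b.2 by case: rd => -[-> ->]; [right|left].
  have Bq : B <= q.2 by case: q2 => ->.
  have qv' : q.2 < v.2 by rewrite /= ltrBlDr ltrDl.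
  have qv := ltW qv'.
  have Eaq : E a q by exact: Q_E Qc ca cq aq.
  have Eqb : E q b by exact: Q_E Qc cq cb bq.
  have Eqq : E q q := E_refl Eqb.
  apply: (@run_move s k1 k3 v ws k1_gt0 k13M _ Eav).
  - by move=> k /andP[kk1 /ltnW kk3]; apply: run; rewrite kk1.
  - by left.
  rewrite -/a; set s1 := setr _ _ _ _.
  have s1p : s1 k3.-1 = a by exact: setr_prev.
  have s1c : s1 k3 = v by rewrite /s1 setr_out ?leqnn ?orbT.
  have s1n : s1 k3.+1 = b by rewrite /s1 setr_out ?leqnSn ?orbT.
  have ws1 : walk s1.
    by apply: walk_run => // _; rewrite k3v.
  apply: (@N_move s1 k3 q ws1 k3M).
  - by rewrite s1p.
  - by rewrite s1n.
  - by right; exists c => //; rewrite s1p s1c s1n ca cv cq cb.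
  set s2 := setr s1 _ _ _.
  have s2E k : s2 k = if k == k3 then q else if (k1 <= k < k3)%N then a else s k.
    exact: setr_run.
  have ws2 : walk s2.
    by apply: walk_setr => // _; [rewrite s1p|rewrite s1n].
  have s2i : s2 i = s i by rewrite /s2 setr_out ?ik3 // /s1 setr_out ?ik1.
  have s2j : s2 j = s j.
    by rewrite /s2 setr_out ?k3j ?orbT // /s1 setr_out // (ltnW k3j) orbT.
  apply: (IHh s2) => //.
  - by rewrite s2i s2j.
  - by apply: leq_trans nsn; apply: nsteps_push => //; rewrite k3v.
  - by move=> k kk; rewrite s2E; case: eqP => // _; case: ifP => // _; exact: BP.
  - rewrite -ltnS; apply: leq_trans hP; rewrite ltnS.
    apply: (@height_lt _ _ _ _ _ k3); first by rewrite ik3' k3j.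
      move=> k kk; rewrite s2E; case: eqP => [->|_].
        by rewrite k3v; exact: leq_dist Bq qv.
      by case: ifP => // /andP[kk1 /ltnW kk3]; rewrite (run k) ?kk1 //; exact: leq_dist.
    by rewrite s2E eqxx k3v; exact: ltn_dist.
  - by rewrite (flat_setr _ _ ik3 (leqW k3j)) (flat_setr _ _ ik1 k3j1).
(* If the base point is both the leftmost and the rightmost vertex of the top row, it is alone
   there, so the walk leaves and re-enters it through the vertex below. The closed part based at
   that vertex is contracted; what remains is one step down and back. *)
have [k0 k0ij ext] := extreme_exists 1 s ij.
have [vp|] := eqVneq (s k0) (s i); last by apply: process ext.
have [k0' k0'ij ext'] := extreme_exists (-1) s ij.
have [vp'|] := eqVneq (s k0') (s i); last by apply: process ext'.
have top k : (i <= k <= j)%N -> s k != s i -> (s k).2 < (s i).2.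
  move=> kk ki; have := ext k kk; have := ext' k kk; rewrite vp vp'.
  move=> [h1 h2] [_ h3]; rewrite lt_neqAle h1 andbT; apply/eqP => e.
  move/eqP: ki; apply; apply: eq_vtx => //.
  by have := h2 e; have := h3 e; lia.
have [|k1 [k1ij k1v k1min]] := @first_index (fun k => s k != s i) i j.
  apply: contrapT => H; move/eqP: ns0; apply; apply: (@nsteps_const _ _ _ (s i)).
  by move=> k kk; apply/eqP; apply: contrapT => /negP kn; apply: H; exists k.
have [|k3 [k3ij k3v k3max]] := @last_index (fun k => s k != s i) i j.
  by exists k1.
have ik1 : (i < k1)%N.
  rewrite ltn_neqAle; apply/andP; split; last by lia.
  by apply/eqP => e; move: k1v; rewrite -e eqxx.
have k3j : (k3 < j)%N.
  rewrite ltn_neqAle; apply/andP; split; last by lia.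
  by apply/eqP => e; move: k3v; rewrite e -sij eqxx.
have k13 : (k1 <= k3)%N.
  rewrite leqNgt; apply/negP => lt; have := k1min k3; rewrite k3v => H.
  by have : false by apply: H; lia.
have pa : s k1.-1 = s i by apply/eqP; rewrite -[_ == _]negbK; apply: k1min; lia.
have pb : s k3.+1 = s i by apply/eqP; rewrite -[_ == _]negbK; apply: k3max; lia.
have E1 : E (s i) (s k1).
  by rewrite -pa; have := ws k1.-1; rewrite prednK; [apply; lia|lia].
have E3 : E (s k3) (s i) by rewrite -pb; apply: ws; lia.
have d1 : s k1 = ((s i).1, (s i).2 - 1).
  have := top k1 k1ij k1v; have := E_adj E1; rewrite /adj => h1 h2.
  by apply: eq_vtx => /=; lia.
have d3 : s k3 = ((s i).1, (s i).2 - 1).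
  have := top k3 k3ij k3v; have := E_adj E3; rewrite /adj => h1 h2.
  by apply: eq_vtx => /=; lia.
apply: (IHn s k1 k3) => //; [lia|by rewrite d1 d3| |].
  have sum3 := nsteps_cat s (ltnW ik1) (ltnW (leq_ltn_trans k13 k3j)).
  have sum2 := nsteps_cat s k13 (ltnW k3j).
  have p1 : (0 < nsteps s i k1)%N.
    by apply: (@nsteps_gt0 s i k1 k1 i); [lia|lia|].
  lia.
have ws' : walk (flat k1 k3 s).
  apply: walk_setr => //.
  - by apply: E_refl (E_sym E1).
  - by move=> k10; rewrite pa.
  - by move=> k3M; rewrite pb d1 -d3.
have si : flat k1 k3 s k1.-1 = s i by rewrite /flat /setr pa; case: ifP => //; lia.
apply: (@run_move _ k1 k3.+1 (s k1)) => //; [lia|lia| | | |].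
- by move=> k kk; rewrite /flat /setr; case: ifP => //; lia.
- by rewrite si.
- by right; rewrite si -pb /flat /setr; case: ifP => //; lia.
rewrite si (_ : setr _ _ _ _ = flat i j s) //.
apply/funext => k; rewrite /flat /setr.
case: ifP => kk; first by case: ifP => //; lia.
case: ifP => k5; first by lia.
case: ifP => // k4; apply/eqP; rewrite -[_ == _]negbK.
by have [k1k|kk1] := leqP k1 k; [apply: k3max|apply: k1min]; lia.
Qed.

End Walks.

(** * Simple connectivity *)

Section NullHomotopy.
Variable R : realType.
Local Notation C := R[i].
Implicit Types (z w : C) (T K : set C).

Let I01 (t : R) := 0 <= t <= 1.

Definition convex_set K := forall z w, K z -> K w -> cseg z w `<=` K.

Lemma cseg_mem z w (u : R) : 0 <= u <= 1 -> cseg z w (z + (u%:C)%C * (w - z)).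
Proof. by move=> u01; exists u => //=; rewrite in_itv. Qed.

Lemma cseg_convex z w : convex_set (cseg z w).
Proof.
move=> _ _ [a /= +] <- [b /= +] <- _ [t /= +] <-.
rewrite !in_itv /= => /andP[a0 a1] /andP[b0 b1] /andP[t0 t1].
exists (a + t * (b - a)).
  rewrite /= in_itv /=; have -> : a + t * (b - a) = (1 - t) * a + t * b by ring.
  have t1' : 0 <= 1 - t by rewrite subr_ge0.
  apply/andP; split; first by rewrite addr_ge0 ?mulr_ge0.
  have h1 : (1 - t) * a <= (1 - t) * 1 by rewrite ler_wpM2l.
  have h2 : t * b <= t * 1 by rewrite ler_wpM2l.
  lra.
by rewrite rmorphD rmorphM rmorphB /=; ring.
Qed.

Lemma cball_convex z r : convex_set (cball z r).
Proof.
move=> a b az bz _ [t /= +] <-; rewrite in_itv /= => /andP[t0 t1].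
have t1' : 0 <= 1 - t by rewrite subr_ge0.
rewrite /cball /mkset.
have -> : a + (t%:C)%C * (b - a) - z = ((1 - t)%:C)%C * (a - z) + (t%:C)%C * (b - z).
  by rewrite rmorphB rmorph1; ring.
apply: le_lt_trans (cmodD _ _) _; rewrite !cmodM !cmod_real !ger0_norm //.
have [t00|t00] := eqVneq t 0.
  by rewrite t00 subr0 mul1r mul0r addr0.
have tp : 0 < t by rewrite lt_def t00.
have h1 : (1 - t) * cmod (a - z) <= (1 - t) * r by rewrite ler_wpM2l // ltW.
have h2 : t * cmod (b - z) < t * r by rewrite ltr_pM2l.
by lra.
Qed.

Definition cont01 (g : R -> C) := forall t, I01 t -> forall e : R, 0 < e ->
  exists2 d : R, 0 < d & forall t', I01 t' -> `|t' - t| < d -> cmod (g t' - g t) < e.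

Lemma cont01P (g : R -> C) : {within `[0, 1], continuous g} <-> cont01 g.
Proof.
split=> [/subspace_continuousP cg t t01 e e0|cg].
  have : nbhs (g t) (cball (g t) e) by apply/nbhs_cballP; exists e.
  have t01' : `[0, 1]%classic t by rewrite /= in_itv.
  move=> /(cg t t01') /nbhs_ballP[d /= d0 dP]; exists d => // t' t'01 tt'.
  by apply: dP; rewrite /ball /= ?in_itv // distrC.
apply/subspace_continuousP => t /=; rewrite in_itv /= => t01 B.
move=> /nbhs_cballP[e e0 eB]; have [d d0 dP] := cg t t01 e e0.
apply/nbhs_ballP; exists d => //= t' tt' /=; rewrite in_itv /= => t'01.
by apply: eB; apply: dP => //; move: tt'; rewrite /ball /= distrC.
Qed.

Definition cont2 (H : R * R -> C) := forall p, I01 p.1 -> I01 p.2 ->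
  forall e : R, 0 < e -> exists2 d : R, 0 < d & forall q, I01 q.1 -> I01 q.2 ->
    `|q.1 - p.1| < d -> `|q.2 - p.2| < d -> cmod (H q - H p) < e.

Lemma cont2P (H : R * R -> C) : {within `[0, 1] `*` `[0, 1], continuous H} <-> cont2 H.
Proof.
split=> [/subspace_continuousP cH p p1 p2 e e0|cH].
  have : nbhs (H p) (cball (H p) e) by apply/nbhs_cballP; exists e.
  have p01 : (`[0, 1] `*` `[0, 1])%classic p by split; rewrite /= in_itv.
  move=> /(cH p p01) /nbhs_ballP[d /= d0 dP]; exists d => // q q1 q2 pq1 pq2.
  apply: dP; first by split; rewrite /ball /= distrC.
  by split; rewrite /= in_itv.
apply/subspace_continuousP => p [/=]; rewrite !in_itv /= => p1 p2 B.
move=> /nbhs_cballP[e e0 eB]; have [d d0 dP] := cH p p1 p2 e e0.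
apply/nbhs_ballP; exists d => //= q [qp1 qp2] [/=]; rewrite !in_itv /= => q1 q2.
by apply: eB; apply: dP => //; [move: qp1|move: qp2]; rewrite /ball /= distrC.
Qed.

Lemma null_homotopic_cst T z : T z -> null_homotopic_in T (fun=> z).
Proof.
move=> Tz; exists (fun=> z), z; split=> //.
  by apply/cont2P => p _ _ e e0; exists 1 => // q *; rewrite subrr cmod0.
by move=> _ [p _ <-].
Qed.

Lemma eq_null_homotopic T (g g' : R -> C) : (forall t, I01 t -> g t = g' t) ->
  null_homotopic_in T g' -> null_homotopic_in T g.
Proof.
move=> gg [H [c [cH HT H0 H1 Hp]]]; exists H, c; split=> // t t01.
by rewrite H0 // gg //; move: t01; rewrite in_itv.
Qed.

(** The straight-line homotopy to [g'] fills the first half of the time, the given contraction of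
    [g'] the second half. *)
Lemma null_homotopic_line T (g g' : R -> C) : cont01 g -> cont01 g' ->
  g 0 = g 1 -> g' 0 = g' 1 ->
  (forall t, I01 t -> cseg (g t) (g' t) `<=` T) ->
  null_homotopic_in T g' -> null_homotopic_in T g.
Proof.
move=> cg cg' g01 g'01 gT [H' [c [/cont2P cH' H'T H'0 H'1 H'p]]].
pose F (p : R * R) : C := g p.2 + ((2 * p.1)%:C)%C * (g' p.2 - g p.2).
pose G (p : R * R) : C := H' (2 * p.1 - 1, p.2).
have cF : cont2 F.
  move=> p p1 p2 e e0; have e3 : 0 < e / 4 / 3 by rewrite !divr_gt0.
  have [d d0 dP] := cg _ p2 _ e3; have [d' d'0 d'P] := cg' _ p2 _ e3.
  pose K := cmod (g' p.2 - g p.2) + 1.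
  have K0 : 0 < K by rewrite ltr_wpDl ?cmod_ge0.
  exists (Num.min (Num.min d d') (e / 8 / K)).
    by rewrite !lt_min d0 d'0 !divr_gt0.
  move=> q q1 q2; rewrite !lt_min => /andP[_ k1] /andP[/andP[k2 k3] _].
  have h1 := dP _ q2 k2; have h2 := d'P _ q2 k3.
  have -> : F q - F p = (g q.2 - g p.2) + ((2 * q.1)%:C)%C *
     ((g' q.2 - g' p.2) - (g q.2 - g p.2)) +
     ((2 * (q.1 - p.1))%:C)%C * (g' p.2 - g p.2).
    rewrite (_ : ((2 * (q.1 - p.1))%:C)%C = ((2 * q.1)%:C)%C - ((2 * p.1)%:C)%C).
      by rewrite /F; ring.
    by rewrite (mulrBr 2) rmorphB.
  apply: le_lt_trans (cmodD _ _) _; rewrite [X in _ + X]cmodM cmod_real.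
  have t1 : `|2 * (q.1 - p.1)| * cmod (g' p.2 - g p.2) <= e / 4.
    rewrite normrM ger0_norm //.
    have : `|q.1 - p.1| * cmod (g' p.2 - g p.2) <= e / 8 / K * K.
      by rewrite ler_pM ?cmod_ge0 ?(ltW k1) // /K lerDl.
    by rewrite divfK ?gt_eqF //; lra.
  have t2 : cmod (((2 * q.1)%:C)%C * ((g' q.2 - g' p.2) - (g q.2 - g p.2))) <=
      2 * (e / 4 / 3 + e / 4 / 3).
    rewrite cmodM cmod_real; have /andP[q10 q11] := q1.
    rewrite ger0_norm ?mulr_ge0 //; apply: ler_pM; rewrite ?mulr_ge0 ?cmod_ge0 //.
      by rewrite -[X in _ <= X]mulr1 ler_wpM2l.
    apply: le_trans (cmodD _ _) _; rewrite cmodN; apply: lerD; exact: ltW.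
  have := cmodD (g q.2 - g p.2) (((2 * q.1)%:C)%C *
    ((g' q.2 - g' p.2) - (g q.2 - g p.2))).
  by lra.
pose H (p : R * R) := if p.1 <= 2^-1 then F p else G p.
exists H, c; split.
- apply/cont2P => p p1 p2 e e0; have /andP[p10 p11] := p1.
  have [d d0 dP] := cF p p1 p2 e e0.
  have G2 : 2^-1 <= p.1 -> exists2 d' : R, 0 < d' & forall q, I01 q.1 -> I01 q.2 ->
      2^-1 <= q.1 -> `|q.1 - p.1| < d' -> `|q.2 - p.2| < d' -> cmod (G q - G p) < e.
    move=> ph; have pg : I01 (2 * p.1 - 1) by apply/andP; split; lra.
    have [d' d'0 d'P] := cH' (2 * p.1 - 1, p.2) pg p2 e e0.
    exists (d' / 2); first by rewrite divr_gt0.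
    move=> q /andP[q10 q11] q2 qh k1 k2; apply: d'P => //=.
    - by apply/andP; split; lra.
    - have -> : 2 * q.1 - 1 - (2 * p.1 - 1) = 2 * (q.1 - p.1) by ring.
      by rewrite normrM ger0_norm //; lra.
    - by apply: lt_trans k2 _; lra.
  have FG q : I01 q.2 -> q.1 = 2^-1 -> F q = G q.
    move=> q2 qh; rewrite /F /G qh divff // subrr.
    by rewrite H'0 ?in_itv // mul1r subrKC.
  have [ph|ph|ph] := ltgtP p.1 2^-1.
  + exists (Num.min d (2^-1 - p.1)); first by rewrite lt_min d0 subr_gt0.
    move=> q q1 q2; rewrite !lt_min => /andP[k1 k2] /andP[k3 _].
    have qh : q.1 <= 2^-1.
      by move: k2; rewrite ltr_norml => /andP[? ?]; lra.
    by rewrite /H qh (ltW ph); exact: dP.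
  + have [d' d'0 d'P] := G2 (ltW ph).
    exists (Num.min d' (p.1 - 2^-1)); first by rewrite lt_min d'0 subr_gt0.
    move=> q q1 q2; rewrite !lt_min => /andP[k1 k2] /andP[k3 _].
    have qh : 2^-1 < q.1.
      by move: k2; rewrite ltr_norml => /andP[? ?]; lra.
    by rewrite /H !leNgt qh ph /=; apply: d'P => //; exact: ltW.
  + have [|d' d'0 d'P] := G2; first by rewrite ph.
    exists (Num.min d d'); first by rewrite lt_min d0.
    move=> q q1 q2; rewrite !lt_min => /andP[k1 k2] /andP[k3 k4].
    rewrite /H ph lexx; case: ifP => qh; first exact: dP.
    rewrite FG //; apply: d'P => //.
    by rewrite leNgt; apply/negP => /ltW; rewrite qh.
- move=> z [p [/=]]; rewrite !in_itv /= => /andP[p10 p11] p2 <-; rewrite /H.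
  case: ifP => ph.
    by apply: (gT _ p2); apply: cseg_mem; apply/andP; split; lra.
  have {}ph : 2^-1 < p.1 by rewrite ltNge ph.
  apply: H'T; exists (2 * p.1 - 1, p.2) => //; split=> /=; rewrite in_itv //=.
  by apply/andP; split; lra.
- move=> t _; rewrite /H /= ifT ?invr_ge0 // /F /= mulr0.
  by rewrite (_ : (0%:C)%C = 0) // mul0r addr0.
- move=> t t01; rewrite /H /= ifF; last by apply/negP; lra.
  by rewrite /G /= (_ : 2 * 1 - 1 = 1) ?H'1 //; ring.
- move=> s; rewrite in_itv /= => /andP[s0 s1]; rewrite /H /=; case: ifP => sh.
    by rewrite /F /= g01 g'01.
  rewrite /G /=; apply: H'p; rewrite in_itv /=.
  have {}sh : 2^-1 < s by rewrite ltNge sh.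
  by apply/andP; split; lra.
Qed.

End NullHomotopy.

(** * Polygonal curves *)

Section PolygonalCurves.
Variable R : realType.
Local Notation C := R[i].
Implicit Types (z w : C) (s : nat -> C) (t : R).

Lemma real_complexB (x y : R) : ((x - y)%:C)%C = (x%:C)%C - (y%:C)%C.
Proof. by rewrite rmorphB. Qed.

Definition clamp t : R := Num.max 0 (Num.min 1 t).

Lemma clamp_lip t t' : `|clamp t - clamp t'| <= `|t - t'|.
Proof.
rewrite /clamp ler_norml; have := ler_norm (t - t'); have := ler_norm (- (t - t')).
rewrite normrN => h1 h2.
by case: (leP 1 t) => ?; case: (leP 1 t') => ?; rewrite ?maxEle ?minEle;
   do ?case: ifP => ?; apply/andP; split; lra.
Qed.

(** The piecewise linear curve through the [s j] at equally spaced times: completed increments count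
    fully, the current one in proportion, later ones not at all. A single formula avoids gluing
    pieces to prove continuity. *)
Definition polygon s (M : nat) t : C :=
  s 0%N + \sum_(j < M) ((clamp (t * M%:R - j%:R))%:C)%C * (s j.+1 - s j).

Lemma polygon_cont s M : cont01 (polygon s M).
Proof.
suff H m t e : 0 < e -> exists2 d : R, 0 < d & forall t', `|t' - t| < d ->
    cmod ((s 0%N + \sum_(j < m) ((clamp (t' * M%:R - j%:R))%:C)%C * (s j.+1 - s j)) -
    (s 0%N + \sum_(j < m) ((clamp (t * M%:R - j%:R))%:C)%C * (s j.+1 - s j))) < e.
  by move=> t _ e /(H M t e)[d d0 dP]; exists d => // t' _; exact: dP.
elim: m t e => [|m IHm] t e e0.
  by exists 1 => // t' _; rewrite !big_ord0 subrr cmod0.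
have e2 : 0 < e / 2 by rewrite divr_gt0.
have [d d0 dP] := IHm t _ e2.
pose K := cmod (s m.+1 - s m) * M%:R + 1.
have K0 : 0 < K by rewrite ltr_wpDl ?mulr_ge0 ?cmod_ge0.
exists (Num.min d (e / 2 / K)); first by rewrite lt_min d0 divr_gt0.
move=> t'; rewrite lt_min => /andP[/dP h1 h2]; rewrite !big_ord_recr /= !addrA.
set a := s 0%N + _ in h1 *; set b := s 0%N + _ in h1 *.
set k := s m.+1 - s m in K K0 h2 *.
have -> : a + ((clamp (t' * M%:R - m%:R))%:C)%C * k
    - (b + ((clamp (t * M%:R - m%:R))%:C)%C * k) =
   (a - b) + ((clamp (t' * M%:R - m%:R) - clamp (t * M%:R - m%:R))%:C)%C * k.
  by rewrite real_complexB; ring.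
apply: le_lt_trans (cmodD _ _) _; rewrite cmodM cmod_real [e]splitr; apply: ltr_leD => //.
have h3 := clamp_lip (t' * M%:R - m%:R) (t * M%:R - m%:R).
have h4 : `|clamp (t' * M%:R - m%:R) - clamp (t * M%:R - m%:R)| <= `|t' - t| * M%:R.
  apply: le_trans h3 _.
  have -> : t' * M%:R - m%:R - (t * M%:R - m%:R) = (t' - t) * M%:R by ring.
  by rewrite normrM normr_nat.
have h5 : `|t' - t| * K <= e / 2 / K * K by rewrite ler_wpM2r // ltW.
rewrite divfK ?gt_eqF // in h5.
have h6 := ler_wpM2r (cmod_ge0 k) h4; apply: le_trans h6 _.
apply: le_trans h5; rewrite /K mulrDr mulr1.
by rewrite -mulrA [M%:R * _]mulrC lerDl.
Qed.

(** The index [j] and the ratio [u] depend on [t] but not on [s], so two polygons of the same length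
    can be compared segment by segment. *)
Lemma polygon_segment M t : (0 < M)%N -> 0 <= t <= 1 ->
  exists j u, [/\ (j < M)%N, 0 <= u <= 1, `|t - j%:R / M%:R| <= M%:R^-1 &
    forall s, polygon s M t = s j + (u%:C)%C * (s j.+1 - s j)].
Proof.
move=> M0 /andP[t0 t1]; have MR : 0 < M%:R :> R by rewrite ltr0n.
have tM0 : 0 <= t * M%:R by rewrite mulr_ge0.
have tM : t * M%:R <= M%:R by rewrite -[X in _ <= X]mul1r ler_wpM2r.
have [j [jM jt tj]] : exists j, [/\ (j < M)%N, j%:R <= t * M%:R & t * M%:R <= j.+1%:R].
  have [h|h] := leP M.-1%:R (t * M%:R).
    by exists M.-1; rewrite prednK //; split.
  have /andP[h1 h2] := truncn_itv tM0.
  exists (Num.truncn (t * M%:R)); split=> //; last exact: ltW.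
  have h3 : (Num.truncn (t * M%:R))%:R < M.-1%:R :> R by exact: le_lt_trans h1 h.
  by rewrite ltr_nat in h3; lia.
exists j, (t * M%:R - j%:R); split=> //.
- by rewrite subr_ge0 jt lerBlDr addrC natr1.
- rewrite -[t](mulfK (lt0r_neq0 MR)) -mulrBl normrM normfV (gtr0_norm MR).
  rewrite -[X in _ <= X]mul1r ler_pM2r ?invr_gt0 // ger0_norm ?subr_ge0 //.
  by rewrite lerBlDr addrC natr1.
move=> s; rewrite /polygon.
pose F i := ((clamp (t * M%:R - i%:R))%:C)%C * (s i.+1 - s i).
rewrite -(big_mkord xpredT F) (@big_cat_nat _ _ _ j 0%N M) /=; [|by []|exact: ltnW].
rewrite (big_ltn jM).
have -> : \sum_(0 <= i < j) F i = s j - s 0%N.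
  rewrite -(telescope_sumr s) // big_nat [RHS]big_nat; apply: eq_bigr => i /andP[_ ij].
  rewrite /F /clamp (_ : Num.min 1 _ = 1); last first.
    apply/min_idPl; rewrite lerBrDr addrC natr1.
    by apply: le_trans jt; rewrite ler_nat.
  by rewrite (_ : Num.max 0 1 = 1) ?mul1r //; apply/max_idPr.
have -> : \sum_(j.+1 <= i < M) F i = 0.
  rewrite big_nat big1 // => i /andP[ji _].
  rewrite /F /clamp (_ : Num.max 0 _ = 0) ?mul0r //; apply/max_idPl.
  rewrite ge_min subr_le0; apply/orP; right; apply: le_trans tj _.
  by rewrite ler_nat.
rewrite /F /clamp addr0 addrA subrKC (_ : Num.min 1 _ = t * M%:R - j%:R).
  by rewrite (_ : Num.max 0 _ = t * M%:R - j%:R) //; apply/max_idPr; rewrite subr_ge0.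
by apply/min_idPr; rewrite lerBlDr addrC natr1.
Qed.

Lemma polygon0 s M : polygon s M 0 = s 0%N.
Proof.
rewrite /polygon big1 ?addr0 // => j _; rewrite /clamp (_ : Num.max 0 _ = 0) ?mul0r //.
apply/max_idPl; by rewrite ge_min ?mul0r sub0r oppr_le0 ler0n orbT.
Qed.

Lemma polygon1 s M : polygon s M 1 = s M.
Proof.
rewrite /polygon mul1r.
have -> : \sum_(j < M) ((clamp (M%:R - j%:R))%:C)%C * (s j.+1 - s j) =
    \sum_(0 <= j < M) (s j.+1 - s j).
  rewrite big_mkord; apply: eq_bigr => j _.
  rewrite /clamp (_ : Num.min 1 _ = 1); last first.
    by apply/min_idPl; rewrite lerBrDr addrC natr1 ler_nat.
  by rewrite (_ : Num.max 0 1 = 1) ?mul1r //; apply/max_idPr.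
by rewrite telescope_sumr // subrKC.
Qed.

End PolygonalCurves.

(** * Lattice walks in a domain without holes *)

Section SimplyConnected.
Variable R : realType.
Local Notation C := R[i].
Implicit Types (z w : C) (u v c : vtx).

Variables (T : set C) (h : R).
Hypothesis h0 : 0 < h.
Hypothesis T_outer : ~` T `<=` outer T.

Definition grid_point v : C := (v.1%:~R * h +i* (v.2%:~R * h))%C.

Definition grid_square c : set C :=
  [set z | c.1%:~R * h <= complex.Re z <= (c.1 + 1)%:~R * h /\
           c.2%:~R * h <= complex.Im z <= (c.2 + 1)%:~R * h].

Definition good_edge u v := adj u v /\ cseg (grid_point u) (grid_point v) `<=` T.

Definition good_square c := grid_square c `<=` T.

Lemma interval_segment (a b x y t : R) : a <= x <= b -> a <= y <= b ->
  0 <= t <= 1 -> a <= x + t * (y - x) <= b.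
Proof.
move=> /andP[ax xb] /andP[ay yb] /andP[t0 t1].
have -> : x + t * (y - x) = (1 - t) * x + t * y by ring.
have t1' : 0 <= 1 - t by rewrite subr_ge0.
have h1 := ler_wpM2l t1' ax; have h2 := ler_wpM2l t1' xb.
have h3 := ler_wpM2l t0 ay; have h4 := ler_wpM2l t0 yb.
by apply/andP; split; lra.
Qed.

Lemma cseg_coord z w (v : C) : cseg z w v -> exists2 t : R, 0 <= t <= 1 &
  complex.Re v = complex.Re z + t * (complex.Re w - complex.Re z) /\
  complex.Im v = complex.Im z + t * (complex.Im w - complex.Im z).
Proof.
move=> [t /=]; rewrite in_itv /= => t01 <-; exists t => //.
by case: z w => [a b] [a' b'] /=; split; ring.
Qed.

Lemma coord_cseg z w (v : C) (t : R) : 0 <= t <= 1 ->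
  complex.Re v = complex.Re z + t * (complex.Re w - complex.Re z) ->
  complex.Im v = complex.Im z + t * (complex.Im w - complex.Im z) -> cseg z w v.
Proof.
move=> t01; case: v z w => [x y] [a b] [a' b'] /= ex ey; exists t.
  by rewrite /= in_itv.
by rewrite /= ex ey; apply/eqP; rewrite eq_complex /=; apply/andP; split;
  apply/eqP; ring.
Qed.

Lemma grid_square_convex c : convex_set (grid_square c).
Proof.
move=> z w [z1 z2] [w1 w2] v /cseg_coord[t t01 [e1 e2]].
by rewrite /grid_square /= e1 e2; split; exact: interval_segment.
Qed.

Lemma corner_grid_square c u : corner c u -> grid_square c (grid_point u).
Proof.
rewrite /corner => /andP[h1 h2]; rewrite /grid_square /= !ler_pM2r // !ler_int.
by split; lia.
Qed.

Lemma good_edge_sym u v : good_edge u v -> good_edge v u.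
Proof.
move=> [uv uvT]; split; first by move: uv; rewrite /adj; lia.
by move=> z zvu; apply: uvT; apply: (cseg_convex (cseg_r _ _) (cseg_l _ _) zvu).
Qed.

Lemma good_edge_refl u v : good_edge u v -> good_edge u u.
Proof.
move=> [uv uvT]; split; first by rewrite /adj; lia.
by move=> z zuu; apply: uvT; apply: (cseg_convex (cseg_l _ _) (cseg_l _ _) zuu).
Qed.

Lemma good_square_edge c u v : good_square c -> corner c u -> corner c v ->
  adj u v -> good_edge u v.
Proof.
move=> cT cu cv uv; split=> // z zuv; apply: cT.
exact: (grid_square_convex (corner_grid_square cu) (corner_grid_square cv) zuv).
Qed.

Section Winding.
Variables (M i j : nat) (s : nat -> vtx).
Hypotheses (ws : walk M good_edge s) (ij : (i <= j)%N) (jM : (j <= M)%N).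
Hypothesis sij : s i = s j.

Let s_adj k : (i <= k < j)%N -> adj (s k) (s k.+1).
Proof. by move=> kij; apply: (ws _).1; lia. Qed.

Let not_used z p q : ~ T z -> cseg (grid_point p) (grid_point q) z ->
  forall k, (i <= k < j)%N ->
    ~ (s k = p /\ s k.+1 = q) /\ ~ (s k.+1 = p /\ s k = q).
Proof.
move=> Tz zpq k kij.
have [_ e] : good_edge (s k) (s k.+1) by apply: ws; lia.
have [_ e'] := good_edge_sym (conj (s_adj kij) e).
by split=> -[e1 e2]; apply: Tz; [apply: e|apply: e']; rewrite e1 e2.
Qed.

Let wind_next_right z c : ~ T z -> grid_square c z ->
  grid_square (c.1 + 1, c.2) z -> wind s i j c = wind s i j (c.1 + 1, c.2).
Proof.
move=> Tz [/andP[_ z1] /andP[z2 z3]] [/= /andP[z1' _] _].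
apply: wind_right => //; apply: (not_used Tz).
have hz : 0 < (c.2 + 1)%:~R * h - c.2%:~R * h.
  by rewrite -mulrBl -rmorphB /= addrAC subrr add0r mul1r.
apply: (@coord_cseg _ _ _ ((complex.Im z - c.2%:~R * h) / ((c.2 + 1)%:~R * h - c.2%:~R * h))).
- by rewrite ler_pdivlMr // ler_pdivrMr // mul0r mul1r; apply/andP; split; lra.
- by rewrite /= subrr mulr0 addr0; apply/eqP; rewrite eq_le z1 z1'.
- by rewrite /= divfK ?gt_eqF // subrKC.
Qed.

Let wind_next_above z c : ~ T z -> grid_square c z ->
  grid_square (c.1, c.2 + 1) z -> wind s i j c = wind s i j (c.1, c.2 + 1).
Proof.
move=> Tz [/andP[z2 z3] /andP[_ z1]] [_ /= /andP[z1' _]].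
apply: wind_above; apply: (not_used Tz).
have hz : 0 < (c.1 + 1)%:~R * h - c.1%:~R * h.
  by rewrite -mulrBl -rmorphB /= addrAC subrr add0r mul1r.
apply: (@coord_cseg _ _ _ ((complex.Re z - c.1%:~R * h) / ((c.1 + 1)%:~R * h - c.1%:~R * h))).
- by rewrite ler_pdivlMr // ler_pdivrMr // mul0r mul1r; apply/andP; split; lra.
- by rewrite /= divfK ?gt_eqF // subrKC.
- by rewrite /= subrr mulr0 addr0; apply/eqP; rewrite eq_le z1 z1'.
Qed.

Let near_index (m m' : int) (x : R) : m%:~R * h <= x <= (m + 1)%:~R * h ->
  m'%:~R * h <= x <= (m' + 1)%:~R * h -> [\/ m' = m, m' = m + 1 | m = m' + 1].
Proof.
move=> /andP[a1 a2] /andP[b1 b2].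
have c1 : m%:~R * h <= (m' + 1)%:~R * h := le_trans a1 b2.
have c2 : m'%:~R * h <= (m + 1)%:~R * h := le_trans b1 a2.
rewrite !ler_pM2r // !ler_int in c1 c2.
have [e|[e|e]] : m' = m \/ m' = m + 1 \/ m = m' + 1 by lia.
- by constructor 1.
- by constructor 2.
- by constructor 3.
Qed.

(** The walk cannot use an edge through a point off [T], so squares sharing such an edge have the
    same winding number. Squares meeting diagonally at [z] are compared through the square
    [(c'.1, c.2)], which also contains [z]. *)
Lemma wind_touching z c c' : ~ T z -> grid_square c z -> grid_square c' z ->
  wind s i j c = wind s i j c'.
Proof.
move=> Tz cz cz'; have cz1 := cz; have cz1' := cz'.
case: cz1 cz1' => [x1 y1] [x2 y2].
have dz : grid_square (c'.1, c.2) z by [].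
apply: (@eq_trans _ _ (wind s i j (c'.1, c.2))).
  case: (near_index x1 x2) => e.
  - by rewrite e; case: (c).
  - by rewrite e in dz *; exact: (wind_next_right Tz cz dz).
  - have := wind_next_right Tz dz; rewrite /= -e.
    have cE : (c.1, c.2) = c by case: (c).
    by rewrite cE => /(_ cz).
case: (near_index y1 y2) => e.
- by rewrite -e; case: (c').
- have := wind_next_above Tz dz; rewrite /= -e.
  have cE : (c'.1, c'.2) = c' by case: (c').
  by rewrite cE => /(_ cz').
- have := wind_next_above Tz cz'; rewrite /= -e => /(_ dz) <-.
  by case: (c').
Qed.

Definition cell_of z : vtx :=
  (Num.floor (complex.Re z / h), Num.floor (complex.Im z / h)).

Lemma floor_cell (x : R) : (Num.floor (x / h))%:~R * h <= x < (Num.floor (x / h) + 1)%:~R * h.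
Proof.
rewrite -ler_pdivlMr // -ltr_pdivrMr // -floor_ge_int lexx /=.
by rewrite -floor_lt_int ltrDl.
Qed.

Lemma cell_ofP z : grid_square (cell_of z) z.
Proof.
have /andP[x1 x2] := floor_cell (complex.Re z).
have /andP[y1 y2] := floor_cell (complex.Im z).
by rewrite /grid_square /= x1 y1 !ltW.
Qed.

(** The floor jumps, but the closed cell of any number near [x] still contains [x]; with
    [wind_touching] this makes the winding number locally constant off [T]. *)
Lemma floor_near (x : R) : exists2 d : R, 0 < d & forall y, `|y - x| < d ->
  (Num.floor (y / h))%:~R * h <= x <= (Num.floor (y / h) + 1)%:~R * h.
Proof.
have /andP[x1 x2] := floor_cell x; set m := Num.floor (x / h) in x1 x2.
have hm : (m + 1)%:~R * h = m%:~R * h + h by rewrite intrD mulrDl mul1r.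
have out y : `|y - x| < (m + 1)%:~R * h - x -> y < (m + 1)%:~R * h.
  by rewrite ltr_norml => /andP[? ?]; lra.
have [e|e] := eqVneq x (m%:~R * h).
  exists h => // y; rewrite ltr_norml => /andP[y1 y2].
  have /andP[f1 f2] := floor_cell y; set n := Num.floor (y / h) in f1 f2 *.
  have nm : n < m + 1.
    by rewrite -(ltr_int R) -(ltr_pM2r h0) hm; apply: le_lt_trans f1 _; lra.
  have mn : m < n + 2.
    rewrite -(ltr_int R) -(ltr_pM2r h0).
    have -> : (n + 2)%:~R * h = (n + 1)%:~R * h + h by rewrite !intrD; ring.
    by rewrite -e; lra.
  rewrite {1 2}e !ler_pM2r // !ler_int; apply/andP; split; lia.
have lt : m%:~R * h < x by rewrite lt_def e.
exists (Num.min (x - m%:~R * h) ((m + 1)%:~R * h - x)).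
  by rewrite lt_min !subr_gt0 lt.
move=> y; rewrite lt_min => /andP[y1 y2].
have yy : m%:~R * h <= y < (m + 1)%:~R * h.
  by rewrite out // andbT; move: y1; rewrite ltr_norml => /andP[? ?]; lra.
have /andP[f1 f2] := floor_cell y; set n := Num.floor (y / h) in f1 f2 *.
have -> : n = m.
  move: yy => /andP[g1 g2].
  have := le_lt_trans f1 g2; have := le_lt_trans g1 f2.
  by rewrite !ltr_pM2r // !ltr_int => n1 n2; apply/eqP; rewrite eq_le -!ltzD1 n1 n2.
by rewrite x1 ltW.
Qed.

(* A square meeting the complement of [T] is joined to infinity off [T], and the
   winding number is locally constant there. *)
Lemma wind_good_square c : wind s i j c <> 0 -> good_square c.
Proof.
move=> wc z cz; apply: contrapT => Tz; apply: wc.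
have [X [cX XT Xz bX]] := T_outer Tz.
have [B BP] : exists B : int, forall k, (i <= k <= j)%N ->
    [/\ (s k).1 <= B, - B <= (s k).1, (s k).2 <= B & - B <= (s k).2].
  have := ij => /subnKC <-; elim: (j - i)%N => [|m [B BP]].
    exists (`|(s i).1| + `|(s i).2|) => k ki; have -> : k = i by lia.
    by split; lia.
  exists (`|B| + (`|(s (i + m).+1).1| + `|(s (i + m).+1).2|)) => k ki.
  have [->|kl] := eqVneq k (i + m).+1; first by split; lia.
  have [|h1 h2 h3 h4] := BP k; first by lia.
  by split; lia.
rewrite (wind_touching Tz cz (cell_ofP z)).
have loc w : X w -> exists2 d : R, 0 < d & forall w', cmod (w' - w) < d ->
    wind s i j (cell_of w') = wind s i j (cell_of w).
  move=> Xw; have [d1 d10 d1P] := floor_near (complex.Re w).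
  have [d2 d20 d2P] := floor_near (complex.Im w).
  exists (Num.min d1 d2); first by rewrite lt_min d10.
  move=> w'; rewrite lt_min => /andP[w1 w2].
  apply: (@wind_touching w); [exact: XT| |exact: cell_ofP].
  split.
    apply: d1P; apply: le_lt_trans w1; rewrite -raddfB; exact: Re_le_cmod.
  apply: d2P; apply: le_lt_trans w2; rewrite -raddfB; exact: Im_le_cmod.
have con : X `<=` [set w | wind s i j (cell_of w) = wind s i j (cell_of z)].
  apply: (connected_clopen cX); first by exists z.
  - by move=> w /loc[d d0 dP] /= <-; exists d => // w' _ /dP.
  - by move=> w /loc[d d0 dP] /= nw; exists d => // w' _ /dP ->.
  - by exists z.
have [w [Xw w_far]] : exists w, X w /\
    ((B + 2)%:~R * h < `|complex.Re w| \/ (B + 2)%:~R * h < `|complex.Im w|).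
  apply: contrapT => H; apply: bX; apply/boundedP.
  exists ((B + 2)%:~R * h + (B + 2)%:~R * h) => w Xw.
  apply: le_trans (cmod_le_ReIm w) _.
  by apply: lerD; rewrite leNgt; apply/negP => wl; apply: H; exists w; split=> //;
    [left|right].
rewrite -(con w Xw); apply: wind_far => //.
have big (x : R) : (B + 2)%:~R * h < `|x| ->
    B <= Num.floor (x / h) \/ Num.floor (x / h) < - B.
  rewrite -ltr_pdivlMr // => xB.
  have {}xB : (B + 2)%:~R < `|x / h| by rewrite normrM normfV (gtr0_norm h0).
  rewrite intrD in xB.
  have [x0|x0] := leP 0 (x / h).
    left; rewrite floor_ge_int; move: xB; rewrite ger0_norm //; lra.
  right; rewrite floor_lt_int rmorphN /=; move: xB; rewrite ltr0_norm //; lra.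
rewrite /cell_of; case: w_far => /big[hB|hB].
- by constructor 3 => k /BP[? ? ? ?] /=; lia.
- by constructor 4 => k /BP[? ? ? ?] /=; lia.
- by constructor 1 => k /BP[? ? ? ?] /=; lia.
- by constructor 2 => k /BP[? ? ? ?] /=; lia.
Qed.

End Winding.

Definition grid_polygon (M : nat) (s : nat -> vtx) :=
  polygon (fun k => grid_point (s k)) M.

(** The property carried through the contraction is null-homotopy of the polygon. An elementary move
    changes two segments within one convex cell of [T], so the old and new polygons are joined by
    straight lines in [T]. *)
Lemma grid_polygon_null M s : (0 < M)%N -> walk M good_edge s -> s 0%N = s M ->
  null_homotopic_in T (grid_polygon M s).
Proof.
move=> M0 ws s0M.
pose N s := s 0%N = s M -> null_homotopic_in T (grid_polygon M s).
suff : N s by exact.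
apply: (@contract_walk M good_edge good_square _ _ _ _ _ N _ (nsteps s 0 M) s 0 M) => //.
- by move=> u v [].
- exact: good_edge_sym.
- exact: good_edge_refl.
- exact: good_square_edge.
- by move=> s' i j c ws' ij jM s'ij; apply: (wind_good_square ws' ij jM s'ij).
- move=> {ws s0M} s k v ws k0M Epv Evn cell Ns s0M.
  have s'0 : setr s k k.+1 v 0%N = s 0%N by rewrite setr_out //; lia.
  have s'M : setr s k k.+1 v M = s M by rewrite setr_out //; lia.
  apply: (@null_homotopic_line R T _ (grid_polygon M (setr s k k.+1 v))).
  + exact: polygon_cont.
  + exact: polygon_cont.
  + by rewrite /grid_polygon polygon0 polygon1 s0M.
  + by rewrite /grid_polygon polygon0 polygon1 s'0 s'M s0M.
  + move=> t t01; have [j [u [jM u01 _ tP]]] := polygon_segment M0 t01.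
    rewrite /grid_polygon !tP.
    suff [K [KT cK [K1 K2 K3 K4]]] : exists K : set C, [/\ K `<=` T, convex_set K &
        [/\ K (grid_point (s j)), K (grid_point (s j.+1)),
          K (grid_point (setr s k k.+1 v j)) & K (grid_point (setr s k k.+1 v j.+1))]].
      move=> z zz; apply: KT; apply: (cK _ _ _ _ _ zz).
        by apply: (cK _ _ K1 K2); exact: cseg_mem.
      by apply: (cK _ _ K3 K4); exact: cseg_mem.
    have [K [KT cK [K1 K2 K3 K4]]] : exists K : set C, [/\ K `<=` T, convex_set K &
        [/\ K (grid_point (s k.-1)), K (grid_point (s k)),
          K (grid_point v) & K (grid_point (s k.+1))]].
      case: cell => [[p [q [[_ pqT] [c1 c2 c3 c4]]]]|[c cT /and4P[c1 c2 c3 c4]]].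
        exists (cseg (grid_point p) (grid_point q)); split=> //.
          exact: cseg_convex.
        by split; [case: c1|case: c2|case: c3|case: c4] => ->;
          [exact: cseg_l|exact: cseg_r|exact: cseg_l|exact: cseg_r|
           exact: cseg_l|exact: cseg_r|exact: cseg_l|exact: cseg_r].
      exists (grid_square c); split=> //; first exact: grid_square_convex.
      by split; exact: corner_grid_square.
    have vk : setr s k k.+1 v k = v by rewrite /setr leqnn ltnSn.
    have [jk|jk] := eqVneq j k.
      exists K; split=> //; rewrite jk vk; split=> //.
      by rewrite setr_out // leqnn orbT.
    have [jk1|jk1] := eqVneq j.+1 k.
      have jE : j = k.-1 by lia.
      exists K; split=> //; rewrite jk1 vk jE; split=> //.
      by rewrite setr_out //; lia.
    exists (cseg (grid_point (s j)) (grid_point (s j.+1))); split.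
    * by case: (ws j jM).
    * exact: cseg_convex.
    * rewrite !setr_out; [|lia|lia].
      by split; [exact: cseg_l|exact: cseg_r|exact: cseg_l|exact: cseg_r].
  + by apply: Ns; rewrite s'0 s'M.
- by rewrite leqnn.
- move=> _; apply: (@eq_null_homotopic R T _ (fun=> grid_point (s 0%N))).
    move=> t t01; have [j [u [jM u01 _ tP]]] := polygon_segment M0 t01.
    rewrite /grid_polygon tP /flat /setr !ifT; [|lia|lia].
    by rewrite subrr mulr0 addr0.
  apply: null_homotopic_cst; have [_] := ws 0%N M0; apply; exact: cseg_l.
Qed.

End SimplyConnected.

(** * Approximation of curves by lattice walks *)

Section CurveApproximation.
Variable R : realType.
Local Notation C := R[i].

(** If no [d] worked, parameters bad for 1 / (n + 1) would accumulate at some [p] of the segment,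
    whose own radius [r p] covers those of large index close to it. *)
Lemma lebesgue_number (r : R -> R) : (forall t, 0 <= t <= 1 -> 0 < r t) ->
  exists2 d : R, 0 < d & forall t, 0 <= t <= 1 ->
    exists2 t0, 0 <= t0 <= 1 & `|t - t0| + d < r t0.
Proof.
move=> r0; apply: contrapT => H.
have bad (n : nat) : exists t, 0 <= t <= 1 /\
    forall t0, 0 <= t0 <= 1 -> r t0 <= `|t - t0| + n.+1%:R^-1.
  apply: contrapT => Hn; apply: H; exists n.+1%:R^-1; first by rewrite invr_gt0.
  move=> t t01; apply: contrapT => Ht; apply: Hn; exists t; split=> // t0 t001.
  by rewrite leNgt; apply/negP => lt; apply: Ht; exists t0.
have [u uP] := choice bad.
have : (u @ \oo) `[0, 1]%classic.
  by exists 0%N => // n _; rewrite /= in_itv /=; case: (uP n).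
move=> /(@segment_compact R 0 1 _ _)[p [/=]]; rewrite in_itv /= => p01 clp.
have rp := r0 p p01.
have rp2 : 0 < r p / 2 by rewrite divr_gt0.
pose n0 := Num.truncn (r p / 2)^-1.
have [||_ [[n n0n <-] /= pn]] := clp (u @` [set n | (n0 <= n)%N]) (ball p (r p / 2)).
- by exists n0 => // n n0n; exists n.
- exact: nbhsx_ballx.
have [_ /(_ p p01)] := uP n; rewrite leNgt => /negP; apply.
have pn' : `|u n - p| < r p / 2 by move: pn; rewrite /ball /= distrC.
have : n.+1%:R^-1 <= r p / 2.
  rewrite -[r p / 2]invrK lef_pV2 ?posrE ?invr_gt0 //.
  by apply: (le_trans (ltW (truncnS_gt _))); rewrite ler_nat ltnS.
by move=> h; rewrite [r p]splitr ltr_leD.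
Qed.

Lemma cont01_modulus (g : R -> C) (e : R) : cont01 g -> 0 < e ->
  exists2 d : R, 0 < d & forall t t', 0 <= t <= 1 -> 0 <= t' <= 1 ->
    `|t - t'| < d -> cmod (g t - g t') < e.
Proof.
move=> cg e0; have e2 : 0 < e / 2 by rewrite divr_gt0.
have [r rP] := choice (fun t => let H := pselect (0 <= t <= 1) in
  match H return exists r : R, 0 <= t <= 1 -> 0 < r /\
     forall t', 0 <= t' <= 1 -> `|t' - t| < r -> cmod (g t' - g t) < e / 2 with
  | left t01 => let: ex_intro2 d d0 dP := cg t t01 _ e2 in
     ex_intro _ d (fun _ => conj d0 dP)
  | right nt => ex_intro _ 0 (fun t01 => False_ind _ (nt t01)) end).
have [|d d0 dP] := @lebesgue_number r; first by move=> t /rP[].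
exists d => // t t' t01 t'01 tt'; have [t0 t001 h] := dP t t01.
have [_ rP0] := rP t0 t001.
have h1 : cmod (g t - g t0) < e / 2 by apply: rP0 => //; lra.
have h2 : cmod (g t' - g t0) < e / 2.
  apply: rP0 => //; have := ler_normD (t' - t) (t - t0).
  by rewrite addrA subrK (distrC t' t); lra.
have := cmodB_trans (g t0) (g t) (g t'); rewrite (cmodB (g t0)); lra.
Qed.

Lemma curve_gap (g : R -> C) (T : set C) : cont01 g -> open T ->
  (forall t, 0 <= t <= 1 -> T (g t)) ->
  exists2 d : R, 0 < d & forall t, 0 <= t <= 1 -> cball (g t) d `<=` T.
Proof.
move=> cg oT gT.
have [r rP] : {r : R -> R & forall t, 0 <= t <= 1 -> 0 < r t /\
    forall t', 0 <= t' <= 1 -> `|t' - t| < r t -> cball (g t') (r t) `<=` T}.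
  apply: (@choice _ _ (fun t r => 0 <= t <= 1 -> 0 < r /\
    forall t', 0 <= t' <= 1 -> `|t' - t| < r -> cball (g t') r `<=` T)) => t.
  have [t01|nt] := pselect (0 <= t <= 1); last by exists 0.
  have [e e0 eT] := (openP T).1 oT _ (gT t t01).
  have e2 : 0 < e / 2 by rewrite divr_gt0.
  have [d d0 dP] := cg t t01 _ e2.
  exists (Num.min d (e / 2)) => _; split; first by rewrite lt_min d0.
  move=> t' t'01; rewrite lt_min => /andP[tt' _] z; rewrite /cball /= lt_min.
  move=> /andP[_ zt']; apply: eT; rewrite /cball /=.
  by have := cmodB_trans (g t') z (g t); have := dP t' t'01 tt'; lra.
have [|d d0 dP] := @lebesgue_number r; first by move=> t /rP[].
exists d => // t t01 z zt; have [t0 t001 h] := dP t t01.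
have [_ rP0] := rP t0 t001; apply: (rP0 t t01); first by lra.
rewrite /cball /=; apply: lt_trans zt _; have := normr_ge0 (t - t0); lra.
Qed.

Lemma floor_adj (h x y : R) : 0 < h -> `|x - y| < h ->
  `|Num.floor (x / h) - Num.floor (y / h)| <= 1.
Proof.
move=> h0; rewrite ltr_norml => /andP[xy1 xy2].
have /andP[x1 x2] := floor_cell h0 x; have /andP[y1 y2] := floor_cell h0 y.
set m := Num.floor (x / h) in x1 x2 *; set n := Num.floor (y / h) in y1 y2 *.
have hS (k : int) : (k + 1)%:~R * h = k%:~R * h + h by rewrite intrD mulrDl mul1r.
have a1 : m < n + 1 + 1.
  by rewrite -(ltr_int R) -(ltr_pM2r h0) hS; lra.
have a2 : n < m + 1 + 1.
  by rewrite -(ltr_int R) -(ltr_pM2r h0) hS; lra.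
lia.
Qed.

(** The curve is joined by straight lines to a lattice walk built from the lower left corners of the
    cells it visits; everything stays within [rho] of the curve, hence in [T]. *)
Lemma outer_null_homotopic (T : set C) g : open T -> ~` T `<=` outer T ->
  closed_curve_in T g -> null_homotopic_in T g.
Proof.
move=> oT T_outer [/cont01P cg g01 gT].
have {}gT t : 0 <= t <= 1 -> T (g t).
  by move=> t01; apply: gT; exists t; rewrite //= in_itv.
have [rho rho0 rhoT] := curve_gap cg oT gT.
(* Vertices of the walk are within [4 * h] of the curve at the same time, and both ends of a segment
   are within [6 * h] of the curve at any time of its interval. *)
pose h := rho / 8; have h0 : 0 < h by rewrite divr_gt0.
have [d d0 dP] := cont01_modulus cg h0.
have [L Lpos Ld] : exists2 L : nat, (0 < L)%N & L%:R^-1 < d.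
  exists (Num.truncn d^-1).+1 => //.
  by rewrite -[X in _ < X]invrK ltf_pV2 ?posrE ?invr_gt0 // truncnS_gt.
pose M := (L + L)%N; have Mpos : (0 < M)%N by rewrite addn_gt0 Lpos.
have L0 : 0 < L%:R :> R by rewrite ltr0n.
have M0 : 0 < M%:R :> R by rewrite ltr0n.
have ML : M%:R = L%:R + L%:R :> R by rewrite natrD.
have LE : L%:R^-1 = 2 * M%:R^-1 :> R.
  have -> : M%:R = 2 * L%:R :> R by rewrite ML; ring.
  by rewrite invfM mulrA divff ?mul1r.
have frac01 (N k : nat) : (0 < N)%N -> (k <= N)%N -> 0 <= (k%:R / N%:R : R) <= 1.
  by move=> N0 kN; rewrite divr_ge0 ?ler0n //= ler_pdivrMr ?ltr0n // mul1r ler_nat.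
pose v i : vtx := cell_of h (g (i%:R / L%:R)).
(* Successive cells may be diagonal neighbours, so each of the [L] steps is split in two: rounding
   the half index up in one coordinate and down in the other gives a horizontal move followed by a
   vertical one. *)
pose s k : vtx := ((v (uphalf k)).1, (v k./2).2).
have close i k : (i <= L)%N -> (k <= M)%N -> (k <= i.*2.+1)%N -> (i.*2 <= k.+1)%N ->
    cmod (g (i%:R / L%:R) - g (k%:R / M%:R)) < h.
  move=> iL kM ki ik; apply: dP; [exact: frac01|exact: frac01|].
  have -> : i%:R / L%:R - k%:R / M%:R = (i.*2%:R - k%:R) / M%:R :> R.
    rewrite mulrBl -muln2 natrM; congr (_ - _); rewrite -mulrA; congr (_ * _).
    exact: LE.
  rewrite normrM normfV (gtr0_norm M0); apply: le_lt_trans Ld; rewrite LE.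
  have : `|i.*2%:R - k%:R| <= 1 :> R.
    have a1 : k%:R <= i.*2%:R + 1 :> R by rewrite natr1 ler_nat.
    have a2 : i.*2%:R <= k%:R + 1 :> R by rewrite natr1 ler_nat.
    by rewrite ler_norml; apply/andP; split; lra.
  have M1 : 0 < M%:R^-1 :> R by rewrite invr_gt0.
  by rewrite ler_pM2r // => a3; apply: le_trans a3 _; rewrite ler1n.
have near k : (k <= M)%N -> cmod (grid_point h (s k) - g (k%:R / M%:R)) <= 4 * h.
  move=> kM; apply: le_trans (cmod_le_ReIm _) _.
  have c1 := close (uphalf k) k; have c2 := close k./2 k.
  have {}c1 : cmod (g ((uphalf k)%:R / L%:R) - g (k%:R / M%:R)) < h.
    by apply: c1; rewrite // ?/M; lia.
  have {}c2 : cmod (g (k./2%:R / L%:R) - g (k%:R / M%:R)) < h.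
    by apply: c2; rewrite // ?/M; lia.
  rewrite !raddfB /=; set a := g (k%:R / M%:R) in c1 c2 *.
  have f1 := floor_cell h0 (complex.Re (g ((uphalf k)%:R / L%:R))).
  have f2 := floor_cell h0 (complex.Im (g (k./2%:R / L%:R))).
  have hS (m : int) : (m + 1)%:~R * h = m%:~R * h + h by rewrite intrD mulrDl mul1r.
  rewrite !hS in f1 f2; move: f1 f2 => /andP[? ?] /andP[? ?].
  have := le_lt_trans (Re_le_cmod _) c1; have := le_lt_trans (Im_le_cmod _) c2.
  rewrite !raddfB /= !ltr_norml => /andP[? ?] /andP[? ?].
  rewrite (_ : 4 * h = 2 * h + 2 * h); last by ring.
  by apply: lerD; rewrite ler_norml; apply/andP; split; lra.
have step k : (k < M)%N -> cmod (g (k.+1%:R / M%:R) - g (k%:R / M%:R)) < h.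
  move=> kM; apply: dP; [apply: frac01; rewrite // ltnW|apply: frac01; rewrite // ltnW|] => //.
  rewrite -mulrBl -natr1 addrAC subrr add0r mul1r normfV gtr0_norm //.
  by apply: lt_trans Ld; rewrite LE; have : 0 < M%:R^-1 :> R; [rewrite invr_gt0|lra].
have vstep i : (i < L)%N -> cmod (g (i.+1%:R / L%:R) - g (i%:R / L%:R)) < h.
  move=> iL; apply: dP; [exact: frac01|apply: frac01; rewrite // ltnW|] => //.
  by rewrite -mulrBl -natr1 addrAC subrr add0r mul1r normfV gtr0_norm.
have s_adj k : (k < M)%N -> adj (s k) (s k.+1).
  move=> kM; rewrite /adj /s /=.
  have [i [ek|ek]] : exists i, k = i.*2 \/ k = i.*2.+1.
    exists k./2; have := odd_double_half k; case: (odd k) => /=; lia.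
  - have -> : uphalf k = i by lia.
    have -> : k./2 = i by lia.
    have iL : (i < L)%N by rewrite /M in kM; lia.
    rewrite subrr normr0 addr0 distrC; apply: floor_adj => //.
    by rewrite -raddfB; apply: le_lt_trans (Re_le_cmod _) (vstep i iL).
  - have -> : uphalf k = i.+1 by lia.
    have -> : k./2 = i by lia.
    have iL : (i < L)%N by rewrite /M in kM; lia.
    rewrite subrr normr0 add0r distrC; apply: floor_adj => //.
    by rewrite -raddfB; apply: le_lt_trans (Im_le_cmod _) (vstep i iL).
have rho8 : rho = 8 * h by rewrite /h; field.
have ws : walk M (good_edge T h) s.
  move=> k kM; split; first exact: s_adj.
  move=> z zs; apply: (rhoT (k%:R / M%:R)); first by apply: frac01; lia.
  have n1 := near k (ltnW kM); have n2 := near k.+1 kM; have n3 := step k kM.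
  apply: (cball_convex _ _ zs); rewrite /cball /= rho8; first by lra.
  have := cmodB_trans (g (k.+1%:R / M%:R)) (grid_point h (s k.+1)) (g (k%:R / M%:R)).
  by lra.
have s0M : s 0%N = s M.
  have -> : s M = ((v L).1, (v L).2) by rewrite /s /M addnn uphalf_double doubleK.
  by rewrite /s /= /v mul0r divff ?gt_eqF // g01.
apply: (@null_homotopic_line R T g (grid_polygon h M s)) => //.
- exact: polygon_cont.
- by rewrite /grid_polygon polygon0 polygon1 s0M.
- move=> t t01; have [j [u [jM u01 tj tP]]] := polygon_segment Mpos t01.
  rewrite /grid_polygon tP => z zz; apply: (rhoT t t01).
  apply: (cball_convex _ _ zz); first exact: cball_center.
  have M1 : 0 < M%:R^-1 :> R by rewrite invr_gt0.
  have t1 : cmod (g (j%:R / M%:R) - g t) < h.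
    apply: dP; [by apply: frac01; rewrite // ltnW|exact: t01|].
    by rewrite distrC; apply: le_lt_trans tj _; apply: lt_trans Ld; rewrite LE; lra.
  have n1 := near j (ltnW jM); have n2 := near j.+1 jM; have n3 := step j jM.
  have b1 : cball (g t) rho (grid_point h (s j)).
    rewrite /cball /= rho8.
    by have := cmodB_trans (g (j%:R / M%:R)) (grid_point h (s j)) (g t); lra.
  have b2 : cball (g t) rho (grid_point h (s j.+1)).
    rewrite /cball /= rho8.
    have := cmodB_trans (g (j.+1%:R / M%:R)) (grid_point h (s j.+1)) (g t).
    by have := cmodB_trans (g (j%:R / M%:R)) (g (j.+1%:R / M%:R)) (g t); lra.
  by apply: (cball_convex b1 b2); exact: cseg_mem.
- exact: grid_polygon_null.
Qed.

End CurveApproximation.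

(** * Spider's webs *)

Section SpidersWeb.
Variable R : realType.
Local Notation C := R[i].
Implicit Types (z w p : C) (T V W : set C).

Lemma disc0_cball (r : R) : disc0 r = cball (0 : C) r.
Proof. by apply/seteqP; split=> z; rewrite /cball /disc0 /= subr0. Qed.

(** A disc not contained in the image would, being connected, meet the boundary of the image; but
    that consists of values on the boundary of [V], of modulus at least [b]. *)
Lemma disc0_sub_image (h : C -> C) V (b : R) : cdiff h -> open V -> bounded_set V ->
  disc0 b `&` h @` V !=set0 -> (forall z, boundary V z -> b <= cmod (h z)) ->
  disc0 b `<=` h @` V.
Proof.
move=> dh oV bV meet hb w bw; apply: contrapT => nw.
have [||| y [yb yh]] := @connected_boundary R (disc0 b) (h @` V).
- by rewrite disc0_cball; exact: cball_connected.
- exact: meet.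
- by exists w.
have [z /hb bz hz] := boundary_image dh oV bV yh.
by move: yb; rewrite /disc0 /= -hz ltNge bz.
Qed.

(** The component of 0 in the interior of the image: a boundary point of it lies in the closure of
    the image but not in its interior, hence is a value on the boundary of [V]. *)
Lemma image_domain (h : C -> C) V (b : R) : cdiff h -> open V -> bounded_set V ->
  0 < b -> disc0 b `&` h @` V !=set0 -> (forall z, boundary V z -> b <= cmod (h z)) ->
  exists B : set C, [/\ open B, bounded_set B, connected B, disc0 b `<=` B &
    boundary B `<=` h @` boundary V].
Proof.
move=> dh oV bV b0 meet hb.
have sub := disc0_sub_image dh oV bV meet hb.
have oI : open (interior (h @` V)) by exact: open_interior.
pose B := connected_component (interior (h @` V)) 0.
have db : disc0 b `<=` B.
  have subI : disc0 b `<=` interior (h @` V).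
    by move=> z zb; apply/nbhs_cballP; rewrite disc0_cball in sub zb *;
      have [r r0 rP] := (openP _).1 (@cball_open R 0 b) z zb; exists r => // w /rP /sub.
  apply: connected_component_max => //; first by rewrite /disc0 /mkset cmod0.
  by rewrite disc0_cball; exact: cball_connected.
have Bh : B `<=` h @` V.
  by move=> z /connected_component_sub /interior_subset.
exists B; split=> //.
- exact: component_open.
- have bi : bounded_set (h @` closure V).
    apply: (@bounded_image R h (closure V) _ (@closed_closure _ V) (bounded_closure bV)).
    by move=> z; exact: cdiff_continuous.
  have /boundedP[M MP] := bi.
  apply/boundedP; exists M => z /Bh[w Vw <-]; apply: MP.
  by exists w; [exact: subset_closure|].
- exact: component_connected.
- move=> z bz; apply: (boundary_image dh oV bV); split.
    by case: bz => cz _; exact: closureS Bh _ cz.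
  exact: (component_boundary oI bz).
Qed.

Lemma outer_domain T : open T -> T !=set0 -> connected T -> ~` T `<=` outer T ->
  simply_connected_domain T.
Proof.
move=> oT T0 cT T_outer; split; first by split.
by move=> g; exact: outer_null_homotopic.
Qed.

(** * Construction of the web *)

Section Escaping.
Variables (f : C -> C) (a : nat -> R).
Hypothesis df : cdiff f.
Hypothesis a_gt0 : forall n : nat, (0 < n)%N -> 0 < a n.
Hypothesis a_incr : forall m n : nat, (0 < m)%N -> (m <= n)%N -> a m <= a n.

Local Notation I := (escaping_at_rate f a).

(** For positive [m], this contains the image of [I] under the [m]-th iterate; time [k = 0] is
    included. *)
Definition escaping_from (m : nat) : set C :=
  [set z | forall k : nat, a (m + k)%N <= cmod (iter k f z)].

Lemma escaping_closed : closed I.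
Proof.
rewrite closure_id eqEsubset; split; first exact: subset_closure.
move=> z /closureP cz n n0; apply/ler_addgt0Pr => e e0.
have /continuousP/(_ e e0)[d d0 dP] : {for z, continuous (iter n f)}.
  by apply: cdiff_continuous; exact: cdiff_iter.
have [w Iw /dP wz] := cz d d0; have := Iw n n0.
by have := cmodB_ge (iter n f w) (iter n f z); lra.
Qed.

Lemma escaping_from_sub m : (0 < m)%N -> escaping_from m `<=` I.
Proof.
move=> m0 z Iz n n0; apply: le_trans (Iz n); apply: a_incr => //.
exact: leq_addl.
Qed.

Variables (n : nat) (p : C).
Hypothesis n0 : (0 < n)%N.
Hypothesis p_cycle : forall k, cmod (iter k f p) < a n.

(** The invariant of the domains T_m; holes are allowed here and are removed by [trap_fill]. *)
Definition trap m T := [/\ open T, bounded_set T, connected T, disc0 (a m) `<=` T &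
  boundary T `<=` escaping_from m].

Let cycle_lt m k : (n <= m)%N -> cmod (iter k f p) < a m.
Proof. by move=> nm; apply: lt_le_trans (p_cycle k) _; exact: a_incr. Qed.

Lemma trap_step m T : (n <= m)%N -> trap m T -> exists T', trap m.+1 T'.
Proof.
move=> nm [oT bT cT dT bdT].
have [|||B [oB bB cB dB bdB]] := @image_domain f T (a m.+1) df oT bT.
- exact: a_gt0.
- exists (f p); split; first by apply: (@cycle_lt _ 1); exact: leqW.
  by exists p => //; apply: dT; exact: (@cycle_lt _ 0).
- by move=> z /bdT /(_ 1%N); rewrite addn1.
exists B; split=> // z /bdB[w /bdT Iw <-] k.
by have := Iw k.+1; rewrite iterSr addnS addSn.
Qed.

Lemma trap_all T m : trap n T -> (n <= m)%N -> exists T', trap m T'.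
Proof.
move=> tT /subnKC <-; elim: (m - n)%N => [|k [T' tT']]; first by exists T; rewrite addn0.
by rewrite addnS; apply: (trap_step _ tT'); exact: leq_addr.
Qed.

Lemma trap_boundary_orbit m T W : (n <= m)%N -> trap m T -> open W ->
  bounded_set W -> T `<=` W -> boundary W `&` escaping_from m !=set0.
Proof.
move=> nm [oT bT cT dT bdT] oW bW TW.
have Tp : T p by apply: dT; exact: (@cycle_lt _ 0).
have [|||z bz zP] := @boundary_orbit R f W (fun k => a (m + k)%N) df oW bW.
- by exists p; exact: TW.
- have [y by_] : boundary T !=set0 by apply: bounded_open_boundary => //; exists p.
  (* A constant iterate would take the same value at the boundary point [y], where its modulus is at
     least a_(m+k), and at [p], whose cycle is smaller. *)
  move=> k [c fc]; have := bdT y by_ k; rewrite fc -(fc p) leNgt => /negP; apply.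
  by apply: cycle_lt; exact: leq_trans nm (leq_addr _ _).
- move=> k w wk; have [|||v Tv <-] := @disc0_sub_image (iter k f) T (a (m + k)%N) _ oT bT _ _ w wk.
  + exact: cdiff_iter.
  + exists (iter k f p); split; last by exists p.
    by apply: cycle_lt; exact: leq_trans nm (leq_addr _ _).
  + by move=> z /bdT; apply.
  by exists v => //; exact: TW.
by exists z.
Qed.

Lemma trap_fill m T : (n <= m)%N -> trap m T ->
  exists2 T', trap m T' & connected (~` T') /\ ~` T' `<=` outer T'.
Proof.
move=> nm [oT bT cT dT bdT]; have /boundedP[M MP] := bT.
pose r : R := `|M| + 1; have r0 : 0 < r by rewrite ltr_wpDl.
have Tr z : T z -> cmod z < r.
  by move=> /MP; have := ler_norm M; rewrite /r; lra.
have Tp : T p by apply: dT; exact: (@cycle_lt _ 0).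
exists (fill T).
  split.
  - exact: (fill_open r0 Tr oT).
  - by apply/boundedP; exists r => z /(fill_lt r0 Tr) /ltW.
  - by apply: (fill_connected r0 Tr oT) => //; exists p.
  - by move=> z /dT; exact: sub_fill.
  - by move=> z /(fill_boundary r0 Tr oT) /bdT.
rewrite /fill setCK; split; first exact: (outer_connected r0 Tr).
move=> z oz; exists (outer T); split=> //.
- exact: (outer_connected r0 Tr).
- by rewrite setCK.
- exact: (outer_unbounded r0 Tr).
Qed.

Lemma trap_spiders_web T : a k @[k --> \oo] --> +oo -> trap n T ->
  exists2 E : set C, E `<=` I & spiders_web E.
Proof.
move=> a_oo tT.
have traps m : (n <= m)%N -> exists T', [/\ trap m T', connected (~` T'),
    ~` T' `<=` outer T' & connected (boundary T')].
  move=> nm; have [T1 t1] := trap_all tT nm.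
  have [T' t' [cT' oT']] := trap_fill nm t1; exists T'; split=> //.
  by case: t' => ? ? ? _ _; exact: boundary_connected.
have bdI m T' : (n <= m)%N -> trap m T' -> boundary T' `<=` I.
  move=> nm [_ _ _ _ bdT'] z /bdT'; apply: escaping_from_sub.
  exact: leq_trans nm.
have trap_p m T' : (n <= m)%N -> trap m T' -> T' p.
  by move=> nm [_ _ _ dT' _]; apply: dT'; exact: (@cycle_lt _ 0).
have [T0 [t0 cT0 oT0 cbT0]] := traps n (leqnn n).
have [x bx] : boundary T0 !=set0.
  by case: (t0) => ? ? _ _ _; apply: bounded_open_boundary => //; exists p; exact: trap_p t0.
pose E := connected_component I x.
have Ix : I x := bdI n T0 (leqnn n) t0 x bx.
have bdE : boundary T0 `<=` E.
  by apply: connected_component_max => //; exact: bdI t0.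
have uE : ~ bounded_set E.
  move=> bE; have [N [oN bN EN NI]] := bounded_component_nbhs escaping_closed Ix bE.
  have [oT0' bT0' _ _ _] := t0.
  (* The union has its boundary off I: the boundary of [T0] lies in [E], hence in the open set [N],
     and the boundary of [N] avoids I. *)
  have oW : open (T0 `|` N) by exact: openU.
  have bW : bounded_set (T0 `|` N).
    have /boundedP[M1 M1P] := bT0'; have /boundedP[M2 M2P] := bN.
    apply/boundedP; exists (Num.max M1 M2) => z [/M1P|/M2P] h; rewrite le_max h ?orbT //.
  have [z [bz Iz]] := trap_boundary_orbit (leqnn n) t0 oW bW (@subsetUl _ _ _).
  have nz := open_boundary oW bz; have [cz _] := bz.
  move: cz; rewrite closureU => -[cz|cz].
    case: (closure_boundary oT0' cz) => [Tz|bTz]; first by apply: nz; left.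
    by apply: nz; right; apply: EN; exact: bdE.
  case: (closure_boundary oN cz) => [Nz|bNz]; first by apply: nz; right.
  suff : (boundary N `&` I) z by rewrite NI.
  by split=> //; apply: (escaping_from_sub n0).
(* [G.1] is the domain; [G.2] is the radius of a disc containing it, recorded for the choice of the
   next domain. *)
have web (r : R) : exists G : set C * R, [/\ open G.1, simply_connected_domain G.1,
    disc0 r `<=` G.1, boundary G.1 `<=` E & G.1 `<=` disc0 G.2].
  have [m [nm rm xm]] : exists m, [/\ (n <= m)%N, r <= a m & cmod x < a m].
    have /cvgryPge/(_ (Num.max r (cmod x + 1)))[m0 _ m0P] := a_oo.
    have := m0P (maxn n m0) (leq_maxr _ _); rewrite /= ge_max => /andP[h1 h2].
    by exists (maxn n m0); split; [exact: leq_maxl|exact: h1|lra].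
  have [T' [t' cT' oT' cbT']] := traps m nm.
  have [opT' bT' cnT' d bd] := t'; have /boundedP[M MP] := bT'.
  exists (T', M + 1); split=> //=.
  - by apply: outer_domain => //; exists p; exact: trap_p t'.
  - by move=> z; rewrite /disc0 /= => zr; apply: d; exact: lt_le_trans rm.
  - have [||y [Ey by_]] := @connected_boundary R E T' (@component_connected _ I x).
    + by exists x; split; [exact: connected_component_refl|exact: d].
    + apply: contrapT => H; apply: uE; apply/boundedP; exists M => z Ez.
      by apply: MP; apply: contrapT => nz; apply: H; exists z.
    move=> z bz; apply: connected_component_trans Ey _.
    by exists (boundary T') => //; split=> //; exact: bdI t'.
  - by move=> z /MP; rewrite /disc0 /=; lra.
have [G GP] := choice web.
(* Exceeding the radius recorded for the previous domain makes the sequence increasing; exceeding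
   the index makes it exhaust the plane. *)
pose rho := fix rho j : R := if j is i.+1 then Num.max (G (rho i)).2 i.+1%:R else 1.
exists E; first exact: connected_component_sub.
split; first exact: component_connected.
exists (fun j => (G (rho j)).1); split.
- move=> j; have [oG sc _ _ sub] := GP (rho j); split=> //.
  by apply/boundedP; exists (G (rho j)).2 => z /sub; rewrite /disc0 /= => /ltW.
- move=> j z; have [_ _ _ _ sub] := GP (rho j); have [_ _ sub' _ _] := GP (rho j.+1).
  move=> /sub zj; apply: sub'; move: zj; rewrite /disc0 /= => zj.
  by rewrite lt_max zj.
- by move=> j; have [] := GP (rho j).
apply/seteqP; split=> // z _; exists (Num.truncn (cmod z)).+1 => //.
have [_ _ sub _ _] := GP (rho (Num.truncn (cmod z)).+1); apply: sub.
by rewrite /disc0 /= lt_max truncnS_gt orbT.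
Qed.

End Escaping.
End SpidersWeb.

Theorem theorem1p4 (R : realType) (f : R[i] -> R[i]) (a : nat -> R)
  (f_transc : transcendental_entire f)
  (a_gt0 : forall n : nat, (0 < n)%N -> 0 < a n)
  (a_oo : a n @[n --> \oo] --> +oo)
  (disc_cycle : forall n : nat, (0 < n)%N ->
     exists2 O : set R[i], periodic_cycle f O & O `<=` disc0 (a n))
  (bdd_component : has_bounded_component (~` escaping_at_rate f a))
  (a_incr : forall m n : nat, (0 < m)%N -> (m <= n)%N -> a m <= a n)
  (a_max_modulus : forall n : nat, (0 < n)%N ->
     a n.+1 <= max_modulus f (a n)) :
  exists2 E : set R[i], E `<=` escaping_at_rate f a & spiders_web E.
Proof.
have df : cdiff f by move=> z; apply: entire_cderiv; case: f_transc.
have [z0 Kz0 bU] := bdd_component.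
have [n n0 z0n] : exists2 n, (0 < n)%N & cmod (iter n f z0) < a n.
  apply: contrapT => H; apply: Kz0 => n n0; rewrite leNgt; apply/negP => h.
  by apply: H; exists n.
have [P [p [q [q0 pp PE]]] Pn] := disc_cycle n n0.
have p_cycle k : cmod (iter k f p) < a n.
  by apply: (Pn (iter k f p)); rewrite PE; exists k.
have oK : open (~` escaping_at_rate f a).
  exact/closed_openC/escaping_closed.
set U := connected_component _ z0 in bU.
have oU : open U by exact: component_open.
have bdU : boundary U `<=` escaping_at_rate f a.
  by move=> z /(component_boundary oK); rewrite setCK.
have [||||T [oT bT cT dT bdT]] := @image_domain R (iter n f) U (a n) _ oU bU.
- exact: cdiff_iter.
- exact: a_gt0.
- exists (iter n f z0); split=> //; exists z0 => //.
  exact: connected_component_refl.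
- by move=> z /bdU; apply.
apply: (@trap_spiders_web R f a df a_gt0 a_incr n p n0 p_cycle T a_oo).
(* A boundary point of [T] is f^n(w) with [w] in I, so its orbit is that of [w] from time [n] on. *)
split=> // z /bdT[w /bdU Iw <-] k.
by rewrite -iterD addnC; apply: Iw; rewrite addn_gt0 n0 orbT.
Qed.
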